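(* Let $g\in\mathcal{H}(\mathbb{D})$. Then the following statements are equivalent: (i) $T_g:H^\infty\to H^\infty$ is compact; (ii) $T_g:A\to A$ is compact; (iii) $T_g:H^\infty\to A$ is compact; (iv) $T_g:A\to H^\infty$ is compact; (v) $\{G^{H^2}_{g,z}:z\in\mathbb{D}\}$ is relatively compact in $\mathcal{K}$.
   Context: $\mathbb{D}$ is the open unit disc, $\mathbb{T}$ its boundary, $\mathcal{H}(\mathbb{D})$ the space of analytic functions in $\mathbb{D}$, $H^\infty$ the bounded analytic functions with sup norm, $A$ the disc algebra (functions analytic in $\mathbb{D}$ and continuous on $\overline{\mathbb{D}}$, sup norm). $T_g(f)(z)=\int_0^z f(\zeta)g'(\zeta)\,d\zeta$. $\mathcal{K}$ is the space of Cauchy transforms $(K\mu)(z)=\int_{\mathbb{T}}\frac{d\mu(\xi)}{1-\overline\xi z}$, with $\mu$ a finite complex Borel measure on $\mathbb{T}$, normed by $\|f\|_{\mathcal{K}}=\inf\{\|\mu\|:f=K\mu\}$, where $\|\mu\|$ is the total variation. For $z\in\mathbb{D}$, $G^{H^2}_{g,z}$ is defined by $\overline{G^{H^2}_{g,z}(w)}=\int_0^z\frac{g'(\zeta)}{1-\overline w\zeta}\,d\zeta$, $w\in\overline{\mathbb{D}}$. *)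

(* Defs.v *)
From HB Require Import structures.
From mathcomp Require Import all_boot all_order all_algebra.
From mathcomp Require Import all_classical all_reals all_analysis.
From mathcomp Require Import measurable_realfun.
From mathcomp Require Import complex ring.
Set Implicit Arguments.
Unset Strict Implicit.
Unset Printing Implicit Defensive.
Import Order.TTheory GRing.Theory Num.Theory.
Import numFieldNormedType.Exports.
Local Open Scope classical_set_scope.
Local Open Scope complex_scope.
Local Open Scope ring_scope.

HB.instance Definition _ (R : realType) := NormedModule.copy R[i] R[i]^o.

Section complex_modulus.
Context {R : realType}.
Implicit Types z w : R[i].

(* The library norm `|z| lives in R[i]; cabs z is the same number in R. *)
Definition cabs z : R := complex.Re `|z|.

Lemma normcE z : `|z| = (cabs z)%:C.
Proof. by rewrite /cabs normc_def. Qed.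

Lemma cabs_ge0 z : 0 <= cabs z.
Proof. by rewrite -lecR -normcE normr_ge0. Qed.

Lemma cabs0 : cabs 0 = 0.
Proof. by rewrite /cabs normr0. Qed.

Lemma cabs0_eq0 z : cabs z = 0 -> z = 0.
Proof. by move=> z0; apply/normr0_eq0; rewrite normcE z0. Qed.

Lemma ler_cabsD z w : cabs (z + w) <= cabs z + cabs w.
Proof. by rewrite -lecR rmorphD/= -!normcE ler_normD. Qed.

Lemma cabsM z w : cabs (z * w) = cabs z * cabs w.
Proof. by apply: complexI; rewrite rmorphM/= -!normcE normrM. Qed.

Lemma cabs_le z (r : R) : (cabs z <= r) = (`|z| <= r%:C).
Proof. by rewrite normcE lecR. Qed.

Lemma cabs_lt z (r : R) : (cabs z < r) = (`|z| < r%:C).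
Proof. by rewrite normcE ltcR. Qed.

Lemma cabs_Re z : `|complex.Re z| <= cabs z.
Proof. by rewrite -lecR -normcE normc_ge_Re. Qed.

Lemma cabs_Im z : `|complex.Im z| <= cabs z.
Proof.
have -> : cabs z = cabs (- 'i * z).
  by rewrite cabsM /cabs normrN normc_def/= expr0n/= expr1n add0r sqrtr1 mul1r.
by case: z => a b; rewrite (le_trans _ (cabs_Re _))//= oppr0 mul0r sub0r mulN1r opprK.
Qed.

Lemma cabs_ReIm z : cabs z <= `|complex.Re z| + `|complex.Im z|.
Proof.
case: z => a b; rewrite /cabs normc_def/=.
rewrite -(@ler_pXn2r _ 2)// ?nnegrE ?sqrtr_ge0 ?addr_ge0//.
rewrite sqr_sqrtr ?addr_ge0 ?sqr_ge0// sqrrD !real_normK ?num_real//.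
by rewrite lerD2r lerDl mulrn_wge0// mulr_ge0.
Qed.

End complex_modulus.

Section complex_continuity.
Context {R : realType}.

Lemma lipschitz1_continuous (f : R[i] -> R) :
  (forall z w, `|f z - f w| <= cabs (z - w)) -> continuous f.
Proof.
move=> lf z; apply: (@cvgrPdist_lt _ _ _ (nbhs z) _ f (f z)).2 => e e0.
exists e%:C => [|w]; first by rewrite /= ltcR.
by rewrite /ball_/= -cabs_lt; exact: le_lt_trans (lf _ _).
Qed.

Lemma Re_continuous : continuous (@complex.Re R).
Proof.
apply: lipschitz1_continuous => -[a b] [c d].
exact: le_trans (cabs_Re ((a +i* b) - (c +i* d))).
Qed.

Lemma Im_continuous : continuous (@complex.Im R).
Proof.
apply: lipschitz1_continuous => -[a b] [c d].
exact: le_trans (cabs_Im ((a +i* b) - (c +i* d))).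
Qed.

Lemma cabs_continuous : continuous (@cabs R).
Proof.
apply: lipschitz1_continuous => z w; rewrite ler_norml lerBlDr.
have zw : cabs z <= cabs (z - w) + cabs w by rewrite -{1}(subrK w z) ler_cabsD.
have wz : cabs w <= cabs (w - z) + cabs z by rewrite -{1}(subrK z w) ler_cabsD.
rewrite zw andbT lerBrDr addrC lerBlDr addrC.
by rewrite [cabs (z - w)]/cabs distrC.
Qed.

Lemma complex_cvg (T : Type) (F : set_system T) (FF : Filter F)
    (f : T -> R[i]) (z : R[i]) :
  complex.Re (f x) @[x --> F] --> complex.Re z ->
  complex.Im (f x) @[x --> F] --> complex.Im z ->
  f x @[x --> F] --> z.
Proof.
move=> fRe fIm; apply: (@cvgrPdist_lt _ _ _ F _ f z).2 => -[e e'] /[dup] e0.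
rewrite ltcE/= => /andP[/eqP e'0 e00]; subst e'.
near=> x; rewrite -[_ +i* 0]/(e%:C) -cabs_lt (le_lt_trans (cabs_ReIm _))//.
rewrite (splitr e) ltrD//.
- rewrite (_ : complex.Re _ = complex.Re z - complex.Re (f x)); last first.
    by case: (z) (f x) => [a b] [c d].
  by near: x; move/cvgrPdist_lt : fRe; apply; rewrite divr_gt0.
- rewrite (_ : complex.Im _ = complex.Im z - complex.Im (f x)); last first.
    by case: (z) (f x) => [a b] [c d].
  by near: x; move/cvgrPdist_lt : fIm; apply; rewrite divr_gt0.
Unshelve. all: by end_near. Qed.

Lemma conjc_continuous : continuous (@conjc R).
Proof.
move=> z; apply: (@complex_cvg _ (nbhs z)).
- rewrite (_ : (fun x => _) = @complex.Re R); last by apply/funext => -[].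
  by case: z => a b; exact: (@Re_continuous (a +i* b)).
- rewrite (_ : (fun x => _) = - (@complex.Im R)); last by apply/funext => -[].
  by case: z => a b; exact: (cvgN (@Im_continuous (a +i* b))).
Qed.

Lemma complexRI_continuous : continuous (fun x : R * R => x.1 +i* x.2).
Proof.
by move=> x; apply: (@complex_cvg _ (nbhs x)); [exact: cvg_fst|exact: cvg_snd].
Qed.

End complex_continuity.

Section sup_norm.
Context {R : realType}.
Implicit Types (S : set R[i]) (f g : R[i] -> R[i]).

Definition bounded_on S f := exists M : R, forall z, S z -> cabs (f z) <= M.

Definition sup_norm S f : R := sup [set cabs (f z) | z in S].

Lemma bounded_onD S f g : bounded_on S f -> bounded_on S g ->
  bounded_on S (f + g).
Proof.
move=> [M fM] [N gN]; exists (M + N) => z Sz.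
by rewrite (le_trans (ler_cabsD _ _))// lerD ?fM ?gN.
Qed.

Lemma bounded_onZ S c f : bounded_on S f -> bounded_on S (c *: f).
Proof.
move=> [M fM]; exists (cabs c * M) => z Sz.
by rewrite -[(c *: f) z]/(c * f z) cabsM ler_wpM2l ?cabs_ge0 ?fM.
Qed.

Lemma sup_norm_ub S f z : bounded_on S f -> S z -> cabs (f z) <= sup_norm S f.
Proof.
move=> [M fM] Sz; apply: ub_le_sup; last by exists z.
by exists M => _ [w Sw <-]; exact: fM.
Qed.

Lemma sup_norm_le S f (M : R) : S !=set0 ->
  (forall z, S z -> cabs (f z) <= M) -> sup_norm S f <= M.
Proof.
move=> [z Sz] fM; apply: ge_sup; first by exists (cabs (f z)), z.
by move=> _ [w Sw <-]; exact: fM.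
Qed.

Lemma sup_norm_ge0 S f : S !=set0 -> bounded_on S f -> 0 <= sup_norm S f.
Proof.
by move=> [z Sz] fb; rewrite (le_trans (cabs_ge0 (f z)))// sup_norm_ub.
Qed.

Lemma ler_sup_normD S f g : S !=set0 -> bounded_on S f -> bounded_on S g ->
  sup_norm S (f + g) <= sup_norm S f + sup_norm S g.
Proof.
move=> S0 fb gb; apply: sup_norm_le => // z Sz.
by rewrite (le_trans (ler_cabsD _ _))// lerD ?sup_norm_ub.
Qed.

Lemma ler_sup_normZ S c f : S !=set0 -> bounded_on S f ->
  sup_norm S (c *: f) <= cabs c * sup_norm S f.
Proof.
move=> S0 fb; apply: sup_norm_le => // z Sz.
by rewrite -[(c *: f) z]/(c * f z) cabsM ler_wpM2l ?cabs_ge0 ?sup_norm_ub.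
Qed.

Lemma sup_norm0_eq0 S f z : bounded_on S f -> sup_norm S f = 0 -> S z ->
  f z = 0.
Proof.
move=> fb f0 Sz; apply/cabs0_eq0/eqP.
by rewrite eq_le cabs_ge0 andbT -f0 sup_norm_ub.
Qed.

End sup_norm.

Lemma homogeneous_of_le (R : realType) (V : lmodType R[i]) (p : V -> R) :
  (forall v, 0 <= p v) -> (forall c v, p (c *: v) <= cabs c * p v) ->
  forall c v, (p (c *: v))%:C = `|c| * (p v)%:C.
Proof.
move=> p0 pZ c v; rewrite normcE -rmorphM/=; congr _%:C.
apply/eqP; rewrite eq_le pZ/=.
have [->|c0] := eqVneq c 0; first by rewrite cabs0 mul0r.
have cabsc0 : cabs c != 0 by apply: contra c0 => /eqP/cabs0_eq0 ->.
have := pZ c^-1 (c *: v).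
rewrite scalerA mulVf// scale1r => /(ler_wpM2l (cabs_ge0 c)).
by rewrite mulrA -cabsM divff// /cabs normr1 mul1r.
Qed.

Section function_spaces.
Context {R : realType}.
Local Notation F := (R[i] -> R[i]).

Definition disc : set R[i] := [set z | `|z| < 1].
Definition closed_disc : set R[i] := [set z | `|z| <= 1].

(* derivable is taken over the scalar field R[i]: complex differentiability. *)
Definition analytic (D : set R[i]) (f : F) := forall z, D z -> derivable f z 1.

Lemma disc0 : disc 0. Proof. by rewrite /disc/= normr0. Qed.

Lemma disc_closed_disc : disc `<=` closed_disc.
Proof. by move=> z /ltW. Qed.

Lemma analyticD D f g : analytic D f -> analytic D g -> analytic D (f + g).
Proof. by move=> fD gD z Dz; apply: derivableD; [exact: fD|exact: gD]. Qed.

Lemma analyticZ D c f : analytic D f -> analytic D (c *: f).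
Proof. by move=> fD z Dz; apply: derivableZ; exact: fD. Qed.

Lemma analytic0 D : analytic D 0.
Proof. by move=> z Dz; exact: derivable_cst. Qed.

(* An element of a space of functions on D (resp. its closure) is represented
   by its extension by 0, so that equality of functions is Leibniz equality. *)
Definition Hinf_set : set F := [set f | [/\ analytic disc f,
  bounded_on disc f & forall z, ~ disc z -> f z = 0]].

Definition disc_algebra_set : set F := [set f | [/\ analytic disc f,
  {within closed_disc, continuous f} & forall z, ~ closed_disc z -> f z = 0]].

Definition Hinf_pred : {pred F} := mem Hinf_set.
Definition disc_algebra_pred : {pred F} := mem disc_algebra_set.

Lemma Hinf_predP f : f \in Hinf_pred <-> Hinf_set f.
Proof. by split=> [/set_mem//|?]; exact/mem_set. Qed.

Lemma disc_algebra_predP f : f \in disc_algebra_pred <-> disc_algebra_set f.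
Proof. by split=> [/set_mem//|?]; exact/mem_set. Qed.

Lemma Hinf_submod_closed : submod_closed Hinf_pred.
Proof.
split.
  apply/Hinf_predP; split; [exact: analytic0| |by []].
  by exists 0 => z _; rewrite cabs0.
move=> c f g /Hinf_predP[fan fb f0] /Hinf_predP[gan gb g0].
apply/Hinf_predP; split.
- exact: (analyticD (analyticZ (c := c) fan) gan).
- exact: (bounded_onD (bounded_onZ c fb) gb).
- by move=> z Dz; rewrite -[LHS]/(c * f z + g z) f0// g0// mulr0 addr0.
Qed.

Lemma disc_algebra_submod_closed : submod_closed disc_algebra_pred.
Proof.
split.
  apply/disc_algebra_predP; split; [exact: analytic0| |by []].
  exact: (@continuous_subspaceT _ _ _ (cst 0) (@cst_continuous _ _ 0)).
move=> c f g /disc_algebra_predP[fan fc f0] /disc_algebra_predP[gan gc g0].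
apply/disc_algebra_predP; split.
- exact: (analyticD (analyticZ (c := c) fan) gan).
- move=> z; apply: (@cvgD _ _ _ (nbhs z) _ (c *: f) g); last exact: gc.
  have := @cvgZl_tmp _ _ _ (nbhs z) _ c f (f z) (fc z).
  exact.
- by move=> z Dz; rewrite -[LHS]/(c * f z + g z) f0// g0// mulr0 addr0.
Qed.

Lemma closed_discE :
  closed_disc = [set x.1 +i* x.2 | x in [set x : R * R | x.1 ^+ 2 + x.2 ^+ 2 <= 1]].
Proof.
apply/seteqP; split=> [[a b]|_ [[a b]/= ab1 <-]]; rewrite /closed_disc/=.
  rewrite -cabs_le /cabs normc_def/= => ab1; exists (a, b) => //=.
  by rewrite -(@sqr_sqrtr _ (_ + _)) ?addr_ge0 ?sqr_ge0// expr_le1 ?sqrtr_ge0.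
by rewrite -cabs_le /cabs normc_def/= -(@expr_le1 _ 2)// ?sqrtr_ge0// sqr_sqrtr// addr_ge0 ?sqr_ge0.
Qed.

Lemma closed_disc_compact : compact closed_disc.
Proof.
rewrite closed_discE; apply: continuous_compact.
  by apply: continuous_subspaceT; exact: complexRI_continuous.
have cR : compact (`[(-1 : R), 1] `*` `[(-1 : R), 1]).
  by apply: compact_setX; exact: segment_compact.
apply: (subclosed_compact _ cR).
  apply: (@closed_comp _ _ (fun x : R * R => x.1 ^+ 2 + x.2 ^+ 2)
    [set r | r <= 1]); last exact: closed_le.
  move=> x _; apply: (@cvgD _ _ _ (nbhs x)).
    by apply: (@cvgM _ _ (nbhs x)); exact: cvg_fst.
  by apply: (@cvgM _ _ (nbhs x)); exact: cvg_snd.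
move=> [a b]/= ab1.
have h (x y : R) : x ^+ 2 + y ^+ 2 <= 1 -> -1 <= x <= 1.
  move=> xy; rewrite -ler_norml -(@expr_le1 _ 2)// real_normK ?num_real//.
  by rewrite (le_trans _ xy)// lerDl sqr_ge0.
by split; rewrite /= in_itv/=; [exact: h ab1|apply: (h _ a); rewrite addrC].
Qed.

Lemma disc_algebra_bounded f : disc_algebra_set f -> bounded_on closed_disc f.
Proof.
move=> [_ fc _].
have cf : {within closed_disc, continuous (cabs \o f)}.
  move=> z; apply: (@continuous_comp (subspace closed_disc) _ _ f cabs).
    exact: fc.
  exact: cabs_continuous.
have [M [_ /(_ (M + 1))]] := compact_bounded (continuous_compact cf closed_disc_compact).
rewrite ltrDl => /(_ ltr01) cfM; exists (M + 1) => z Dz.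
by rewrite (le_trans (ler_norm _))//; apply: cfM; exists z.
Qed.

End function_spaces.

HB.instance Definition _ (R : realType) := GRing.isSubmodClosed.Build _ _
  (@Hinf_pred R) (@Hinf_submod_closed R).
HB.instance Definition _ (R : realType) := GRing.isSubmodClosed.Build _ _
  (@disc_algebra_pred R) (@disc_algebra_submod_closed R).

Definition Hinf (R : realType) := {f : R[i] -> R[i] | f \in Hinf_pred}.
HB.instance Definition _ (R : realType) := SubChoice.on (Hinf R).
HB.instance Definition _ (R : realType) :=
  [SubChoice_isSubLmodule of Hinf R by <:].

Definition Hinf_fun (R : realType) (f : Hinf R) : R[i] -> R[i] := \val f.
Coercion Hinf_fun : Hinf >-> Funclass.

Definition disc_algebra (R : realType) :=
  {f : R[i] -> R[i] | f \in disc_algebra_pred}.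
HB.instance Definition _ (R : realType) := SubChoice.on (disc_algebra R).
HB.instance Definition _ (R : realType) :=
  [SubChoice_isSubLmodule of disc_algebra R by <:].

Definition disc_algebra_fun (R : realType) (f : disc_algebra R) :
  R[i] -> R[i] := \val f.
Coercion disc_algebra_fun : disc_algebra >-> Funclass.

Section Hinf_normed.
Context {R : realType}.
Implicit Types f g : Hinf R.

Definition Hinf_norm f : R := sup_norm disc f.

Let disc_neq0 : @disc R !=set0. Proof. by exists 0; exact: disc0. Qed.

Let fb f : bounded_on disc f. Proof. by have /Hinf_predP[] := valP f. Qed.

Lemma ler_Hinf_normD f g :
  (Hinf_norm (f + g))%:C <= (Hinf_norm f)%:C + (Hinf_norm g)%:C.
Proof. by rewrite -rmorphD/= lecR; apply: ler_sup_normD => //; exact: fb. Qed.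

Lemma Hinf_normZ c f : (Hinf_norm (c *: f))%:C = `|c| * (Hinf_norm f)%:C.
Proof.
apply: homogeneous_of_le => [g|a g]; first exact: (sup_norm_ge0 _ (fb g)).
exact: (ler_sup_normZ _ _ (fb g)).
Qed.

Lemma Hinf_norm0_eq0 f : (Hinf_norm f)%:C = 0 -> f = 0.
Proof.
move=> /complexI f0; apply/val_inj/funext => z.
have [Dz|Dz] := pselect (disc z); first exact: (sup_norm0_eq0 (fb f) f0).
by have /Hinf_predP[_ _ /(_ z Dz)] := valP f.
Qed.

HB.instance Definition _ := Lmodule_isNormed.Build R[i] (Hinf R)
  ler_Hinf_normD Hinf_normZ Hinf_norm0_eq0.

End Hinf_normed.

Section disc_algebra_normed.
Context {R : realType}.
Implicit Types f g : disc_algebra R.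

Definition disc_algebra_norm f : R := sup_norm closed_disc f.

Let disc_neq0 : @closed_disc R !=set0.
Proof. by exists 0; exact/disc_closed_disc/disc0. Qed.

Let fb f : bounded_on closed_disc f.
Proof. exact/disc_algebra_bounded/disc_algebra_predP/(valP f). Qed.

Lemma ler_disc_algebra_normD f g :
  (disc_algebra_norm (f + g))%:C <=
  (disc_algebra_norm f)%:C + (disc_algebra_norm g)%:C.
Proof. by rewrite -rmorphD/= lecR; apply: ler_sup_normD => //; exact: fb. Qed.

Lemma disc_algebra_normZ c f :
  (disc_algebra_norm (c *: f))%:C = `|c| * (disc_algebra_norm f)%:C.
Proof.
apply: homogeneous_of_le => [g|a g]; first exact: (sup_norm_ge0 _ (fb g)).
exact: (ler_sup_normZ _ _ (fb g)).
Qed.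

Lemma disc_algebra_norm0_eq0 f : (disc_algebra_norm f)%:C = 0 -> f = 0.
Proof.
move=> /complexI f0; apply/val_inj/funext => z.
have [Dz|Dz] := pselect (closed_disc z); first exact: (sup_norm0_eq0 (fb f) f0).
by have /disc_algebra_predP[_ _ /(_ z Dz)] := valP f.
Qed.

HB.instance Definition _ := Lmodule_isNormed.Build R[i] (disc_algebra R)
  ler_disc_algebra_normD disc_algebra_normZ disc_algebra_norm0_eq0.

End disc_algebra_normed.

Section charge_integral.
Context d {T : measurableType d} {R : realType}.
Implicit Types (nu : {charge set T -> \bar R}) (f : T -> R).

Definition hahn_pos nu : set T := sval (cid (Hahn_decomposition nu)).

Definition hahn_neg nu : set T :=
  sval (cid (svalP (cid (Hahn_decomposition nu)))).

Definition hahnP nu : hahn_decomposition nu (hahn_pos nu) (hahn_neg nu) :=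
  svalP (cid (svalP (cid (Hahn_decomposition nu)))).

(* Integral against a signed measure through its Jordan decomposition; by
   charge_integralE it does not depend on the Hahn decomposition chosen. *)
Definition charge_integral nu f : R :=
  (\int[jordan_pos (hahnP nu)]_x f x - \int[jordan_neg (hahnP nu)]_x f x)%R.

Definition bounded_measurable f :=
  measurable_fun setT f /\ exists M : R, forall x, `|f x| <= M.

Lemma bounded_measurable_integrable (mu : {measure set T -> \bar R}) f :
  (mu setT < +oo)%E -> bounded_measurable f -> mu.-integrable setT (EFin \o f).
Proof.
move=> muoo [mf [M fM]]; apply: measurable_bounded_integrable => //.
exists M; split; first by rewrite num_real.
by move=> N MN x _ /=; rewrite (le_trans (fM x))// ltW.
Qed.

Lemma Rintegral_measure_add (m1 m2 : {measure set T -> \bar R}) f :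
  (m1 setT < +oo)%E -> (m2 setT < +oo)%E -> bounded_measurable f ->
  (\int[measure_add m1 m2]_x f x = \int[m1]_x f x + \int[m2]_x f x)%R.
Proof.
move=> m1oo m2oo bf; have i1 := bounded_measurable_integrable m1oo bf.
have i2 := bounded_measurable_integrable m2oo bf.
rewrite /Rintegral (@integral_measure_add _ _ _ m1 m2 _ _ (EFin \o f))//.
by rewrite fineD//; exact: integrable_fin_num.
Qed.

Lemma Rintegral_mscale (k : {nonneg R}) (m : {measure set T -> \bar R}) f :
  (m setT < +oo)%E -> bounded_measurable f ->
  (\int[mscale k m]_x f x = k%:num * \int[m]_x f x)%R.
Proof.
move=> moo bf; have mf : measurable_fun setT (EFin \o f).
  by apply/measurable_EFinP; case: bf.
have i := bounded_measurable_integrable moo bf.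
have ip := integral_fune_fin_num measurableT (integrable_funepos measurableT i).
have inn := integral_fune_fin_num measurableT (integrable_funeneg measurableT i).
rewrite /Rintegral integralE [in RHS]integralE.
rewrite !ge0_integral_mscale//; [|exact: measurable_funeneg|exact: measurable_funepos].
rewrite -(fineK ip) -(fineK inn) -!EFinM -!EFinB/=.
by rewrite mulrBr.
Qed.

Let sube_eq (a b c e : \bar R) : a \is a fin_num -> b \is a fin_num ->
  c \is a fin_num -> e \is a fin_num -> (a - b = c - e -> c + b = a + e)%E.
Proof.
move: a b c e => [a||] [b||] [c||] [e||]// _ _ _ _ [abce]; congr EFin.
by move/eqP: abce; rewrite subr_eq addrAC eq_sym subr_eq => /eqP.
Qed.

Let addeB (a b c e : \bar R) : e \is a fin_num ->
  ((a - b) + (c - e) = (a + c) - (b + e))%E.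
Proof. by move=> efin; rewrite fin_num_oppeD// addeACA. Qed.

Lemma jordan_decompB nu A : measurable A ->
  nu A = (jordan_pos (hahnP nu) A - jordan_neg (hahnP nu) A)%E.
Proof.
move=> mA; rewrite [LHS](jordan_decomp (hahnP nu) mA); congr (_ + _)%E.
exact: mulN1e.
Qed.

Lemma charge_integralE nu (m1 m2 : {measure set T -> \bar R}) f :
  (m1 setT < +oo)%E -> (m2 setT < +oo)%E ->
  (forall A, measurable A -> nu A = m1 A - m2 A)%E -> bounded_measurable f ->
  charge_integral nu f = (\int[m1]_x f x - \int[m2]_x f x)%R.
Proof.
move=> m1oo m2oo num bf; rewrite /charge_integral.
pose p : {finite_measure set T -> \bar R} := jordan_pos (hahnP nu).
pose n : {finite_measure set T -> \bar R} := jordan_neg (hahnP nu).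
rewrite -/p -/n.
have finm (m : {finite_measure set T -> \bar R}) : (m setT < +oo)%E.
  by rewrite ltey_eq fin_num_measure.
apply/eqP; rewrite subr_eq addrAC eq_sym subr_eq eq_sym; apply/eqP.
rewrite -!Rintegral_measure_add//=.
rewrite /Rintegral; congr fine; apply: eq_measure_integral => A mA _.
rewrite [LHS](measure_addE p m2) [RHS](measure_addE m1 n).
have : (m1 A - m2 A = p A - n A)%E.
  by rewrite -num//; exact: jordan_decompB.
have pA : p A \is a fin_num by exact: fin_num_measure.
have nA : n A \is a fin_num by exact: fin_num_measure.
have mfin (m : {measure set T -> \bar R}) : (m setT < +oo)%E -> m A \is a fin_num.
  move=> moo; rewrite ge0_fin_numE// (le_lt_trans _ moo)//.
  by apply: le_measure; rewrite ?inE.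
by apply: sube_eq => //; exact: mfin.
Qed.

Lemma finite_measure_lty (m : {finite_measure set T -> \bar R}) :
  (m setT < +oo)%E.
Proof. by rewrite ltey_eq fin_num_measure. Qed.

Lemma charge_integralD nu1 nu2 f : bounded_measurable f ->
  charge_integral (cadd nu1 nu2) f = charge_integral nu1 f + charge_integral nu2 f.
Proof.
move=> bf.
pose p1 : {finite_measure set T -> \bar R} := jordan_pos (hahnP nu1).
pose n1 : {finite_measure set T -> \bar R} := jordan_neg (hahnP nu1).
pose p2 : {finite_measure set T -> \bar R} := jordan_pos (hahnP nu2).
pose n2 : {finite_measure set T -> \bar R} := jordan_neg (hahnP nu2).
have addoo (m m' : {finite_measure set T -> \bar R}) :
    (measure_add m m' setT < +oo)%E.
  by rewrite measure_addE lte_add_pinfty//; exact: finite_measure_lty.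
rewrite (@charge_integralE _ (measure_add p1 p2) (measure_add n1 n2))//.
- rewrite !Rintegral_measure_add//; try exact: finite_measure_lty.
  by rewrite opprD addrACA.
- exact: addoo.
- exact: addoo.
move=> A mA; rewrite [RHS](congr2 (fun x y => x - y)%E (measure_addE p1 p2 A) (measure_addE n1 n2 A)).
transitivity (nu1 A + nu2 A)%E => //.
rewrite (jordan_decompB nu1 mA) (jordan_decompB nu2 mA).
by apply: addeB; exact: (fin_num_measure n2).
Qed.

Lemma charge_integralZ a nu f : bounded_measurable f ->
  charge_integral (cscale a nu) f = a * charge_integral nu f.
Proof.
move=> bf.
pose p : {finite_measure set T -> \bar R} := jordan_pos (hahnP nu).
pose n : {finite_measure set T -> \bar R} := jordan_neg (hahnP nu).
have scaleoo (k : {nonneg R}) (m : {finite_measure set T -> \bar R}) :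
    (mscale k m setT < +oo)%E.
  by rewrite /mscale ltey_eq fin_numM// fin_num_measure.
have nuA A : measurable A -> cscale a nu A = (a%:E * p A - a%:E * n A)%E.
  move=> mA; rewrite /cscale jordan_decompB// muleBr//.
  by apply: fin_num_adde_defr; exact: (fin_num_measure p).
have [a0|a0] := leP 0 a.
  pose k : {nonneg R} := NngNum a0.
  rewrite (@charge_integralE _ (mscale k p) (mscale k n))//; try exact: scaleoo.
  by rewrite !Rintegral_mscale//= ?mulrBr//; exact: finite_measure_lty.
have Na0 : 0 <= - a by rewrite oppr_ge0 ltW.
pose k : {nonneg R} := NngNum Na0.
rewrite (@charge_integralE _ (mscale k n) (mscale k p))//; try exact: scaleoo.
  rewrite !Rintegral_mscale//=; try exact: finite_measure_lty.
  by rewrite -mulrBr mulNr -mulrN opprB.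
move=> A mA; transitivity (a%:E * p A - a%:E * n A)%E; first exact: nuA.
transitivity ((- a)%:E * n A - (- a)%:E * p A)%E => //.
by rewrite EFinN !mulNe oppeK addeC.
Qed.

Lemma Rintegral_le_bound (m : {finite_measure set T -> \bar R}) f (M : R) :
  bounded_measurable f -> (forall x, `|f x| <= M) ->
  `|\int[m]_x f x| <= M * fine (m setT).
Proof.
move=> bf fM.
have i := bounded_measurable_integrable (finite_measure_lty m) bf.
rewrite (le_trans (le_normr_Rintegral measurableT i))//.
have le : (\int[m]_x `|f x|%:E <= M%:E * m setT)%E.
  rewrite -[leRHS](integral_cst m measurableT M%:E).
  apply: ge0_le_integral => //.
  - by apply/measurable_EFinP/measurableT_comp => //; case: bf.
  - by move=> x _; rewrite lee_fin (le_trans _ (fM x)).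
have mfin : m setT \is a fin_num by exact: fin_num_measure.
have Mm : (M%:E * m setT)%E \is a fin_num by rewrite fin_numM.
have := fine_le _ Mm le; rewrite fineM//; apply.
rewrite ge0_fin_numE; last by apply: integral_ge0 => x _; rewrite lee_fin.
by rewrite (le_lt_trans le)// ltey_eq Mm.
Qed.

Lemma charge_integral_le nu f (M : R) : bounded_measurable f ->
  (forall x, `|f x| <= M) ->
  `|charge_integral nu f| <=
  M * (`|fine (nu (hahn_pos nu))| + `|fine (nu (hahn_neg nu))|).
Proof.
move=> bf fM; have [[mP _] [mN _] PN PN0] := hahnP nu.
pose p : {finite_measure set T -> \bar R} := jordan_pos (hahnP nu).
pose n : {finite_measure set T -> \bar R} := jordan_neg (hahnP nu).
have -> : nu (hahn_pos nu) = p setT.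
  transitivity (crestr0 nu mP setT) => //.
  by rewrite /crestr0 /crestr mem_set// setTI.
have -> : nu (hahn_neg nu) = (- n setT)%E.
  have -> : n setT = ((-1)%:E * crestr0 nu mN setT)%E by [].
  by rewrite /crestr0 /crestr mem_set// setTI mulN1e oppeK.
rewrite fineN normrN (le_trans (ler_normB _ _))// mulrDr lerD//.
- have p0 : 0 <= fine (p setT) by rewrite fine_ge0.
  by rewrite (ger0_norm p0); exact: (@Rintegral_le_bound p f M bf fM).
- have n0 : 0 <= fine (n setT) by rewrite fine_ge0.
  by rewrite (ger0_norm n0); exact: (@Rintegral_le_bound n f M bf fM).
Qed.

End charge_integral.

(* The complex measure cmeasure_Re + i cmeasure_Im. *)
Record cmeasure d (T : measurableType d) (R : realType) := CMeasure {
  cmeasure_Re : {charge set T -> \bar R} ;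
  cmeasure_Im : {charge set T -> \bar R} }.

Definition cmeasure_fun d (T : measurableType d) (R : realType)
    (mu : cmeasure T R) (A : set T) : R[i] :=
  fine (cmeasure_Re mu A) +i* fine (cmeasure_Im mu A).
Coercion cmeasure_fun : cmeasure >-> Funclass.

Section complex_measure.
Context d {T : measurableType d} {R : realType}.
Implicit Types (mu nu : cmeasure T R) (f : T -> R[i]).

Definition countable_partition (F : (set T)^nat) :=
  [/\ forall n, measurable (F n), trivIset setT F & \bigcup_n F n = setT].

Definition total_variation mu : \bar R := ereal_sup
  [set \sum_(0 <= n <oo) (cabs (mu (F n)))%:E | F in countable_partition]%E.

Definition cmeasure_norm mu : R := fine (total_variation mu).

Definition cintegral mu f : R[i] :=
  (charge_integral (cmeasure_Re mu) (@complex.Re R \o f)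
   - charge_integral (cmeasure_Im mu) (@complex.Im R \o f)) +i*
  (charge_integral (cmeasure_Re mu) (@complex.Im R \o f)
   + charge_integral (cmeasure_Im mu) (@complex.Re R \o f)).

Definition cmeasureD mu nu : cmeasure T R :=
  CMeasure (cadd (cmeasure_Re mu) (cmeasure_Re nu))
           (cadd (cmeasure_Im mu) (cmeasure_Im nu)).

Definition cmeasureZ (c : R[i]) mu : cmeasure T R :=
  CMeasure (cadd (cscale (complex.Re c) (cmeasure_Re mu))
                 (cscale (- complex.Im c) (cmeasure_Im mu)))
           (cadd (cscale (complex.Re c) (cmeasure_Im mu))
                 (cscale (complex.Im c) (cmeasure_Re mu))).

Lemma cmeasureDE mu nu A : measurable A ->
  cmeasureD mu nu A = mu A + nu A.
Proof.
move=> mA; rewrite /cmeasure_fun/=.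
by congr (_ +i* _); rewrite fineD// fin_num_measure.
Qed.

Lemma cmeasureZE c mu A : measurable A -> cmeasureZ c mu A = c * mu A.
Proof.
move=> mA; rewrite /cmeasure_fun/=; case: c => a b.
have fre : cmeasure_Re mu A \is a fin_num by exact: fin_num_measure.
have fim : cmeasure_Im mu A \is a fin_num by exact: fin_num_measure.
by congr (_ +i* _);
  rewrite /cadd/= /cscale fineD ?fin_numM// !fineM//= ?mulNr.
Qed.

Lemma cabs_series_le mu F : countable_partition F ->
  (\sum_(0 <= n <oo) (cabs (mu (F n)))%:E <= total_variation mu)%E.
Proof. by move=> cF; apply: ereal_sup_ubound; exists F. Qed.

Lemma charge_series_fin (nu : {charge set T -> \bar R}) F :
  countable_partition F ->
  (\sum_(0 <= n <oo) `|nu (F n)| <= charge_variation (hahnP nu) setT)%E.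
Proof.
move=> [mF tF UF].
pose v : {measure set T -> \bar R} := charge_variation (hahnP nu).
have -> : charge_variation (hahnP nu) setT = v (\bigcup_n F n) by rewrite UF.
rewrite measure_bigcup//.
rewrite (eq_eseriesl (P := fun n => n \in setT) (Q := xpredT)); last first.
  by move=> n; exact: in_setT.
by apply: lee_nneseries => // n _; exact: abse_charge_variation.
Qed.

Lemma total_variation_lty mu : (total_variation mu < +oo)%E.
Proof.
have finv (nu : {charge set T -> \bar R}) :
    charge_variation (hahnP nu) setT \is a fin_num.
  by apply: fin_num_measure.
apply: (@le_lt_trans _ _ (charge_variation (hahnP (cmeasure_Re mu)) setT +
  charge_variation (hahnP (cmeasure_Im mu)) setT)%E); last first.
  by rewrite ltey_eq fin_numD !finv.
apply: ge_ereal_sup => _ [F cF <-].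
rewrite (le_trans _ (leeD (charge_series_fin _ cF) (charge_series_fin _ cF)))//.
rewrite -nneseriesD//; apply: lee_nneseries => [n _ _|n _].
  by rewrite lee_fin cabs_ge0.
have [mF _ _] := cF.
have fre : cmeasure_Re mu (F n) \is a fin_num by exact: fin_num_measure.
have fim : cmeasure_Im mu (F n) \is a fin_num by exact: fin_num_measure.
rewrite -(fineK fre) -(fineK fim) /= lee_fin.
exact: cabs_ReIm.
Qed.

Lemma countable_partition2 A : measurable A ->
  countable_partition (bigcup2 A (~` A)).
Proof.
move=> mA; split.
- by move=> [|[|n]]//=; exact: measurableC.
- by rewrite -trivIset_bigcup2 setICr.
- exact: (eq_trans (bigcup2E A (~` A)) (setUv A)).
Qed.

Lemma total_variation_ge mu A : measurable A ->
  ((cabs (mu A))%:E <= total_variation mu)%E.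
Proof.
move=> mA; rewrite (le_trans _ (cabs_series_le mu (countable_partition2 mA)))//.
rewrite (le_trans _ (nneseries_lim_ge 1 _))//.
  by rewrite big_nat1.
by move=> n _ _; rewrite lee_fin cabs_ge0.
Qed.

Lemma total_variation_ge0 mu : (0 <= total_variation mu)%E.
Proof. by rewrite (le_trans _ (total_variation_ge mu measurable0))// lee_fin cabs_ge0. Qed.

Lemma total_variationE mu : total_variation mu = (cmeasure_norm mu)%:E.
Proof.
by rewrite fineK// ge0_fin_numE ?total_variation_ge0// total_variation_lty.
Qed.

Lemma cmeasure_norm_ge0 mu : 0 <= cmeasure_norm mu.
Proof. by rewrite fine_ge0// total_variation_ge0. Qed.

Lemma cabs_cmeasure_le mu A : measurable A -> cabs (mu A) <= cmeasure_norm mu.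
Proof. by move=> mA; rewrite -lee_fin -total_variationE total_variation_ge. Qed.

Lemma cmeasure_normD mu nu :
  cmeasure_norm (cmeasureD mu nu) <= cmeasure_norm mu + cmeasure_norm nu.
Proof.
rewrite -lee_fin EFinD -!total_variationE; apply: ge_ereal_sup => _ [F cF <-].
rewrite (le_trans _ (leeD (cabs_series_le _ cF) (cabs_series_le _ cF)))//.
have [mF _ _] := cF.
rewrite -nneseriesD//; [|by move=> n _ _; rewrite lee_fin cabs_ge0..].
apply: lee_nneseries => [n _ _|n _]; first by rewrite lee_fin cabs_ge0.
by rewrite -EFinD lee_fin cmeasureDE// ler_cabsD.
Qed.

Lemma cmeasure_normZ c mu :
  cmeasure_norm (cmeasureZ c mu) <= cabs c * cmeasure_norm mu.
Proof.
rewrite -lee_fin EFinM -!total_variationE; apply: ge_ereal_sup => _ [F cF <-].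
have [mF _ _] := cF.
rewrite (le_trans _ (lee_wpmul2l _ (cabs_series_le mu cF)))//; last first.
  by rewrite lee_fin cabs_ge0.
rewrite -nneseriesZl; last by move=> n _; rewrite lee_fin cabs_ge0.
apply: lee_nneseries => [n _ _|n _]; first by rewrite lee_fin cabs_ge0.
by rewrite -EFinM lee_fin cmeasureZE// cabsM.
Qed.

Definition cbounded_measurable f :=
  bounded_measurable (@complex.Re R \o f) /\ bounded_measurable (@complex.Im R \o f).

Lemma cintegralD mu nu f : cbounded_measurable f ->
  cintegral (cmeasureD mu nu) f = cintegral mu f + cintegral nu f.
Proof.
move=> [bre bim]; rewrite /cintegral/= !charge_integralD//.
by congr (_ +i* _); rewrite ?opprD addrACA.
Qed.

Lemma cintegralZ c mu f : cbounded_measurable f ->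
  cintegral (cmeasureZ c mu) f = c * cintegral mu f.
Proof.
move=> [bre bim]; case: c => a b.
rewrite /cintegral/= !charge_integralD// !charge_integralZ//.
by congr (_ +i* _); ring.
Qed.

Lemma cabs_cintegral_le mu f (M : R) : cbounded_measurable f ->
  (forall x, cabs (f x) <= M) ->
  cabs (cintegral mu f) <= M * (8 * cmeasure_norm mu).
Proof.
move=> [bre bim] fM.
have reM x : `|(@complex.Re R \o f) x| <= M by exact: le_trans (cabs_Re _) (fM x).
have imM x : `|(@complex.Im R \o f) x| <= M by exact: le_trans (cabs_Im _) (fM x).
have leM (nu : {charge set T -> \bar R}) (g : T -> R) :
    (forall A, measurable A -> `|fine (nu A)| <= cmeasure_norm mu) ->
    bounded_measurable g -> (forall x, `|g x| <= M) ->
    `|charge_integral nu g| <= M * (2 * cmeasure_norm mu).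
  move=> numu bg gM; rewrite (le_trans (charge_integral_le _ bg gM))//.
  have M0 : 0 <= M by rewrite (le_trans _ (gM point)).
  have [[mP _] [mN _] _ _] := hahnP nu.
  by rewrite ler_wpM2l// mulr_natl mulr2n lerD// numu.
have rele A : measurable A -> `|fine (cmeasure_Re mu A)| <= cmeasure_norm mu.
  by move=> mA; rewrite (le_trans _ (cabs_cmeasure_le mu mA))// (cabs_Re (mu A)).
have imle A : measurable A -> `|fine (cmeasure_Im mu A)| <= cmeasure_norm mu.
  by move=> mA; rewrite (le_trans _ (cabs_cmeasure_le mu mA))// (cabs_Im (mu A)).
rewrite (le_trans (cabs_ReIm _))//=.
have -> : M * (8 * cmeasure_norm mu) =
    (M * (2 * cmeasure_norm mu) + M * (2 * cmeasure_norm mu)) +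
    (M * (2 * cmeasure_norm mu) + M * (2 * cmeasure_norm mu)).
  by ring.
apply: lerD.
  by rewrite (le_trans (ler_normB _ _))// lerD// leM.
by rewrite (le_trans (ler_normD _ _))// lerD// leM.
Qed.

End complex_measure.

Definition circle (R : realType) : Type := set_type [set z : R[i] | `|z| = 1].

HB.instance Definition _ (R : realType) :=
  Topological.copy (circle R) (set_type [set z : R[i] | `|z| = 1]).

Lemma circle_subproof (R : realType) : (1 : R[i]) \in [set z : R[i] | `|z| = 1].
Proof. by apply/mem_set; rewrite /= normr1. Qed.

HB.instance Definition _ (R : realType) :=
  isPointed.Build (circle R) (exist _ 1 (circle_subproof R)).

Definition borel_circle (R : realType) :=
  g_sigma_algebraType (@open (circle R)).

Definition circle_val (R : realType) (xi : borel_circle R) : R[i] :=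
  set_val (xi : set_type [set z : R[i] | `|z| = 1]).
Coercion circle_val : borel_circle >-> complex.

Section cauchy_transform.
Context {R : realType}.
Local Notation F := (R[i] -> R[i]).
Implicit Types mu nu : cmeasure (borel_circle R) R.

Lemma cabs_circle (xi : borel_circle R) : cabs xi = 1.
Proof. by rewrite /cabs (set_valP xi). Qed.

Lemma circle_val_continuous :
  continuous (@circle_val R : circle R -> R[i]).
Proof.
exact: (@initial_continuous (set_type [set z : R[i] | `|z| = 1]) _ set_val).
Qed.

Lemma continuous_circle_measurable (f : circle R -> R) :
  continuous f -> measurable_fun setT (f : borel_circle R -> R).
Proof.
move=> /continuousP cf; apply: (measurability _ (RGenOpens.measurableE R)).
move=> _ [_ [a [b ->] <-]]; rewrite setTI; apply: sub_sigma_algebra.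
exact/cf/interval_open.
Qed.

Definition cauchy_kernel (z : R[i]) (xi : borel_circle R) : R[i] :=
  (1 - conjc xi * z)^-1.

Definition cauchy_transform mu : F :=
  fun z => cintegral mu (cauchy_kernel z).

Lemma conjc_circle (xi : borel_circle R) : cabs (conjc xi) = 1.
Proof.
rewrite -(cabs_circle xi) /cabs !normc_def; case: (xi : R[i]) => a b /=.
by rewrite sqrrN.
Qed.

Lemma cauchy_denom z (xi : borel_circle R) : disc z ->
  1 - cabs z <= cabs (1 - conjc xi * z).
Proof.
move=> Dz; rewrite lerBlDr.
have -> : 1 = cabs (1 - conjc xi * z + conjc xi * z) :> R.
  by rewrite subrK /cabs normr1.
rewrite (le_trans (ler_cabsD _ _))// lerD2l.
by rewrite cabsM conjc_circle mul1r.
Qed.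

Lemma disc_cabs (z : R[i]) : disc z -> 0 < 1 - cabs z.
Proof. by move=> Dz; rewrite subr_gt0 cabs_lt. Qed.

Lemma cabs_cauchy_kernel z (xi : borel_circle R) : disc z ->
  cabs (cauchy_kernel z xi) <= (1 - cabs z)^-1.
Proof.
move=> Dz; have h := cauchy_denom xi Dz.
have d0 : 0 < cabs (1 - conjc xi * z) by exact: lt_le_trans (disc_cabs Dz) h.
have dn0 : 1 - conjc xi * z != 0.
  by apply: contraTneq d0 => ->; rewrite cabs0 ltxx.
have -> : cabs (cauchy_kernel z xi) = (cabs (1 - conjc xi * z))^-1.
  apply: (mulIf (lt0r_neq0 d0)); rewrite mulVf ?lt0r_neq0// -cabsM mulVf//.
  by rewrite /cabs normr1.
by rewrite lef_pV2// ?posrE// disc_cabs.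
Qed.

Lemma cauchy_kernel_continuous z : disc z ->
  continuous (cauchy_kernel z : circle R -> R[i]).
Proof.
move=> Dz xi; have d0 := lt_le_trans (disc_cabs Dz) (cauchy_denom xi Dz).
have dn0 : 1 - conjc (circle_val xi) * z != 0.
  by apply: contraTneq d0 => ->; rewrite cabs0 ltxx.
apply: (@continuous_comp (circle R) _ _ (@circle_val R)
  (fun w => (1 - conjc w * z)^-1)); first exact: circle_val_continuous.
move: (circle_val xi) dn0 => w wn0.
have cw : (fun w => conjc w * z) x @[x --> nbhs w] --> conjc w * z.
  by apply: (@cvgM _ _ (nbhs w)); [exact: conjc_continuous|exact: cvg_cst].
have c1w : (fun w => 1 - conjc w * z) x @[x --> nbhs w] --> 1 - conjc w * z.
  by apply: (@cvgB _ _ _ (nbhs w)) cw; exact: cvg_cst.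
exact: (@cvgV _ _ (nbhs w) _ _ _ wn0 c1w).
Qed.

Lemma cauchy_kernel_bm z : disc z -> cbounded_measurable (cauchy_kernel z).
Proof.
move=> Dz; split; split.
- apply: continuous_circle_measurable => xi.
  apply: (@continuous_comp (circle R) _ _ (cauchy_kernel z) (@complex.Re R)).
    exact: cauchy_kernel_continuous.
  exact: Re_continuous.
- exists (1 - cabs z)^-1 => xi.
  exact: le_trans (cabs_Re _) (cabs_cauchy_kernel xi Dz).
- apply: continuous_circle_measurable => xi.
  apply: (@continuous_comp (circle R) _ _ (cauchy_kernel z) (@complex.Im R)).
    exact: cauchy_kernel_continuous.
  exact: Im_continuous.
- exists (1 - cabs z)^-1 => xi.
  exact: le_trans (cabs_Im _) (cabs_cauchy_kernel xi Dz).
Qed.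

(* f is the Cauchy transform of mu on the disc. *)
Definition represents mu (f : F) := {in disc, cauchy_transform mu =1 f}.

Lemma representsD mu nu f g : represents mu f -> represents nu g ->
  represents (cmeasureD mu nu) (f + g).
Proof.
move=> muf nug z Dz; have := cauchy_kernel_bm (set_mem Dz).
by move=> bm; rewrite /cauchy_transform cintegralD// -[RHS]/(f z + g z) -muf// -nug.
Qed.

Lemma representsZ c mu f : represents mu f ->
  represents (cmeasureZ c mu) (c *: f).
Proof.
move=> muf z Dz; have := cauchy_kernel_bm (set_mem Dz).
by move=> bm; rewrite /cauchy_transform cintegralZ// -[RHS]/(c * f z) -muf.
Qed.

Definition cauchy_set : set F := [set f |
  (exists mu, represents mu f) /\ forall z, ~ disc z -> f z = 0].

Definition cauchy_pred : {pred F} := mem cauchy_set.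

Lemma cauchy_predP f : f \in cauchy_pred <-> cauchy_set f.
Proof. by split=> [/set_mem//|?]; exact/mem_set. Qed.

Lemma cauchy_submod_closed : submod_closed cauchy_pred.
Proof.
split.
  apply/cauchy_predP; split=> //.
  exists (cmeasureZ 0 (CMeasure czero czero)) => z Dz.
  have bm := cauchy_kernel_bm (set_mem Dz).
  by rewrite /cauchy_transform cintegralZ// mul0r.
move=> c f g /cauchy_predP[[mu muf] f0] /cauchy_predP[[nu nug] g0].
apply/cauchy_predP; split.
  exists (cmeasureD (cmeasureZ c mu) nu).
  exact: (representsD (representsZ c muf) nug).
by move=> z Dz; rewrite -[LHS]/(c * f z + g z) f0// g0// mulr0 addr0.
Qed.

End cauchy_transform.

HB.instance Definition _ (R : realType) := GRing.isSubmodClosed.Build _ _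
  (@cauchy_pred R) (@cauchy_submod_closed R).

Definition cauchy_space (R : realType) :=
  {f : R[i] -> R[i] | f \in cauchy_pred}.
HB.instance Definition _ (R : realType) := SubChoice.on (cauchy_space R).
HB.instance Definition _ (R : realType) :=
  [SubChoice_isSubLmodule of cauchy_space R by <:].

Definition cauchy_fun (R : realType) (f : cauchy_space R) : R[i] -> R[i] :=
  \val f.
Coercion cauchy_fun : cauchy_space >-> Funclass.

Section cauchy_normed.
Context {R : realType}.
Implicit Types f g : cauchy_space R.

Definition cauchy_norm f : R := inf [set cmeasure_norm mu | mu in represents ^~ f].

Let rep f : exists mu, represents mu f.
Proof. by have /cauchy_predP[] := valP f. Qed.

Lemma cauchy_norm_le f mu : represents mu f -> cauchy_norm f <= cmeasure_norm mu.
Proof.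
move=> muf; apply: ge_inf; last by exists mu.
by exists 0 => _ [nu _ <-]; exact: cmeasure_norm_ge0.
Qed.

Lemma le_cauchy_norm f (M : R) :
  (forall mu, represents mu f -> M <= cmeasure_norm mu) -> M <= cauchy_norm f.
Proof.
move=> fM; apply: lb_le_inf.
  by have [mu muf] := rep f; exists (cmeasure_norm mu), mu.
by move=> _ [nu nuf <-]; exact: fM.
Qed.

Lemma cauchy_norm_ge0 f : 0 <= cauchy_norm f.
Proof. by apply: le_cauchy_norm => mu _; exact: cmeasure_norm_ge0. Qed.

Lemma ler_cauchy_normD f g :
  (cauchy_norm (f + g))%:C <= (cauchy_norm f)%:C + (cauchy_norm g)%:C.
Proof.
rewrite -rmorphD/= lecR -lerBlDr; apply: le_cauchy_norm => mu muf.
rewrite lerBlDr -lerBlDl; apply: le_cauchy_norm => nu nug.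
rewrite lerBlDl (le_trans _ (cmeasure_normD mu nu))//.
exact: (@cauchy_norm_le (f + g) _ (representsD muf nug)).
Qed.

Lemma cauchy_normZ c f : (cauchy_norm (c *: f))%:C = `|c| * (cauchy_norm f)%:C.
Proof.
have h a g mu : represents mu g ->
    cauchy_norm (a *: g) <= cabs a * cmeasure_norm mu.
  move=> mug; rewrite (le_trans _ (cmeasure_normZ a mu))//.
  exact: (@cauchy_norm_le (a *: g) _ (representsZ a mug)).
apply: homogeneous_of_le => [g|a g]; first exact: cauchy_norm_ge0.
have [a0|a0] := eqVneq (cabs a) 0.
  by have [mu /(h a)] := rep g; rewrite a0 !mul0r.
have {}a0 : 0 < cabs a by rewrite lt_def a0 cabs_ge0.
rewrite mulrC -ler_pdivrMr//; apply: le_cauchy_norm => mu /(h a).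
by rewrite ler_pdivrMr// mulrC.
Qed.

Lemma cauchy_norm0_eq0 f : (cauchy_norm f)%:C = 0 -> f = 0.
Proof.
move=> /complexI f0; apply/val_inj/funext => z.
have [Dz|Dz] := pselect (disc z); last first.
  by have /cauchy_predP[_ /(_ z Dz)] := valP f.
have d0 := disc_cabs Dz.
have C0 : 0 < (1 - cabs z)^-1 * 8 by rewrite mulr_gt0 ?invr_gt0.
apply: cabs0_eq0; apply/eqP; rewrite eq_le cabs_ge0 andbT.
suff : cabs (f z) / ((1 - cabs z)^-1 * 8) <= cauchy_norm f.
  by rewrite f0 ler_pdivrMr// mul0r.
apply: le_cauchy_norm => mu muf; rewrite ler_pdivrMr// mulrC -mulrA.
rewrite -(muf z (mem_set Dz)).
apply: (cabs_cintegral_le mu (cauchy_kernel_bm Dz)) => xi.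
exact: cabs_cauchy_kernel.
Qed.

HB.instance Definition _ := Lmodule_isNormed.Build R[i] (cauchy_space R)
  ler_cauchy_normD cauchy_normZ cauchy_norm0_eq0.

End cauchy_normed.

Section integration_operator.
Context {R : realType}.
Local Notation C := R[i].
Local Notation F := (C -> C).

(* Integral of h along the segment from 0 to z; for h analytic in the disc the
   integral does not depend on the path from 0 to z. *)
Definition segment_integral (h : F) (z : C) : C := z *
  ((\int[lebesgue_measure]_(t in `[0, 1]) complex.Re (h (t%:C * z))) +i*
   (\int[lebesgue_measure]_(t in `[0, 1]) complex.Im (h (t%:C * z)))).

Definition Tg (g f : F) : F :=
  segment_integral (fun zeta => f zeta * derive1 g zeta).

Definition G_H2 (g : F) (z w : C) : C :=
  conjc (segment_integral
    (fun zeta => derive1 g zeta / (1 - conjc w * zeta)) z).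

Definition compact_operator (X Y : normedModType C) (T : {linear X -> Y}) :=
  forall B : set X, bounded_set B -> precompact (T @` B).

(* For X and Y spaces of functions (iX and iY giving the underlying functions),
   Tg g maps X into Y and is compact as an operator from X to Y. *)
Definition Tg_compact (X Y : normedModType C) (iX : X -> F) (iY : Y -> F)
    (g : F) :=
  exists T : {linear X -> Y},
    (forall f : X, {in disc, iY (T f) =1 Tg g (iX f)}) /\ compact_operator T.

(* The restrictions to the disc of the functions of S all belong to the space
   of Cauchy transforms and form a relatively compact subset of it. *)
Definition cauchy_relatively_compact (S : set F) :=
  (forall h, S h -> exists k : cauchy_space R, {in disc, k =1 h}) /\
  precompact [set k : cauchy_space R | exists2 h, S h & {in disc, k =1 h}].

End integration_operator.

(* Main.v *)
From HB Require Import structures.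
From mathcomp Require Import all_boot all_order all_algebra.
From mathcomp Require Import all_classical all_reals all_analysis.
From mathcomp Require Import measurable_realfun.
From mathcomp Require Import complex ring lra.
Require Import Defs.
Import Order.TTheory GRing.Theory Num.Theory.
Import numFieldNormedType.Exports.
Set Implicit Arguments.
Unset Strict Implicit.
Unset Printing Implicit Defensive.
Local Open Scope classical_set_scope.
Local Open Scope complex_scope.
Local Open Scope ring_scope.

(* Everything is read off the functions T_g p, p a polynomial with |p| <= 1 on
   the closed disc; the functional p |-> T_g p (z) is the pairing of p with the
   kernel G_z.  Compactness in (iv) or in (v) forces these functions to be
   uniformly bounded and T_g (p h^n) to tend to 0 uniformly in p for every peak
   function h z = (1 + conj xi z) / 2, |xi| = 1, since p h^n tends to 0 locally
   uniformly.  Writing p = p h^n + p q with q = 1 - h^n, which vanishes at xi,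
   and integrating T_g (p q) by parts, one obtains that the functions T_g p are
   equicontinuous on the disc, near the boundary points too, uniformly in p.

   By Arzela-Ascoli on the closed disc this equicontinuity gives (iii).  It also
   gives (v): by convex separation in finite dimension, a kernel difference
   G_z - G_z' whose pairing with all p is at most M is, up to a small error, the
   Fejer mean of a finite measure on the circle of mass at most M, so that its
   norm in the space of Cauchy transforms is at most 8 M.  Hence z |-> G_z extends
   continuously to the closed disc, that space being complete. *)

(** Among (i)-(iv), (iii) is the strongest and (iv) the weakest, so it is enough to reach (iii) and
    (v) from (iv) and (iii) from (v). The obstacle is that nothing bounds g' near the circle; the
    bounded quantity that replaces it is T_g p itself. Polynomials suffice because an analytic f
    with |f| <= 1 on the disc is a locally uniform limit of polynomials with |p| <= 1 on the closed
    disc, while T_g f (z) only depends on f over the segment from 0 to z. Duality enters through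
    explicit measures: the one representing a kernel difference has a continuous density, made of an
    error term of modulus at most M and of combinations of Fejer kernels of mass at most M. Cutting
    it into positive and negative, real and imaginary parts costs a factor 4, whence 8 M. Constants
    are crude throughout, since only smallness and compactness are at stake. Function theory is
    likewise reduced to polynomials: a function is analytic in the disc exactly when polynomials
    approximate it uniformly on each |z| <= r < 1, and derivatives and primitives are then computed
    on the polynomials. *)

Section complex_basics.
Context {R : realType}.
Local Notation C := R[i].
Implicit Types (z w : C) (r : R).

Lemma cabs1 : cabs (1 : C) = 1.
Proof. by rewrite /cabs normr1. Qed.

Lemma cabsR r : cabs r%:C = `|r|.
Proof. by rewrite /cabs normc_def/= expr0n/= addr0 sqrtr_sqr. Qed.

Lemma cabsN z : cabs (- z) = cabs z.
Proof. by rewrite /cabs normrN. Qed.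

Lemma cabsB z w : cabs (z - w) = cabs (w - z).
Proof. by rewrite -opprB cabsN. Qed.

Lemma cabs_gt0 z : (0 < cabs z) = (z != 0).
Proof.
rewrite lt_def cabs_ge0 andbT; congr (~~ _).
by apply/eqP/eqP => [/cabs0_eq0|->]; rewrite ?cabs0.
Qed.

Lemma cabsV z : cabs z^-1 = (cabs z)^-1.
Proof.
have [->|z0] := eqVneq z 0; first by rewrite invr0 cabs0 invr0.
apply: (mulIf (x := cabs z)); first by rewrite gt_eqF// cabs_gt0.
by rewrite -cabsM mulVf// cabs1 mulVf// gt_eqF// cabs_gt0.
Qed.

Lemma cabs_div z w : cabs (z / w) = cabs z / cabs w.
Proof. by rewrite cabsM cabsV. Qed.

Lemma cabsX z n : cabs (z ^+ n) = cabs z ^+ n.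
Proof. by elim: n => [|n IH]; rewrite ?expr0 ?cabs1// !exprS cabsM IH. Qed.

Lemma cabs_conj z : cabs (conjc z) = cabs z.
Proof. by case: z => a b; rewrite /cabs !normc_def/= sqrrN. Qed.

Lemma cabs_sum (I : Type) (s : seq I) (P : pred I) (F : I -> C) :
  cabs (\sum_(i <- s | P i) F i) <= \sum_(i <- s | P i) cabs (F i).
Proof.
elim/big_ind2 : _ => [|x1 x2 y1 y2 h1 h2|//]; first by rewrite cabs0.
by rewrite (le_trans (ler_cabsD _ _))// lerD.
Qed.

Lemma ler_cabs_dist z w v : cabs (z - w) <= cabs (z - v) + cabs (v - w).
Proof. by rewrite (_ : z - w = (z - v) + (v - w)) ?ler_cabsD//; ring. Qed.

Lemma ler_cabsB z w : cabs z - cabs w <= cabs (z - w).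
Proof. by rewrite lerBlDr -{1}(subrK w z) ler_cabsD. Qed.

Lemma cabs_eq0P z : (forall e : R, 0 < e -> cabs z <= e) -> z = 0.
Proof.
move=> ze; apply: cabs0_eq0; apply/eqP; rewrite eq_le cabs_ge0 andbT.
by apply/ler_addgt0Pr => e e0; rewrite add0r ze.
Qed.

Lemma discP z : disc z <-> cabs z < 1.
Proof. by rewrite cabs_lt. Qed.

Lemma closed_discP z : closed_disc z <-> cabs z <= 1.
Proof. by rewrite cabs_le. Qed.

Lemma ReM z w : complex.Re (z * w) =
  complex.Re z * complex.Re w - complex.Im z * complex.Im w.
Proof. by case: z w => a b [c d]. Qed.

Lemma ImM z w : complex.Im (z * w) =
  complex.Re z * complex.Im w + complex.Im z * complex.Re w.
Proof. by case: z w => a b [c d]. Qed.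

Lemma ReD z w : complex.Re (z + w) = complex.Re z + complex.Re w.
Proof. by case: z w => a b [c d]. Qed.

Lemma ImD z w : complex.Im (z + w) = complex.Im z + complex.Im w.
Proof. by case: z w => a b [c d]. Qed.

Lemma Re_sum (I : Type) (s : seq I) (P : pred I) (F : I -> C) :
  complex.Re (\sum_(i <- s | P i) F i) = \sum_(i <- s | P i) complex.Re (F i).
Proof. by apply: (big_morph _ ReD). Qed.

(** A positive element of [R[i]] has imaginary part 0, so every ball has a real radius; later
    estimates are all between real numbers. *)
Lemma nbhs_cabsP z (A : set C) :
  nbhs z A <-> exists2 d : R, 0 < d & forall w, cabs (w - z) < d -> A w.
Proof.
split=> [/nbhs_ballP[[a b]/= + zA]|[d d0 zA]].
  rewrite ltcE/= => /andP[/eqP b0 a0]; rewrite b0 in zA.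
  by exists a => // w wz; apply: zA; rewrite /ball/= -cabs_lt cabsB.
apply/nbhs_ballP; exists d%:C => [|w]; first by rewrite /= ltcR.
by rewrite /ball/= -cabs_lt cabsB; exact: zA.
Qed.

Lemma continuous_cabsP (f : C -> C) z : {for z, continuous f} <->
  forall e : R, 0 < e -> exists2 d : R, 0 < d &
    forall w, cabs (w - z) < d -> cabs (f w - f z) < e.
Proof.
split=> [fz e e0|fz].
  have /fz/nbhs_cabsP[d d0 H] : nbhs (f z) [set v | cabs (v - f z) < e].
    by apply/nbhs_cabsP; exists e.
  by exists d.
move=> A /nbhs_cabsP[e e0 eA]; have [d d0 dA] := fz e e0.
by apply/nbhs_cabsP; exists d => // w /dA /eA.
Qed.

Lemma derivable_cvgE (f : C -> C) z : derivable f z 1 =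
  cvg (h^-1 *: (f (h + z) - f z) @[h --> 0^']).
Proof.
rewrite /derivable; set F := (X in cvg (X @ _)).
suff -> : F = (fun h => h^-1 *: (f (h + z) - f z)) by [].
by apply/funext => h; rewrite /F/= [h%:A](mulr1).
Qed.

(** A quadratic remainder is what the Cauchy kernel provides; it gives differentiability and the
    value of the derivative together. *)
Lemma derivable_quadratic (f : C -> C) z (d : C) (K r : R) : 0 < r ->
  (forall h, cabs h < r -> cabs (f (z + h) - f z - h * d) <= K * cabs h ^+ 2) ->
  derivable f z 1 /\ derive1 f z = d.
Proof.
move=> r0 fd.
have cv : h^-1 *: (f (h + z) - f z) @[h --> 0^'] --> d.
  move=> A /nbhs_cabsP[e e0 eA]; rewrite nbhs_simpl/=.
  apply/nbhs_cabsP; exists (Num.min r (e / (1 + `|K|))).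
    by rewrite lt_min r0 divr_gt0// ltr_pwDl.
  move=> h; rewrite subr0 lt_min ltr_pdivlMr ?ltr_pwDl// => /andP[hr he] h0.
  apply: eA.
  have hp : 0 < cabs h by rewrite cabs_gt0.
  rewrite -[_ *: _]/(h^-1 * _) (_ : _ - d = h^-1 * (f (z + h) - f z - h * d)).
    rewrite cabsM cabsV mulrC ltr_pdivrMr// (le_lt_trans (fd h hr))//.
    apply: (@le_lt_trans _ _ (`|K| * cabs h ^+ 2)).
      by rewrite ler_wpM2r ?sqr_ge0// ler_norm.
    rewrite expr2 mulrA ltr_pM2r// (le_lt_trans _ he)//.
    by rewrite mulrC ler_pM2l// lerDr.
  by rewrite addrC [h + z]addrC [in RHS]mulrBr mulrA mulVf// mul1r addrC.
split; last exact: (cvg_lim _ cv).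
by rewrite derivable_cvgE; apply/cvg_ex; exists d.
Qed.

Lemma derivable_little_o (f : C -> C) z (e : R) : derivable f z 1 -> 0 < e ->
  exists2 d : R, 0 < d & forall w, cabs (w - z) < d ->
    cabs (f w - f z - (w - z) * derive1 f z) <= e * cabs (w - z).
Proof.
rewrite derivable_cvgE => fz e0.
have : h^-1 *: (f (h + z) - f z) @[h --> 0^'] --> derive1 f z by [].
move=> /(_ [set v | cabs (v - derive1 f z) < e]); rewrite /= nbhs_simpl/=.
case/(_ _)/nbhs_cabsP; first by apply/nbhs_cabsP; exists e.
move=> d d0 H; exists d => // w wz.
have [->|wz0] := eqVneq w z; first by rewrite !subrr mul0r subr0 cabs0 mulr0.
have h0 : w - z != 0 by rewrite subr_eq0.
have := H (w - z); rewrite subr0 => /(_ wz h0).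
rewrite /= -[_ *: _]/((w - z)^-1 * _) subrK => /ltW.
move=> /(ler_wpM2r (cabs_ge0 (w - z))); rewrite -cabsM.
rewrite (_ : _ * (w - z) = f w - f z - (w - z) * derive1 f z)//.
rewrite mulrBl mulrAC mulVf// mul1r [in RHS]mulrC//.
Qed.

Lemma derivable_continuous (f : C -> C) z : derivable f z 1 ->
  {for z, continuous f}.
Proof. by move=> /derivable1_diffP/differentiable_continuous. Qed.

End complex_basics.

(** * Integrals along paths *)

Section complex_integral.
Context {R : realType}.
Local Notation C := R[i].
Local Notation mu := (@lebesgue_measure R).
Implicit Types (a b c t : R) (phi psi : R -> C) (k : C).

Definition cint a b phi : C :=
  (\int[mu]_(t in `[a, b]) complex.Re (phi t)) +i*
  (\int[mu]_(t in `[a, b]) complex.Im (phi t)).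

(** Continuity is meant on the whole line, at the end points too: the integrands below are regular
    slightly beyond the segment, and compositions stay free of subspace topologies. *)
Definition cont_on a b phi := forall t, a <= t <= b -> {for t, continuous phi}.

Lemma continuous_Re phi t : {for t, continuous phi} ->
  {for t, continuous (fun t => complex.Re (phi t))}.
Proof.
by move=> ct; apply: (continuous_comp ct); exact: Re_continuous.
Qed.

Lemma continuous_Im phi t : {for t, continuous phi} ->
  {for t, continuous (fun t => complex.Im (phi t))}.
Proof.
by move=> ct; apply: (continuous_comp ct); exact: Im_continuous.
Qed.

Lemma within_cont a b (f : R -> R) :
  (forall t, a <= t <= b -> {for t, continuous f}) ->
  {within `[a, b], continuous f}.
Proof.
move=> cf; apply: continuous_in_subspaceT => t.
by rewrite inE/= in_itv/=; exact: cf.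
Qed.

Lemma cont_integrable a b (f : R -> R) :
  (forall t, a <= t <= b -> {for t, continuous f}) ->
  mu.-integrable `[a, b] (EFin \o f).
Proof.
move=> cf; apply: continuous_compact_integrable; first exact: segment_compact.
exact: within_cont.
Qed.

Lemma integrable_Re a b phi : cont_on a b phi ->
  mu.-integrable `[a, b] (EFin \o (fun t => complex.Re (phi t))).
Proof. by move=> c; apply: cont_integrable => t /c; exact: continuous_Re. Qed.

Lemma integrable_Im a b phi : cont_on a b phi ->
  mu.-integrable `[a, b] (EFin \o (fun t => complex.Im (phi t))).
Proof. by move=> c; apply: cont_integrable => t /c; exact: continuous_Im. Qed.

Lemma cont_onS a b c d phi : a <= c -> d <= b -> cont_on a b phi ->
  cont_on c d phi.
Proof.
move=> ac db h t /andP[ct td]; apply: h.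
by rewrite (le_trans ac)//= (le_trans td).
Qed.

Lemma cont_on_cst a b k : cont_on a b (fun=> k).
Proof. by move=> t _; exact: cst_continuous. Qed.

Lemma cont_onD a b phi psi : cont_on a b phi -> cont_on a b psi ->
  cont_on a b (fun t => phi t + psi t).
Proof. by move=> h1 h2 t ht; apply: cvgD; [exact: h1|exact: h2]. Qed.

Lemma cont_onN a b phi : cont_on a b phi -> cont_on a b (fun t => - phi t).
Proof. by move=> h1 t ht; apply: cvgN; exact: h1. Qed.

Lemma cont_onB a b phi psi : cont_on a b phi -> cont_on a b psi ->
  cont_on a b (fun t => phi t - psi t).
Proof. by move=> h1 h2; exact: (cont_onD h1 (cont_onN h2)). Qed.

Lemma cont_onM a b phi psi : cont_on a b phi -> cont_on a b psi ->
  cont_on a b (fun t => phi t * psi t).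
Proof. by move=> h1 h2 t ht; exact: (cvgM (h1 t ht) (h2 t ht)). Qed.

Lemma cont_onX a b phi n : cont_on a b phi -> cont_on a b (fun t => phi t ^+ n).
Proof.
move=> h; elim: n => [|n IH]; first exact: cont_on_cst.
rewrite (_ : (fun t => _) = (fun t => phi t * phi t ^+ n)); last first.
  by apply/funext => t; rewrite exprS.
exact: cont_onM.
Qed.

Lemma cont_onV a b phi : (forall t, a <= t <= b -> phi t != 0) ->
  cont_on a b phi -> cont_on a b (fun t => (phi t)^-1).
Proof. by move=> p0 h t ht; exact: (cvgV (p0 t ht) (h t ht)). Qed.

Lemma cont_on_conj a b phi : cont_on a b phi ->
  cont_on a b (fun t => conjc (phi t)).
Proof.
by move=> h t ht; apply: (continuous_comp (h t ht)); exact: conjc_continuous.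
Qed.

Lemma cont_on_comp a b phi (f : C -> C) : cont_on a b phi ->
  (forall t, a <= t <= b -> {for phi t, continuous f}) ->
  cont_on a b (fun t => f (phi t)).
Proof.
by move=> h hf t ht; apply: (continuous_comp (h t ht)); exact: hf.
Qed.

Lemma cont_onR a b (f : R -> R) :
  (forall t, a <= t <= b -> {for t, continuous f}) ->
  cont_on a b (fun t => (f t)%:C).
Proof.
move=> hf t ht; apply: (@complex_cvg _ _ (nbhs t)) => /=; first exact: hf.
exact: cvg_cst.
Qed.

Lemma cont_on_id a b : cont_on a b (fun t => t%:C).
Proof. by apply: cont_onR => t _; exact: cvg_id. Qed.

Lemma cont_on_sum a b (I : Type) (s : seq I) (F : I -> R -> C) :
  (forall i, cont_on a b (F i)) -> cont_on a b (fun t => \sum_(i <- s) F i t).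
Proof.
move=> h; elim: s => [|i s IH].
  rewrite (_ : (fun t => _) = (fun=> 0)); first exact: cont_on_cst.
  by apply/funext => t; rewrite big_nil.
rewrite (_ : (fun t => _) = (fun t => F i t + \sum_(i <- s) F i t)).
  exact: (cont_onD (h i) IH).
by apply/funext => t; rewrite big_cons.
Qed.

Lemma eq_cint a b phi psi : (forall t, a <= t <= b -> phi t = psi t) ->
  cint a b phi = cint a b psi.
Proof.
move=> e; congr (_ +i* _); apply: eq_Rintegral => t;
  by rewrite inE/= in_itv/= => /e ->.
Qed.

Lemma cintD a b phi psi : cont_on a b phi -> cont_on a b psi ->
  cint a b (fun t => phi t + psi t) = cint a b phi + cint a b psi.
Proof.
move=> h1 h2; rewrite /cint.
under eq_Rintegral do rewrite ReD.
under [X in _ +i* X]eq_Rintegral do rewrite ImD.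
by rewrite !RintegralD//; [exact: integrable_Im..|exact: integrable_Re|
  exact: integrable_Re].
Qed.

Lemma cintZ a b k phi : cont_on a b phi ->
  cint a b (fun t => k * phi t) = k * cint a b phi.
Proof.
move=> h; have hr := integrable_Re h; have hi := integrable_Im h.
have hc (x : R) (f : R -> R) : mu.-integrable `[a, b] (EFin \o f) ->
    mu.-integrable `[a, b] (EFin \o (fun t => x * f t)).
  by move=> hf; exact: (integrableZl _ x hf).
case: k => x y; rewrite /cint.
under eq_Rintegral do rewrite ReM/=.
under [X in _ +i* X]eq_Rintegral do rewrite ImM/=.
by rewrite RintegralB ?RintegralD ?RintegralZl//; exact: hc.
Qed.

Lemma cintN a b phi : cont_on a b phi ->
  cint a b (fun t => - phi t) = - cint a b phi.
Proof.
move=> h; rewrite -mulN1r -cintZ//; apply: eq_cint => t _.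
by rewrite mulN1r.
Qed.

Lemma cintB a b phi psi : cont_on a b phi -> cont_on a b psi ->
  cint a b (fun t => phi t - psi t) = cint a b phi - cint a b psi.
Proof.
by move=> h1 h2; rewrite (cintD h1 (cont_onN h2)) (cintN h2).
Qed.

Lemma cint0 a b : cint a b (fun=> 0) = 0.
Proof.
by rewrite -[RHS](mul0r (cint a b (fun=> 0))) -cintZ ?mul0r//; exact: cont_on_cst.
Qed.

Lemma cint_sum a b (I : Type) (s : seq I) (F : I -> R -> C) :
  (forall i, cont_on a b (F i)) ->
  cint a b (fun t => \sum_(i <- s) F i t) = \sum_(i <- s) cint a b (F i).
Proof.
move=> h; elim: s => [|i s IH].
  rewrite big_nil -[RHS](cint0 a b); apply: eq_cint => t _; exact: big_nil.
rewrite big_cons -IH -(cintD (h i) (cont_on_sum (s := s) h)).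
by apply: eq_cint => t _; rewrite big_cons.
Qed.

(** The factor 2 comes from bounding the real and imaginary parts separately; it reappears in most
    of the constants below. *)
Lemma cint_bound a b phi (M : R) : a <= b -> cont_on a b phi ->
  (forall t, a <= t <= b -> cabs (phi t) <= M) ->
  cabs (cint a b phi) <= 2 * M * (b - a).
Proof.
move=> ab h hM.
have bd (f : R -> R) : mu.-integrable `[a, b] (EFin \o f) ->
    (forall t, a <= t <= b -> `|f t| <= M) ->
    `|\int[mu]_(t in `[a, b]) f t| <= M * (b - a).
  move=> hf fM; rewrite (le_trans (le_normr_Rintegral _ hf))//.
  have iM : mu.-integrable `[a, b] (EFin \o (fun=> M)).
    by apply: cont_integrable => t _; exact: cst_continuous.
  apply: (@le_trans _ _ (\int[mu]_(t in `[a, b]) M)).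
    have iN : mu.-integrable `[a, b] (EFin \o (fun t => `|f t|)).
      exact: integrable_norm.
    apply: le_Rintegral; [by []|exact: iN|exact: iM|move=> t].
    by rewrite /= in_itv/=; exact: fM.
  rewrite Rintegral_cst//= lebesgue_measure_itv/= lte_fin.
  case: ltP => [_//|ba]; rewrite mulr0 (_ : b - a = 0) ?mulr0//.
  by apply/eqP; rewrite subr_eq0 eq_le ab ba.
rewrite (le_trans (cabs_ReIm _))//= -mulrA [2 * _]mulrDl mul1r lerD//; apply: bd.
- exact: integrable_Re.
- by move=> t /hM; exact: le_trans (cabs_Re _).
- exact: integrable_Im.
- by move=> t /hM; exact: le_trans (cabs_Im _).
Qed.

Lemma cint_split a c b phi : a <= c <= b -> cont_on a b phi ->
  cint a b phi = cint a c phi + cint c b phi.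
Proof.
move=> /andP[ac cb] h.
have sp (f : R -> R) : mu.-integrable `[a, b] (EFin \o f) ->
  \int[mu]_(t in `[a, b]) f t =
  \int[mu]_(t in `[a, c]) f t + \int[mu]_(t in `[c, b]) f t.
  move=> hf; rewrite -(@Rintegral_itv_obnd_cbnd _ c); last first.
    apply: integrableS hf => //; apply: subset_itv; rewrite bnd_simp//.
  rewrite -(@Rintegral_itvB _ f (BLeft a) (BRight b) c)//; first by rewrite addrC subrK.
by rewrite /cint sp ?(sp (fun t => complex.Im (phi t)))//; [exact: integrable_Im|exact: integrable_Re].
Qed.

End complex_integral.

Arguments cont_on_cst {R a b} k.
Arguments cont_on_id {R a b}.

Section path_derivative.
Context {R : realType}.
Local Notation C := R[i].
Implicit Types (F G : R -> C) (a b t : R) (v w k : C).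

(** [R[i]] is a normed module over itself, not over [R], hence the derivative of a path with real
    parameter is taken componentwise. *)
Definition is_cderive F v t :=
  is_derive t (1 : R) (fun t => complex.Re (F t)) (complex.Re v) /\
  is_derive t (1 : R) (fun t => complex.Im (F t)) (complex.Im v).

Lemma is_cderive_eq F v w t : is_cderive F v t -> v = w -> is_cderive F w t.
Proof. by move=> ? <-. Qed.

Lemma is_cderive_cst k t : is_cderive (fun=> k) 0 t.
Proof. by split; exact: is_derive_cst. Qed.

Lemma is_cderive_id t : is_cderive (fun t => t%:C) 1 t.
Proof. by split; [exact: is_derive_id|exact: is_derive_cst]. Qed.

Lemma is_cderiveD F G v w t : is_cderive F v t -> is_cderive G w t ->
  is_cderive (fun t => F t + G t) (v + w) t.
Proof.
move=> [Fr Fi] [Gr Gi]; split.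
  rewrite (_ : (fun t => _) = (fun t => complex.Re (F t)) \+ (fun t => complex.Re (G t))).
    by rewrite ReD; exact: is_deriveD.
  by apply/funext => s; rewrite ReD.
rewrite (_ : (fun t => _) = (fun t => complex.Im (F t)) \+ (fun t => complex.Im (G t))).
  by rewrite ImD; exact: is_deriveD.
by apply/funext => s; rewrite ImD.
Qed.

Lemma is_cderiveM F G v w t : is_cderive F v t -> is_cderive G w t ->
  is_cderive (fun t => F t * G t) (v * G t + F t * w) t.
Proof.
move=> [Fr Fi] [Gr Gi]; split.
  rewrite (_ : (fun t => _) =
    (fun t => complex.Re (F t)) * (fun t => complex.Re (G t)) -
    (fun t => complex.Im (F t)) * (fun t => complex.Im (G t))).
    apply: (is_derive_eq (is_deriveB (is_deriveM Fr Gr) (is_deriveM Fi Gi))).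
    rewrite ReD !ReM.
    rewrite -[_ *: complex.Re w]/(_ * _) -[_ *: complex.Re v]/(_ * _).
    rewrite -[_ *: complex.Im w]/(_ * _) -[_ *: complex.Im v]/(_ * _).
    by ring.
  by apply/funext => s; rewrite ReM.
rewrite (_ : (fun t => _) =
    (fun t => complex.Re (F t)) * (fun t => complex.Im (G t)) +
    (fun t => complex.Im (F t)) * (fun t => complex.Re (G t))).
  apply: (is_derive_eq (is_deriveD (is_deriveM Fr Gi) (is_deriveM Fi Gr))).
  rewrite ImD !ImM.
  rewrite -[_ *: complex.Re w]/(_ * _) -[_ *: complex.Re v]/(_ * _).
  rewrite -[_ *: complex.Im w]/(_ * _) -[_ *: complex.Im v]/(_ * _).
  by ring.
by apply/funext => s; rewrite ImM.
Qed.

Lemma is_cderiveZ k F v t : is_cderive F v t ->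
  is_cderive (fun t => k * F t) (k * v) t.
Proof.
move=> Fv; apply: is_cderive_eq; first exact: (is_cderiveM (is_cderive_cst k t) Fv).
by rewrite mul0r add0r.
Qed.

Lemma is_cderiveX F v t n : is_cderive F v t ->
  is_cderive (fun t => F t ^+ n) (n%:R * F t ^+ n.-1 * v) t.
Proof.
move=> Fv; elim: n => [|n IH].
  by rewrite !mul0r; exact: is_cderive_cst.
rewrite (_ : (fun t => _) = (fun t => F t * F t ^+ n)); last first.
  by apply/funext => s; rewrite exprS.
apply: is_cderive_eq; first exact: (is_cderiveM Fv IH).
case: n IH => [|n] _; first by rewrite !mul0r mulr0 addr0 expr0 mulr1 !mul1r.
rewrite /= -[n.+2]addn1 natrD !mulrDl !mul1r addrC; congr (_ + _).
  by rewrite [in RHS]exprS; ring.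
by rewrite mulrC.
Qed.

Lemma is_cderive_continuous F v t : is_cderive F v t -> {for t, continuous F}.
Proof.
move=> [[dr _] [di _]]; apply: complex_cvg.
  by move/derivable1_diffP/differentiable_continuous : dr.
by move/derivable1_diffP/differentiable_continuous : di.
Qed.

Lemma cint_FTC a b F (phi : R -> C) : a <= b -> cont_on a b phi ->
  (forall t, a <= t <= b -> is_cderive F (phi t) t) ->
  cint a b phi = F b - F a.
Proof.
rewrite le_eqVlt => /predU1P[->|ab] cphi dF.
  by rewrite /cint set_itv1 !Rintegral_set1 subrr.
have ftc (f g : R -> R) : (forall t, a <= t <= b -> {for t, continuous f}) ->
    (forall t, a <= t <= b -> is_derive t (1 : R) g (f t)) ->
    \int[lebesgue_measure]_(t in `[a, b]) f t = g b - g a.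
  move=> cf dg.
  have cg t : a <= t <= b -> {for t, continuous g}.
    by move=> /dg[/derivable1_diffP/differentiable_continuous].
  rewrite /Rintegral (continuous_FTC2 ab _ (F := g))//.
  - exact: within_cont.
  - split.
    + move=> t; rewrite in_itv/= => /andP[/ltW ta /ltW tb].
      by have [] := dg t; rewrite ?ta ?tb.
    + by apply: cvg_at_right_filter; apply: cg; rewrite lexx ltW.
    + by apply: cvg_at_left_filter; apply: cg; rewrite lexx ltW.
  - move=> t; rewrite in_itv/= => /andP[/ltW ta /ltW tb].
    have dgt : is_derive t (1 : R) g (f t) by apply: dg; rewrite ta tb.
    by rewrite derive1E; exact: derive_val.
rewrite /cint (ftc _ _ (fun t ht => continuous_Re (cphi t ht)) (fun t ht => (dF t ht).1)).
rewrite (ftc _ _ (fun t ht => continuous_Im (cphi t ht)) (fun t ht => (dF t ht).2)).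
by case: (F b) (F a) => [x y] [x' y'].
Qed.

(** The circle is run through once over [0, 1], so that [cint 0 1] of a function of [expi t] is its
    mean over the circle. *)
Definition expi t : C := cos (2 * pi * t) +i* sin (2 * pi * t).

Definition twopii : C := 0 +i* (2 * pi).

Lemma is_cderive_expi t : is_cderive expi (twopii * expi t) t.
Proof.
have dl : is_derive t (1 : R) (fun t : R => 2 * pi * t) (2 * pi : R).
  by apply: is_derive_eq; rewrite -[_ *: _]/(_ * _) mulr1.
split.
  rewrite ReM/= mul0r sub0r -mulrN [_ * - _]mulrC.
  exact: (is_derive1_comp (is_derive_cos (2 * pi * t)) dl).
rewrite ImM/= mul0r add0r [_ * cos _]mulrC.
exact: (is_derive1_comp (is_derive_sin (2 * pi * t)) dl).
Qed.

Lemma cabs_expi t : cabs (expi t) = 1.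
Proof. by rewrite /cabs normc_def/= cos2Dsin2 sqrtr1. Qed.

Lemma expi_neq0 t : expi t != 0.
Proof. by rewrite -cabs_gt0 cabs_expi. Qed.

Lemma expi0 : expi 0 = 1.
Proof. by rewrite /expi mulr0 cos0 sin0. Qed.

Lemma expi1 : expi 1 = 1.
Proof.
by rewrite /expi mulr1 mulr_natl cos2pi sin2pi.
Qed.

Lemma conj_expi t : conjc (expi t) = (expi t)^-1.
Proof.
apply: (mulfI (expi_neq0 t)); rewrite divff ?expi_neq0//.
rewrite /expi; set x := cos _; set y := sin _.
have xy : x ^+ 2 + y ^+ 2 = 1 by rewrite cos2Dsin2.
apply/eqP; rewrite eq_complex/=; apply/andP; split; apply/eqP.
  by rewrite -xy; ring.
by ring.
Qed.

Lemma expi_cont a b : cont_on a b expi.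
Proof. by move=> t _; exact: (is_cderive_continuous (is_cderive_expi t)). Qed.

Lemma twopii_neq0 : twopii != 0.
Proof.
rewrite eq_complex/= eqxx/= mulf_neq0// gt_eqF// pi_gt0//.
Qed.

(** For n > 0 the primitive expi^n / (2 pi i n) takes the same value at 0 and at 1. *)
Lemma cint_expiX n : cint 0 1 (fun t => expi t ^+ n) = (n == 0)%:R.
Proof.
have [->|n0] := eqVneq n 0%N.
  rewrite (@cint_FTC 0 1 (fun t => t%:C))//; first by rewrite subr0.
    exact: (cont_on_cst _).
  by move=> t _; exact: is_cderive_id.
have k0 : n%:R * twopii != 0.
  by rewrite mulf_neq0 ?twopii_neq0// pnatr_eq0.
rewrite (@cint_FTC 0 1 (fun t => (n%:R * twopii)^-1 * expi t ^+ n))//.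
- by rewrite expi0 expi1 subrr.
- exact/cont_onX/expi_cont.
- move=> t _; apply: is_cderive_eq.
    exact/is_cderiveZ/is_cderiveX/is_cderive_expi.
  case: n n0 k0 => // n _ k0 /=.
  rewrite [RHS](_ : _ = (n.+1%:R * twopii)^-1 * (n.+1%:R * twopii) * expi t ^+ n.+1).
    by rewrite exprS; ring.
  by rewrite mulVf// mul1r.
Qed.

Lemma cint_conj a b (phi : R -> C) : cont_on a b phi ->
  cint a b (fun t => conjc (phi t)) = conjc (cint a b phi).
Proof.
move=> h; rewrite /cint/=; congr (_ +i* _).
  by apply: eq_Rintegral => t _; case: (phi t).
rewrite -[RHS]mulN1r -RintegralZl//; last exact: integrable_Im.
by apply: eq_Rintegral => t _; rewrite mulN1r; case: (phi t).
Qed.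

Lemma cint_conj_expiX n : cint 0 1 (fun t => conjc (expi t) ^+ n) = (n == 0)%:R.
Proof.
have -> : (n == 0)%:R = conjc ((n == 0)%:R : C).
  by case: (n == 0); rewrite /= oppr0.
rewrite -cint_expiX -cint_conj; last exact/cont_onX/expi_cont.
by apply: eq_cint => t _; rewrite rmorphXn.
Qed.

End path_derivative.

Lemma continuous_affine (R : realType) (A B z0 z : R[i]) :
  {for z, continuous (fun z => A + B * (z - z0))}.
Proof.
have h1 : z - z0 @[z --> nbhs z] --> z - z0.
  by apply: (@cvgB _ _ _ (nbhs z)); [exact: cvg_id|exact: cvg_cst].
have h2 : B * (z - z0) @[z --> nbhs z] --> B * (z - z0).
  by apply: (@cvgM _ _ (nbhs z)) h1; exact: cvg_cst.
by apply: (@cvgD _ _ _ (nbhs z)) h2; exact: cvg_cst.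
Qed.

(** * Cauchy theory on the disc *)

Section goursat.
Context {R : realType}.
Local Notation C := R[i].
Variables (w : C) (kap kapd : R -> C) (K a0 : R).
Hypothesis K0 : 0 < K.
Hypothesis a00 : 0 <= a0 <= 1.
Hypothesis kapK : forall t, 0 <= t <= 1 -> cabs (kap t) <= K.
Hypothesis kapdK : forall t, 0 <= t <= 1 -> cabs (kapd t) <= K.
Hypothesis dkap : forall t, 0 <= t <= 1 -> is_cderive kap (kapd t) t.
Hypothesis ckapd : cont_on 0 1 kapd.

Local Notation H s t := (w + s%:C * kap t).

Let horiz (h : C -> C) (s c d : R) : C :=
  cint c d (fun t => h (H s t) * (s%:C * kapd t)).

Let vert (h : C -> C) (t a b : R) : C :=
  cint a b (fun s => h (H s t) * kap t).

(** The integral of [h] along the closed curve that is the image of the boundary of [a, b] x [c, d]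
    under (s, t) |-> [H s t]. *)
Let bd (h : C -> C) (a b c d : R) : C :=
  horiz h b c d - horiz h a c d - vert h d a b + vert h c a b.

Let ckap : cont_on 0 1 kap.
Proof. by move=> t /dkap; exact: is_cderive_continuous. Qed.

Let good (h : C -> C) := forall s t, a0 <= s <= 1 -> 0 <= t <= 1 ->
  {for H s t, continuous h}.

Let cont_horiz h s c d : good h -> a0 <= s <= 1 -> 0 <= c -> d <= 1 ->
  cont_on c d (fun t => h (H s t) * (s%:C * kapd t)).
Proof.
move=> gh s01 c0 d1; apply: (cont_onS c0 d1); apply: cont_onM; last first.
  exact: (cont_onM (cont_on_cst s%:C) ckapd).
apply: (@cont_on_comp _ _ _ (fun t => H s t)) => [|t t01]; last exact: gh.
exact: (cont_onD (cont_on_cst w) (cont_onM (cont_on_cst s%:C) ckap)).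
Qed.

Let cont_vert h t a b : good h -> 0 <= t <= 1 -> a0 <= a -> b <= 1 ->
  cont_on a b (fun s => h (H s t) * kap t).
Proof.
move=> gh t01 aa b1; apply: (cont_onS aa b1); apply: cont_onM; last first.
  exact: (cont_on_cst _).
apply: (@cont_on_comp _ _ _ (fun s => H s t)) => [|s s01]; last exact: gh.
exact: (cont_onD (cont_on_cst w) (cont_onM cont_on_id (cont_on_cst (kap t)))).
Qed.

Let bdD h1 h2 a b c d : good h1 -> good h2 -> a0 <= a -> a <= b -> b <= 1 ->
  0 <= c -> c <= d -> d <= 1 ->
  bd (fun z => h1 z + h2 z) a b c d = bd h1 a b c d + bd h2 a b c d.
Proof.
move=> g1 g2 aa ab b1 c0 cd d1.
have hD s : a0 <= s <= 1 -> horiz (fun z => h1 z + h2 z) s c d =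
    horiz h1 s c d + horiz h2 s c d.
  move=> s01; rewrite /horiz -cintD; [|exact: cont_horiz..].
  by apply: eq_cint => t _; rewrite mulrDl.
have vD t : 0 <= t <= 1 -> vert (fun z => h1 z + h2 z) t a b =
    vert h1 t a b + vert h2 t a b.
  move=> s01; rewrite /vert -cintD; [|exact: cont_vert..].
  by apply: eq_cint => s _; rewrite mulrDl.
have a1 : a0 <= a <= 1 by rewrite aa (le_trans ab).
have bb : a0 <= b <= 1 by rewrite b1 (le_trans aa).
have c1 : 0 <= c <= 1 by rewrite c0 (le_trans cd).
have d0 : 0 <= d <= 1 by rewrite d1 (le_trans c0).
rewrite /bd !hD// !vD//.
by ring.
Qed.

Let bd_split h a m b c n d : good h -> a0 <= a -> a <= m -> m <= b -> b <= 1 ->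
  0 <= c -> c <= n -> n <= d -> d <= 1 ->
  bd h a b c d = bd h a m c n + bd h m b c n + bd h a m n d + bd h m b n d.
Proof.
move=> gh aa am mb b1 c0 cn nd d1.
have hS s : a0 <= s <= 1 -> horiz h s c d = horiz h s c n + horiz h s n d.
  move=> s01; rewrite /horiz; apply: cint_split; first by rewrite cn nd.
  exact: cont_horiz.
have vS t : 0 <= t <= 1 -> vert h t a b = vert h t a m + vert h t m b.
  move=> t01; rewrite /vert; apply: cint_split; first by rewrite am mb.
  exact: cont_vert.
have a1 : a0 <= a <= 1 by rewrite aa (le_trans (le_trans am mb)).
have bb : a0 <= b <= 1 by rewrite b1 (le_trans aa (le_trans am mb)).
have c1 : 0 <= c <= 1 by rewrite c0 (le_trans (le_trans cn nd)).
have d0 : 0 <= d <= 1 by rewrite d1 (le_trans c0 (le_trans cn nd)).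
rewrite /bd !hS// !vS//.
move: (horiz h b c n) (horiz h b n d) (horiz h a c n) (horiz h a n d).
move: (vert h d a m) (vert h d m b) (vert h c a m) (vert h c m b).
move: (horiz h m c n) (horiz h m n d) (vert h n a m) (vert h n m b).
by move=> *; ring.
Qed.

(** An affine function has the primitive [P], so the four sides telescope over the corners. *)
Let bd_affine (A B z0 : C) a b c d : a0 <= a -> a <= b -> b <= 1 ->
  0 <= c -> c <= d -> d <= 1 -> bd (fun z => A + B * (z - z0)) a b c d = 0.
Proof.
move=> aa ab b1 c0 cd d1.
have gl : good (fun z => A + B * (z - z0)).
  by move=> s t _ _; exact: continuous_affine.
pose P z := A * z + (B / 2) * (z - z0) ^+ 2.
have two : (2 : C) != 0 by rewrite pnatr_eq0.
have dP F v t : is_cderive F v t ->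
    is_cderive (fun t => P (F t)) ((A + B * (F t - z0)) * v) t.
  move=> Fv; apply: is_cderive_eq.
    apply: is_cderiveD (is_cderiveZ A Fv) (is_cderiveZ (B / 2) (is_cderiveX 2 _)).
    exact: (is_cderiveD Fv (is_cderive_cst (- z0) t)).
  by rewrite /= expr1 addr0; field.
have hP s : a0 <= s <= 1 -> horiz (fun z => A + B * (z - z0)) s c d =
    P (H s d) - P (H s c).
  move=> s01; rewrite /horiz.
  rewrite (@cint_FTC _ c d (fun t => P (H s t)))//; first exact: (cont_horiz gl s01 c0 d1).
  move=> t /andP[ct td]; apply: dP; apply: is_cderive_eq.
    apply: is_cderiveD (is_cderive_cst w t) (is_cderiveZ s%:C _).
    by apply: dkap; rewrite (le_trans c0 ct) (le_trans td d1).
  by rewrite add0r.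
have vP t : 0 <= t <= 1 -> vert (fun z => A + B * (z - z0)) t a b =
    P (H b t) - P (H a t).
  move=> t01; rewrite /vert.
  rewrite (@cint_FTC _ a b (fun s => P (H s t)))//; first exact: (cont_vert gl t01 aa b1).
  move=> s _; apply: dP; apply: is_cderive_eq.
    exact: is_cderiveD (is_cderive_cst w s) (is_cderiveM (is_cderive_id s) (is_cderive_cst (kap t) s)).
  by rewrite add0r mul1r mulr0 addr0.
have a1 : a0 <= a <= 1 by rewrite aa (le_trans ab).
have bb : a0 <= b <= 1 by rewrite b1 (le_trans aa).
have c1 : 0 <= c <= 1 by rewrite c0 (le_trans cd).
have d0 : 0 <= d <= 1 by rewrite d1 (le_trans c0).
by rewrite /bd !hP// !vP//; ring.
Qed.

Let kap_lip t t0 : 0 <= t <= 1 -> 0 <= t0 <= 1 ->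
  cabs (kap t - kap t0) <= 2 * K * `|t - t0|.
Proof.
wlog tt : t t0 / t0 <= t.
  move=> wl t01 t001; have [tt|/ltW tt] := leP t0 t; first exact: wl.
  by rewrite cabsB distrC; exact: wl.
move=> /andP[_ t1] /andP[t00 _].
rewrite -(@cint_FTC _ t0 t kap kapd)//.
- rewrite ger0_norm ?subr_ge0//; apply: cint_bound => //.
    exact: cont_onS ckapd.
  by move=> u /andP[ut tu]; apply: kapdK; rewrite (le_trans t00)//= (le_trans tu).
- exact: cont_onS ckapd.
- by move=> u /andP[ut tu]; apply: dkap; rewrite (le_trans t00)//= (le_trans tu).
Qed.

Let bd_bound h (M : R) a b c d (l : R) : good h -> a0 <= a -> a <= b -> b <= 1 ->
  0 <= c -> c <= d -> d <= 1 -> b - a <= l -> d - c <= l ->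
  (forall s t, a <= s <= b -> c <= t <= d -> cabs (h (H s t)) <= M) ->
  cabs (bd h a b c d) <= 8 * M * K * l.
Proof.
move=> gh aa ab b1 c0 cd d1 bal dcl hM.
have M0 : 0 <= M.
  by rewrite (le_trans _ (hM a c _ _)) ?cabs_ge0 ?lexx.
have MK : 0 <= 2 * (M * K) by rewrite mulr_ge0// mulr_ge0// ltW.
have hB s : a <= s <= b -> cabs (horiz h s c d) <= 2 * (M * K) * l.
  move=> /[dup] sab /andP[sa sb].
  have s01 : a0 <= s <= 1 by rewrite (le_trans aa)//= (le_trans sb).
  have s0 : 0 <= s by have /andP[h0 _] := a00; have /andP[h1 _] := s01; exact: le_trans h1.
  rewrite (le_trans (y := 2 * (M * K) * (d - c)))//; last by rewrite ler_wpM2l.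
  apply: cint_bound => //; first exact: cont_horiz.
  move=> t /[dup] tcd /andP[tc td]; rewrite cabsM ler_pM ?cabs_ge0 ?hM//.
  rewrite cabsM cabsR ger0_norm// -[leRHS]mul1r ler_pM ?cabs_ge0 ?(le_trans sb)//.
  by apply: kapdK; rewrite (le_trans c0)//= (le_trans td).
have vB t : c <= t <= d -> cabs (vert h t a b) <= 2 * (M * K) * l.
  move=> /[dup] tcd /andP[tc td].
  have t01 : 0 <= t <= 1 by rewrite (le_trans c0)//= (le_trans td).
  rewrite (le_trans (y := 2 * (M * K) * (b - a)))//; last by rewrite ler_wpM2l.
  apply: cint_bound => //; first exact: cont_vert.
  by move=> s sab; rewrite cabsM ler_pM ?cabs_ge0 ?hM// kapK.
have -> : 8 * M * K * l = 2 * (M * K) * l + 2 * (M * K) * l + 2 * (M * K) * l + 2 * (M * K) * l by ring.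
rewrite /bd (le_trans (ler_cabsD _ _))// lerD//; last by rewrite vB// lexx.
rewrite (le_trans (ler_cabsD _ _))// cabsN lerD//; last by rewrite vB// lexx andbT.
rewrite (le_trans (ler_cabsD _ _))// cabsN lerD//; rewrite hB// lexx ?andbT//.
Qed.

Variable h : C -> C.
Hypothesis dh : forall s t, a0 <= s <= 1 -> 0 <= t <= 1 -> derivable h (H s t) 1.

Let gh : good h.
Proof. by move=> s t hs ht; apply: derivable_continuous; exact: dh. Qed.

(** Subtracting the tangent affine function at [H s0 t0], whose boundary integral is 0, leaves a
    remainder small compared with [l], integrated along a curve of length of order [l]. *)
Let bd_local s0 t0 (e : R) : a0 <= s0 <= 1 -> 0 <= t0 <= 1 -> 0 < e ->
  exists2 d : R, 0 < d & forall a b c' d' l, a0 <= a -> a <= s0 <= b -> b <= 1 ->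
   0 <= c' -> c' <= t0 <= d' -> d' <= 1 -> b - a <= l -> d' - c' <= l -> l < d ->
   cabs (bd h a b c' d') <= e * l ^+ 2.
Proof.
move=> hs0 ht0 e0; set z0 := H s0 t0.
(* 24 K^2 is the 8 K of [bd_bound] times 3 K, as the image of the rectangle lies within 3 K l of
   [z0]. *)
have e0' : 0 < e / (24 * K ^+ 2) by rewrite divr_gt0// mulr_gt0// exprn_gt0.
have [r r0 hr] := derivable_little_o (dh hs0 ht0) e0'.
exists (r / (3 * K)) => [|a b c d l aa /andP[as0 s0b] b1 c0 /andP[ct0 t0d] d1 bal dcl].
  by rewrite divr_gt0// mulr_gt0.
rewrite ltr_pdivlMr ?mulr_gt0// => lr.
have ab : a <= b := le_trans as0 s0b.
have cd : c <= d := le_trans ct0 t0d.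
pose A := h z0; pose B := derive1 h z0.
have gl : good (fun z => A + B * (z - z0)).
  by move=> s t _ _; exact: continuous_affine.
pose h2 z := h z - (A + B * (z - z0)).
have g2 : good h2.
  by move=> s t hs ht; exact: (cvgB (gh hs ht) (gl _ _ hs ht)).
have -> : h = fun z => (A + B * (z - z0)) + h2 z.
  by apply/funext => z; rewrite /h2 addrC subrK.
rewrite bdD// bd_affine// add0r.
have l0 : 0 <= l by rewrite (le_trans _ bal)// subr_ge0.
have Hz s t : a <= s <= b -> c <= t <= d -> cabs (H s t - z0) <= 3 * K * l.
  move=> /andP[sa sb] /andP[tc td].
  have t01 : 0 <= t <= 1 by rewrite (le_trans c0)//= (le_trans td).
  rewrite (_ : H s t - z0 = (s - s0)%:C * kap t + s0%:C * (kap t - kap t0)); last first.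
    by rewrite /z0 rmorphB/=; ring.
  rewrite (_ : 3 * K * l = l * K + 1 * (2 * K * l)); last by ring.
  rewrite (le_trans (ler_cabsD _ _))// !cabsM !cabsR lerD//.
    rewrite ler_pM ?cabs_ge0 ?kapK// (le_trans _ bal)// ler_norml.
    by rewrite opprB lerB//= lerB.
  have /andP[h1 h2'] := hs0; have /andP[h3 _] := a00.
  rewrite ler_pM ?cabs_ge0// ?ger0_norm// ?(le_trans h3)//.
  rewrite (le_trans (kap_lip t01 ht0))// ler_wpM2l ?mulr_ge0 ?(ltW K0)//.
  by rewrite (le_trans _ dcl)// ler_norml opprB lerB//= lerB.
rewrite (le_trans (bd_bound (M := e / (24 * K ^+ 2) * (3 * K * l)) (l := l) g2 _ _ _ _ _ _ _ _ _))//.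
  move=> s t sab tcd; have Hst := Hz s t sab tcd.
  rewrite /h2 opprD addrA [B * _]mulrC (le_trans (hr _ _))//.
    by rewrite (le_lt_trans Hst)// mulrC.
  by rewrite ler_wpM2l// ltW.
rewrite le_eqVlt; apply/orP; left; apply/eqP; field.
by rewrite gt_eqF.
Qed.

Let L := 1 - a0.
(** The triple (a, c, n) encodes the rectangle of corner (a, c) and sides L / 2^n and 1 / 2^n
    reached after n bisections; keeping one quarter at a time accounts for 4^n. *)
Let P (x : R * R * nat) (eta : R) := let: (a, c, n) := x in
  [/\ a0 <= a, a + L / 2 ^+ n <= 1, 0 <= c, c + 1 / 2 ^+ n <= 1 &
     eta / 4 ^+ n <= cabs (bd h a (a + L / 2 ^+ n) c (c + 1 / 2 ^+ n))].

Let nested (x y : R * R * nat) := let: (a, c, n) := x in let: (a', c', n') := y in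
  [/\ n' = n.+1, a <= a', a' + L / 2 ^+ n' <= a + L / 2 ^+ n,
      c <= c' & c' + 1 / 2 ^+ n' <= c + 1 / 2 ^+ n].

Let L0 : 0 <= L. Proof. by rewrite subr_ge0; case/andP: a00. Qed.

Let step x eta : P x eta -> exists2 y, P y eta & nested x y.
Proof.
case: x => [[a c] n] [aa a1 c0 c1 H0].
have h2 (x : R) : x / 2 ^+ n = x / 2 ^+ n.+1 + x / 2 ^+ n.+1.
  by rewrite exprS; field; rewrite expf_neq0.
pose u := L / 2 ^+ n.+1; pose v : R := 1 / 2 ^+ n.+1.
have u0 : 0 <= u by rewrite divr_ge0// exprn_ge0.
have v0 : 0 <= v by rewrite divr_ge0// exprn_ge0.
rewrite !h2 -/u -/v in a1 c1 H0.
have auu : a + u <= a + (u + u) by rewrite lerD2l lerDr.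
have cvv : c + v <= c + (v + v) by rewrite lerD2l lerDr.
have au : a <= a + u by rewrite lerDl.
have cv : c <= c + v by rewrite lerDl.
have := H0; rewrite (@bd_split h a (a + u) (a + (u + u)) c (c + v))// => H1.
have q : eta / 4 ^+ n = eta / 4 ^+ n.+1 + eta / 4 ^+ n.+1 + eta / 4 ^+ n.+1 + eta / 4 ^+ n.+1.
  by rewrite exprS; field; rewrite expf_neq0.
set e := eta / 4 ^+ n.+1 in q.
have [q1|q1] := leP e (cabs (bd h a (a + u) c (c + v))).
  exists (a, c, n.+1); split => //; rewrite ?h2 -/u -/v//.
  - exact: le_trans auu a1.
  - exact: le_trans cvv c1.
have [q2|q2] := leP e (cabs (bd h (a + u) (a + (u + u)) c (c + v))).
  exists (a + u, c, n.+1); split => //; rewrite ?h2 -/u -/v -?addrA//.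
  - exact: le_trans aa au.
  - exact: le_trans cvv c1.
have [q3|q3] := leP e (cabs (bd h a (a + u) (c + v) (c + (v + v)))).
  exists (a, c + v, n.+1); split => //; rewrite ?h2 -/u -/v -?addrA//.
  - exact: le_trans auu a1.
  - exact: le_trans c0 cv.
have [q4|q4] := leP e (cabs (bd h (a + u) (a + (u + u)) (c + v) (c + (v + v)))).
  exists (a + u, c + v, n.+1); split => //; rewrite ?h2 -/u -/v -?addrA//.
  - exact: le_trans aa au.
  - exact: le_trans c0 cv.
exfalso; move: H1; apply/negP; rewrite -ltNge q.
rewrite (le_lt_trans (ler_cabsD _ _))// ltrD// (le_lt_trans (ler_cabsD _ _))// ltrD//.
by rewrite (le_lt_trans (ler_cabsD _ _))// ltrD.
Qed.

(** Goursat's bisection, carried out on the parameters of the dilated paths w + s kap. When [kap] is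
    closed the right-hand side is 0, so that the loop integrals for s = 1 and s = a0 agree. *)
Lemma goursat : cint 0 1 (fun t => h (H 1 t) * (1%:C * kapd t)) -
  cint 0 1 (fun t => h (H a0 t) * (a0%:C * kapd t)) =
  cint a0 1 (fun s => h (H s 1) * kap 1) -
  cint a0 1 (fun s => h (H s 0) * kap 0).
Proof.
suff : bd h a0 1 0 1 = 0.
  by rewrite /bd /horiz /vert => /eqP; rewrite -addrA addr_eq0 opprD opprK => /eqP.
apply/eqP/negPn/negP; rewrite -cabs_gt0; set eta := cabs _ => eta0.
have P0 : P (a0, 0, 0%N) eta.
  have h1 : a0 + L / 2 ^+ 0 = 1 by rewrite expr0 divr1 /L addrC subrK.
  have h2 : 0 + 1 / 2 ^+ 0 = 1 :> R by rewrite expr0 divr1 add0r.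
  by split; rewrite ?h1 ?h2// expr0 divr1.
have stepT x : {y | P x eta -> P y eta /\ nested x y}.
  have [/step/cid2[y Py xy]|nP] := pselect (P x eta); first by exists y.
  by exists x.
have [f [f0 fS]] := dependent_choice stepT (a0, 0, 0%N).
have Pf n : P (f n) eta.
  by elim: n => [|n IH]; [rewrite f0|have [] := fS n IH].
have Nf n : nested (f n) (f n.+1) by have [] := fS n (Pf n).
pose a n := (f n).1.1; pose c n := (f n).1.2.
have f2 n : (f n).2 = n.
  elim: n => [|n IH]; first by rewrite f0.
  by have := Nf n; case: (f n) IH => [[? ?] ?]/= ->; case: (f n.+1) => [[? ?] ?] [].
have fE n : f n = (a n, c n, n).
  by have := f2 n; rewrite /a /c; case: (f n) => [[x y] m]/= ->.
have {}Pf n : [/\ a0 <= a n, a n + L / 2 ^+ n <= 1, 0 <= c n, c n + 1 / 2 ^+ n <= 1 &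
     eta / 4 ^+ n <= cabs (bd h (a n) (a n + L / 2 ^+ n) (c n) (c n + 1 / 2 ^+ n))].
  by have := Pf n; rewrite fE.
have {}Nf n : [/\ a n <= a n.+1, a n.+1 + L / 2 ^+ n.+1 <= a n + L / 2 ^+ n,
      c n <= c n.+1 & c n.+1 + 1 / 2 ^+ n.+1 <= c n + 1 / 2 ^+ n].
  by have := Nf n; rewrite !fE => -[].
have lim (x : nat -> R) (l : R) : 0 <= l -> (forall n, x n <= x n.+1) ->
    (forall n, x n.+1 + l / 2 ^+ n.+1 <= x n + l / 2 ^+ n) ->
    exists y, forall n, x n <= y <= x n + l / 2 ^+ n.
  move=> l0 xS xlS.
  have xm n m : (n <= m)%N -> x n <= x m.
    elim: m => [|m IH]; first by rewrite leqn0 => /eqP ->.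
    by rewrite leq_eqVlt => /predU1P[->//|/IH h1]; exact: le_trans (xS m).
  have xlm n m : (n <= m)%N -> x m + l / 2 ^+ m <= x n + l / 2 ^+ n.
    elim: m => [|m IH]; first by rewrite leqn0 => /eqP ->.
    by rewrite leq_eqVlt => /predU1P[->//|/IH h1]; exact: le_trans (xlS m) h1.
  have ub n m : x m <= x n + l / 2 ^+ n.
    have lp k : 0 <= l / 2 ^+ k by rewrite divr_ge0// exprn_ge0.
    rewrite (le_trans (xm m (maxn m n) (leq_maxl _ _)))//.
    rewrite (le_trans _ (xlm n (maxn m n) (leq_maxr _ _)))//.
    by rewrite lerDl.
  exists (sup (range x)) => n; apply/andP; split.
    apply: ub_le_sup; last by exists n.
    by exists (x 0%N + l / 2 ^+ 0) => _ [m _ <-].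
  apply: ge_sup; first by exists (x 0%N), 0%N.
  by move=> _ [m _ <-].
have [s0 hs0] : exists y, forall n, a n <= y <= a n + L / 2 ^+ n.
  by apply: lim => // n; have [] := Nf n.
have [t0 ht0] : exists y, forall n, c n <= y <= c n + 1 / 2 ^+ n.
  by apply: lim => // n; have [] := Nf n.
have s01 : a0 <= s0 <= 1.
  have [h1 h2 _ _ _] := Pf 0%N; have /andP[h3 h4] := hs0 0%N.
  by rewrite (le_trans h1)//= (le_trans h4).
have t01 : 0 <= t0 <= 1.
  have [_ _ h1 h2 _] := Pf 0%N; have /andP[h3 h4] := ht0 0%N.
  by rewrite (le_trans h1)//= (le_trans h4).
(* For l = 1 / 2^n the local bound reads (eta / 2) / 4^n, against the lower bound eta / 4^n kept
   along the bisection. *)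
have eta2 : 0 < eta / 2 by rewrite divr_gt0.
have [d d0 hd] := bd_local s01 t01 eta2.
have [n nd] : exists n, 1 / 2 ^+ n < d.
  have [n _ hn] := near_infty_natSinv_expn_lt (PosNum d0).
  by exists n; exact: (hn n (leqnn n)).
have [h1 h2 h3 h4 h5] := Pf n.
have p2 : 0 < 2 ^+ n :> R by rewrite exprn_gt0.
have := hd _ _ _ _ (1 / 2 ^+ n) h1 (hs0 n) h2 h3 (ht0 n) h4.
rewrite addrC addKr addrC addKr => /(_ _ _ nd).
have le1 : L / 2 ^+ n <= 1 / 2 ^+ n.
  by rewrite ler_pM2r ?invr_gt0// gerBl; case/andP: a00.
move=> /(_ le1 (lexx _)) /(le_trans h5).
rewrite expr_div_n expr1n -exprM mulnC exprM (_ : 2 ^+ 2 = 4 :> R); last by ring.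
by rewrite mul1r ler_pM2r ?invr_gt0 ?exprn_gt0// leNgt ltr_pdivrMr// ltr_pMr// ltr1n.
Qed.

End goursat.

(** * Cauchy integral formula *)

Section cauchy_formula.
Context {R : realType}.
Local Notation C := R[i].
Implicit Types (w x y z : C) (r : R) (f : C -> C) (phi : R -> C).

Lemma expr_small (q e : R) : 0 <= q -> q < 1 -> 0 < e ->
  exists N, forall n, (N <= n)%N -> q ^+ n <= e.
Proof.
move=> q0 q1 e0; have [N _ hN] : \forall n \near \oo, `|q ^+ n| <= e.
  apply: (@cvgr0_norm_le _ _ _ _ _ (fun n => q ^+ n)) => //.
  by apply: cvg_expr; rewrite ger0_norm.
exists N => n Nn; rewrite -[leLHS]ger0_norm ?exprn_ge0//.
exact: hN.
Qed.

Lemma geometric_expansion x n : x != 1 ->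
  (1 - x)^-1 = \sum_(k < n) x ^+ k + x ^+ n * (1 - x)^-1.
Proof.
move=> x1; have d0 : 1 - x != 0 by rewrite subr_eq0 eq_sym.
have h := subrX1 x n; apply: (mulfI d0); rewrite mulrDr mulrCA !divff// mulr1.
have -> : (1 - x) * (\sum_(i < n) x ^+ i) = - (x ^+ n - 1) by rewrite h -mulNr opprB.
by rewrite opprB subrK.
Qed.

(** With z = r expi t this is z / (z - w), the Cauchy kernel relative to the mean over the circle,
    in the form that expands in powers of [w]. *)
Definition circle_kernel r w t : C := (1 - w * (conjc (expi t) / r%:C))^-1.

Section kernel.
Variables (r : R) (w : C).
Hypothesis wr : cabs w < r.

Let r0 : 0 < r. Proof. exact: le_lt_trans (cabs_ge0 w) wr. Qed.

Lemma cabs_kernel_arg t : cabs (w * (conjc (expi t) / r%:C)) = cabs w / r.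
Proof.
by rewrite cabsM cabs_div cabs_conj cabs_expi cabsR gtr0_norm// mul1r.
Qed.

Lemma kernel_ratio : 0 < 1 - cabs w / r.
Proof. by rewrite subr_gt0 ltr_pdivrMr// mul1r. Qed.

Lemma kernel_denom t : 1 - cabs w / r <= cabs (1 - w * (conjc (expi t) / r%:C)).
Proof.
rewrite -(cabs_kernel_arg t) -[X in X - _](@cabs1 R); exact: ler_cabsB.
Qed.

Lemma kernel_denom_neq0 t : 1 - w * (conjc (expi t) / r%:C) != 0.
Proof. by rewrite -cabs_gt0 (lt_le_trans kernel_ratio)// kernel_denom. Qed.

Lemma cabs_circle_kernel t : cabs (circle_kernel r w t) <= (1 - cabs w / r)^-1.
Proof.
rewrite cabsV lef_pV2 ?posrE ?kernel_denom ?kernel_ratio//.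
by rewrite (lt_le_trans kernel_ratio)// kernel_denom.
Qed.

Lemma circle_kernel_cont a b : cont_on a b (circle_kernel r w).
Proof.
apply: cont_onV => [t _|]; first exact: kernel_denom_neq0.
apply: (cont_onB (cont_on_cst 1)); apply: (cont_onM (cont_on_cst w)).
exact: (cont_onM (cont_on_conj (@expi_cont R a b)) (cont_on_cst _)).
Qed.

Lemma circle_kernel_expansion n t : circle_kernel r w t =
  \sum_(k < n) w ^+ k * (conjc (expi t) / r%:C) ^+ k +
  w ^+ n * ((conjc (expi t) / r%:C) ^+ n * circle_kernel r w t).
Proof.
rewrite /circle_kernel [LHS](@geometric_expansion _ n); last first.
  by rewrite -subr_eq0 -oppr_eq0 opprB kernel_denom_neq0.
rewrite exprMn -mulrA; congr (_ + _).
by apply: eq_bigr => k _; rewrite exprMn.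
Qed.

End kernel.

Definition taylor_coef r phi (k : nat) : C :=
  cint 0 1 (fun t => phi t * (conjc (expi t) / r%:C) ^+ k).

Definition cauchy_int r phi w := cint 0 1 (fun t => phi t * circle_kernel r w t).

(** The derivative of [cauchy_int] in [w], taken under the integral: 1 / (1 - w u) has derivative u
    / (1 - w u)^2. *)
Definition cauchy_dint r phi w := cint 0 1 (fun t =>
  phi t * ((conjc (expi t) / r%:C) * circle_kernel r w t ^+ 2)).

Let cont_arg r a b n : cont_on a b (fun t => (conjc (expi t) / r%:C) ^+ n).
Proof.
apply: cont_onX.
exact: (cont_onM (cont_on_conj (@expi_cont R a b)) (cont_on_cst _)).
Qed.

Lemma cauchy_int_taylor r phi (M : R) w n : cont_on 0 1 phi ->
  (forall t, 0 <= t <= 1 -> cabs (phi t) <= M) -> cabs w < r ->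
  cabs (cauchy_int r phi w - \sum_(k < n) taylor_coef r phi k * w ^+ k)
  <= 2 * M * (cabs w / r) ^+ n / (1 - cabs w / r).
Proof.
move=> cphi phiM wr; have r0 : 0 < r by exact: le_lt_trans (cabs_ge0 w) wr.
have M0 : 0 <= M by rewrite (le_trans _ (phiM 0 _)) ?cabs_ge0 ?lexx/=.
pose psi (k : 'I_n) t := w ^+ k * (phi t * (conjc (expi t) / r%:C) ^+ k).
have cpsi k : cont_on 0 1 (psi k).
  exact: (cont_onM (cont_on_cst _) (cont_onM cphi (@cont_arg r 0 1 k))).
have -> : \sum_(k < n) taylor_coef r phi k * w ^+ k =
    cint 0 1 (fun t => \sum_(k <- index_enum 'I_n) psi k t).
  rewrite (cint_sum _ cpsi); apply: eq_bigr => k _.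
  by rewrite (cintZ _ (cont_onM cphi (@cont_arg r 0 1 k))) [LHS]mulrC.
have cK := circle_kernel_cont (a := 0) (b := 1) wr.
rewrite -(cintB (cont_onM cphi cK) (cont_on_sum cpsi)).
rewrite (_ : _ / _ = 2 * (M * ((cabs w / r) ^+ n / (1 - cabs w / r))) * (1 - 0)); last first.
  by rewrite subr0 mulr1 !mulrA.
apply: (cint_bound ler01).
  exact: (cont_onB (cont_onM cphi cK) (cont_on_sum cpsi)).
move=> t t01; rewrite (circle_kernel_expansion wr n t) mulrDr mulr_sumr.
rewrite (eq_bigr (psi^~ t)); last by move=> k _; rewrite /psi mulrCA.
rewrite addrC addKr cabsM ler_pM ?cabs_ge0 ?phiM// mulrA -exprMn cabsM cabsX.
rewrite cabs_kernel_arg// ler_wpM2l ?exprn_ge0 ?divr_ge0 ?cabs_ge0 ?(ltW r0)//.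
exact: cabs_circle_kernel.
Qed.

(** For the constant density 1 only the Taylor coefficient of index 0 survives, and the remainder
    decays like (|w| / r)^n. *)
Lemma cint_circle_kernel r w : cabs w < r -> cint 0 1 (circle_kernel r w) = 1.
Proof.
move=> wr; have r0 : 0 < r by exact: le_lt_trans (cabs_ge0 w) wr.
apply/eqP; rewrite -subr_eq0; apply/eqP/cabs_eq0P => e e0.
have kr := kernel_ratio wr.
have wr0 : 0 <= cabs w / r by rewrite divr_ge0 ?cabs_ge0 ?ltW.
have wr1 : cabs w / r < 1 by rewrite -subr_gt0.
have [N hN] := expr_small wr0 wr1 (mulr_gt0 (divr_gt0 e0 (ltr0Sn R 1)) kr).
have c1 : cont_on 0 1 (fun=> 1 : C) by exact: cont_on_cst.
have h1 (t : R) : 0 <= t <= 1 -> cabs (1 : C) <= 1 by rewrite cabs1.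
have := cauchy_int_taylor N.+1 c1 h1 wr.
rewrite (bigD1 ord0)//= expr0 mulr1 big1 ?addr0; last first.
  move=> [[|k] kN]//= _; rewrite /taylor_coef (_ : cint _ _ _ = 0) ?mul0r//.
  transitivity (r%:C ^- k.+1 * cint 0 1 (fun t => conjc (expi t) ^+ k.+1)).
    rewrite -(cintZ _ (cont_onX (n := k.+1) (cont_on_conj (@expi_cont R 0 1)))).
    by apply: eq_cint => t _; rewrite mul1r exprMn exprVn mulrC.
  by rewrite cint_conj_expiX mulr0.
have -> : taylor_coef r (fun=> 1) 0 = 1.
  transitivity (cint 0 1 (fun t : R => conjc (expi t) ^+ 0)).
    by apply: eq_cint => t _; rewrite mul1r !expr0.
  by rewrite cint_conj_expiX.
have -> : cauchy_int r (fun=> 1) w = cint 0 1 (circle_kernel r w).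
  by apply: eq_cint => t _; rewrite mul1r.
move=> /le_trans; apply; rewrite mulr1 ler_pdivrMr//.
have := hN N.+1 (leqnSn N); rewrite -(ler_pM2l (ltr0Sn R 1)) => /le_trans; apply.
by rewrite mulrA mulrCA divff ?mulr1// pnatr_eq0.
Qed.

(** The circle |z| = r is contracted to [w] through the loops w + s (r expi t - w), 0 < s <= 1,
    which stay in the disc by convexity. By [goursat] the integral of f(z) / (z - w) does not depend
    on s, and continuity of [f] at [w] gives its limit as s tends to 0. *)
Lemma cauchy_formula f r w : analytic disc f -> r < 1 -> cabs w < r ->
  f w = cauchy_int r (fun t => f (r%:C * expi t)) w.
Proof.
move=> fan r1 wr; have r0 : 0 < r by exact: le_lt_trans (cabs_ge0 w) wr.
have rC0 : r%:C != 0 by rewrite -cabs_gt0 cabsR gtr0_norm.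
pose kap t : C := r%:C * expi t - w.
pose kapd t : C := r%:C * (twopii * expi t).
pose h z := f z / (z - w).
have kapE t : kap t = r%:C * expi t * (1 - w * (conjc (expi t) / r%:C)).
  by rewrite /kap conj_expi; have := expi_neq0 t => e0; field; rewrite rC0 e0.
have kap0 t : kap t != 0.
  by rewrite kapE !mulf_neq0 ?expi_neq0// kernel_denom_neq0.
have kerE t : kapd t / kap t = twopii * circle_kernel r w t.
  have := kernel_denom_neq0 wr t.
  rewrite kapE /kapd /circle_kernel; set d := (1 - _) => d0.
  by have e0 := expi_neq0 t; field; rewrite rC0 e0 d0.
have dkap t : is_cderive kap (kapd t) t.
  apply: is_cderive_eq.
    exact: (is_cderiveD (is_cderiveZ r%:C (is_cderive_expi t)) (is_cderive_cst (- w) t)).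
  by rewrite addr0.
have ckapd : cont_on 0 1 kapd.
  exact: (cont_onM (cont_on_cst _) (cont_onM (cont_on_cst _) (@expi_cont R 0 1))).
have cker := circle_kernel_cont (a := 0) (b := 1) wr.
have Hdisc (s t : R) : 0 <= s <= 1 -> disc (w + s%:C * kap t).
  move=> /andP[s0 s1]; apply/discP.
  rewrite (_ : _ + _ = (1 - s)%:C * w + s%:C * (r%:C * expi t)); last first.
    by rewrite rmorphB rmorph1 /kap; ring.
  rewrite (le_lt_trans (ler_cabsD _ _))// !cabsM !cabsR cabs_expi mulr1.
  rewrite !ger0_norm ?subr_ge0 ?(ltW r0)//.
  rewrite (@le_lt_trans _ _ ((1 - s) * r + s * r))//; last first.
    by rewrite -mulrDl subrK mul1r.
  by rewrite lerD2r ler_wpM2l ?subr_ge0// ltW.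
(* [twopii * Phi s] is the integral of f(z) / (z - w) along the loop of parameter [s]: the factor s
   of dz cancels the one of z - w. *)
pose Phi s := cint 0 1 (fun t => f (w + s%:C * kap t) * circle_kernel r w t).
have cH s : 0 <= s <= 1 -> cont_on 0 1 (fun t => f (w + s%:C * kap t)).
  move=> s01; apply: (@cont_on_comp _ _ _ (fun t => w + s%:C * kap t)) => [|t _].
    apply: (cont_onD (cont_on_cst w)); apply: (cont_onM (cont_on_cst _)).
    exact: (cont_onB (cont_onM (cont_on_cst _) (@expi_cont R 0 1)) (cont_on_cst w)).
  by apply: derivable_continuous; apply: fan; exact: Hdisc.
have cPhi s : 0 <= s <= 1 ->
    cont_on 0 1 (fun t => f (w + s%:C * kap t) * circle_kernel r w t).
  by move=> s01; exact: (cont_onM (cH s s01) cker).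
have PhiE s : 0 < s -> s <= 1 -> cint 0 1 (fun t =>
    h (w + s%:C * kap t) * (s%:C * kapd t)) = twopii * Phi s.
  move=> s0 s1; rewrite /Phi -cintZ; last by apply: cPhi; rewrite ltW.
  apply: eq_cint => t _; rewrite /h [w + _ - w](_ : _ = s%:C * kap t); last first.
    by rewrite addrC addKr.
  rewrite [RHS]mulrCA -kerE.
  have sC0 : s%:C != 0 by rewrite -cabs_gt0 cabsR gtr0_norm.
  by have := kap0 t => k0; field; rewrite k0 sC0.
have PhiS s : 0 < s -> s <= 1 -> Phi 1 = Phi s.
  move=> s0 s1; apply: (mulfI (@twopii_neq0 R)); apply/eqP; rewrite -subr_eq0.
  rewrite -!PhiE//.
  (* r + |w| bounds [kap] and 2 pi r bounds [kapd]. *)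
  pose K : R := r * (2 * pi) + r + cabs w.
  rewrite (@goursat _ w kap kapd K s).
  - rewrite subr_eq0; apply/eqP; apply: eq_cint => u _.
    by rewrite /kap expi0 expi1.
  - by rewrite /K -addrA ltr_pwDl ?mulr_gt0 ?pi_gt0// addr_ge0 ?cabs_ge0 ?ltW.
  - by rewrite ltW.
  - move=> t _; rewrite /kap /K (le_trans (ler_cabsD _ _))//.
    rewrite cabsN cabsM cabsR cabs_expi mulr1 gtr0_norm// lerD2r lerDr.
    by rewrite mulr_ge0 ?ltW// mulr_gt0// pi_gt0.
  - move=> t _; rewrite /kapd /K !cabsM cabsR cabs_expi mulr1 gtr0_norm//.
    rewrite [cabs twopii](_ : _ = 2 * pi); last first.
      rewrite (_ : twopii = 'i * (2 * pi)%:C); last first.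
        by apply/eqP; rewrite eq_complex/=; apply/andP; split; apply/eqP; ring.
      rewrite cabsM cabsR ger0_norm ?mulr_ge0 ?pi_ge0//.
      by rewrite /cabs normc_def/= expr0n/= expr1n add0r sqrtr1 mul1r.
    by rewrite -addrA lerDl addr_ge0 ?cabs_ge0 ?ltW.
  - by move=> t _; exact: dkap.
  - exact: ckapd.
  - move=> u t /andP[su u1] _.
    have u0 : 0 < u := lt_le_trans s0 su.
    have Hu : disc (w + u%:C * kap t) by apply: Hdisc; rewrite (ltW u0).
    have Hw : w + u%:C * kap t - w != 0.
      rewrite addrC addKr mulf_neq0// -cabs_gt0 cabsR gtr0_norm//.
    apply: derivableM; first exact: fan.
    apply: derivableV => //; exact: derivableB.
have -> : f w = f w * cint 0 1 (circle_kernel r w).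
  by rewrite cint_circle_kernel// mulr1.
apply/esym/eqP; rewrite -subr_eq0; apply/eqP/cabs_eq0P => e e0.
have -> : cauchy_int r (fun t => f (r%:C * expi t)) w = Phi 1.
  by apply: eq_cint => t _; rewrite /kap mul1r [w + _]addrC subrK.
have kr := kernel_ratio wr.
have fw : {for w, continuous f}.
  by apply: derivable_continuous; apply: fan; apply/discP; exact: lt_trans r1.
have e0' : 0 < e / 2 * (1 - cabs w / r) by rewrite mulr_gt0// divr_gt0.
have [d d0 hd] := (continuous_cabsP f w).1 fw _ e0'.
(* As |kap| < 2 r, the loop of parameter [s] stays within d / 2 of [w]. *)
pose s := Num.min 1 (d / (4 * r)).
have s0 : 0 < s by rewrite lt_min ltr01 divr_gt0// mulr_gt0.
have s1 : s <= 1 by rewrite ge_min lexx.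
have s01 : 0 <= s <= 1 by rewrite ltW.
rewrite (PhiS s)// -(cintZ _ cker).
rewrite -(cintB (cPhi s s01) (cont_onM (cont_on_cst _) cker)).
have -> : e = 2 * (e / 2 * (1 - cabs w / r) * (1 - cabs w / r)^-1) * (1 - 0).
  by have /lt0r_neq0 := kr; set a := 1 - _ / _ => a0; field.
apply: (cint_bound ler01).
  exact: (cont_onB (cPhi s s01) (cont_onM (cont_on_cst _) cker)).
move=> t _; rewrite -mulrBl cabsM ler_pM ?cabs_ge0 ?cabs_circle_kernel//.
apply/ltW/hd; rewrite addrC addKr cabsM cabsR gtr0_norm//.
have kb : cabs (kap t) < 2 * r.
  rewrite /kap (le_lt_trans (ler_cabsD _ _))// cabsN cabsM cabsR cabs_expi mulr1.
  by rewrite gtr0_norm// mulr_natl mulr2n ltrD2l.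
apply: (@lt_le_trans _ _ (s * (2 * r))); first by rewrite ltr_pM2l.
apply: (@le_trans _ _ (d / (4 * r) * (2 * r))).
  by rewrite ler_wpM2r ?mulr_ge0 ?(ltW r0)// ge_min lexx orbT.
rewrite (_ : _ * _ = d / 2); last by field; rewrite gt_eqF.
by rewrite ler_pdivrMr// ler_peMr ?(ltW d0)// ler1n.
Qed.

End cauchy_formula.

(** * Analytic functions as locally uniform limits of polynomials *)

Section analytic_toolkit.
Context {R : realType}.
Local Notation C := R[i].
Implicit Types (w x y z : C) (r : R) (f g : C -> C) (phi : R -> C) (p : {poly C}).

Lemma cont_on_bounded a b phi : a <= b -> cont_on a b phi ->
  exists2 M : R, 0 < M & forall t, a <= t <= b -> cabs (phi t) <= M.
Proof.
move=> ab h.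
have cc : {within `[a, b], continuous (cabs \o phi)}.
  apply: within_cont => t /h ct; apply: (continuous_comp ct).
  exact: cabs_continuous.
have [c _ hc] := EVT_max ab cc.
exists (1 + cabs (phi c)) => [|t tab]; first by rewrite ltr_pwDl ?cabs_ge0.
have := hc t; rewrite in_itv/= tab => /(_ isT) /= /le_trans; apply.
by rewrite lerDr.
Qed.

(** The density [phi] is arbitrary, so that this serves analytic functions as well as locally
    uniform limits of polynomials, whose analyticity is still to be shown. *)
Lemma cauchy_rep_derivable f r phi w : cont_on 0 1 phi ->
  (forall x, cabs x < r -> f x = cauchy_int r phi x) -> cabs w < r ->
  derivable f w 1 /\ derive1 f w = cauchy_dint r phi w.
Proof.
move=> cphi fE wr; have r0 : 0 < r by exact: le_lt_trans (cabs_ge0 w) wr.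
have [M M0 phiM] := cont_on_bounded ler01 cphi.
pose rho := (cabs w + r) / 2.
have wrho : cabs w < rho by rewrite /rho midf_lt.
have rhor : rho < r by rewrite /rho midf_lt.
pose kk := (1 - rho / r)^-1.
have kk0 : 0 < 1 - rho / r by rewrite subr_gt0 ltr_pdivrMr// mul1r.
have kb x t : cabs x <= rho -> cabs (circle_kernel r x t) <= kk.
  move=> xr; rewrite (le_trans (cabs_circle_kernel (le_lt_trans xr rhor) t))//.
  rewrite lef_pV2 ?posrE// ?lerB ?ler_pM2r ?invr_gt0//.
  exact: kernel_ratio (le_lt_trans xr rhor).
apply: (@derivable_quadratic _ _ _ _ (2 * (M * (r^-1 ^+ 2 * kk ^+ 3))) (rho - cabs w)).
  by rewrite subr_gt0.
move=> h hr.
have whr : cabs (w + h) <= rho.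
  by rewrite (le_trans (ler_cabsD _ _))// addrC -lerBrDr ltW.
have whr' := le_lt_trans whr rhor.
have cu : cont_on 0 1 (fun t => conjc (expi t) / r%:C).
  exact: (cont_onM (cont_on_conj (@expi_cont R 0 1)) (cont_on_cst _)).
have c1 := cont_onM cphi (circle_kernel_cont (a := 0) (b := 1) whr').
have c2 := cont_onM cphi (circle_kernel_cont (a := 0) (b := 1) wr).
have c3 := cont_onM cphi (cont_onM cu (cont_onX (n := 2) (circle_kernel_cont (a := 0) (b := 1) wr))).
rewrite !fE// /cauchy_int /cauchy_dint -(cintB c1 c2) -(cintZ h c3).
rewrite -(cintB (cont_onB c1 c2) (cont_onM (cont_on_cst h) c3)).
rewrite (_ : _ * cabs h ^+ 2 = 2 * (M * (r^-1 ^+ 2 * kk ^+ 3 * cabs h ^+ 2)) * (1 - 0)); last first.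
  by rewrite subr0 mulr1 !mulrA.
apply: (cint_bound ler01); first exact: (cont_onB (cont_onB c1 c2) (cont_onM (cont_on_cst h) c3)).
move=> t t01; set u := conjc (expi t) / r%:C.
have uE : cabs u = r^-1.
  by rewrite /u cabs_div cabs_conj cabs_expi cabsR gtr0_norm// mul1r.
have d1 := kernel_denom_neq0 whr' t; have d2 := kernel_denom_neq0 wr t.
have -> : phi t * circle_kernel r (w + h) t - phi t * circle_kernel r w t -
   h * (phi t * (u * circle_kernel r w t ^+ 2)) =
   phi t * (u ^+ 2 * (circle_kernel r (w + h) t * circle_kernel r w t ^+ 2) * h ^+ 2).
  rewrite /circle_kernel -/u in d1 d2 *.
  by clear uE; move: (phi t) u d1 d2 => P v d1 d2; field; rewrite d1 d2.
have e3 : kk ^+ 3 = kk * kk ^+ 2 by rewrite exprS.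
rewrite cabsM; apply: ler_pM (cabs_ge0 _) (cabs_ge0 _) (phiM _ t01) _.
rewrite cabsM cabsM cabsM !cabsX uE e3.
rewrite ler_wpM2r ?exprn_ge0 ?cabs_ge0// ler_wpM2l ?exprn_ge0 ?invr_ge0 ?(ltW r0)//.
rewrite ler_pM ?cabs_ge0 ?exprn_ge0 ?cabs_ge0 ?kb//.
by rewrite lerXn2r ?nnegrE ?cabs_ge0 ?invr_ge0 ?(ltW kk0)// kb// ltW.
Qed.

Lemma circle_path_disc r t : 0 <= r < 1 -> disc (r%:C * expi t).
Proof.
by move=> /andP[r0 r1]; apply/discP; rewrite cabsM cabsR cabs_expi mulr1 ger0_norm.
Qed.

Lemma analytic_continuous f z : analytic disc f -> disc z -> {for z, continuous f}.
Proof. by move=> fan Dz; apply: derivable_continuous; exact: fan. Qed.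

Lemma cont_on_circle f r a b : 0 <= r < 1 ->
  (forall z, disc z -> {for z, continuous f}) ->
  cont_on a b (fun t => f (r%:C * expi t)).
Proof.
move=> r01 cf; apply: (@cont_on_comp _ _ _ (fun t => r%:C * expi t)).
  exact: (cont_onM (cont_on_cst _) (@expi_cont R a b)).
by move=> t _; apply: cf; exact: circle_path_disc.
Qed.

Lemma analytic_derive1E f r w : analytic disc f -> r < 1 -> cabs w < r ->
  derive1 f w = cauchy_dint r (fun t => f (r%:C * expi t)) w.
Proof.
move=> fan r1 wr; have r0 : 0 <= r by exact: le_trans (cabs_ge0 w) (ltW wr).
have cf : cont_on 0 1 (fun t => f (r%:C * expi t)).
  by apply: cont_on_circle; [rewrite r0|move=> z; exact: analytic_continuous].
have := @cauchy_rep_derivable f r _ w cf _ wr; case=> // x xr.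
exact: cauchy_formula.
Qed.

(** Cauchy estimate, read off the differentiated kernel. *)
Lemma derive1_bound f r rho w (M : R) : analytic disc f -> r < 1 ->
  (forall z, cabs z = r -> cabs (f z) <= M) -> cabs w <= rho -> rho < r ->
  cabs (derive1 f w) <= 2 * (M * (r^-1 * (1 - rho / r)^-1 ^+ 2)).
Proof.
move=> fan r1 fM wrho rhor; have wr := le_lt_trans wrho rhor.
have r0 : 0 < r by exact: le_lt_trans (cabs_ge0 w) wr.
rewrite (analytic_derive1E fan r1 wr) -[leRHS]mulr1 -[X in _ * X](subr0 (1 : R)).
have cu : cont_on 0 1 (fun t => conjc (expi t) / r%:C).
  exact: (cont_onM (cont_on_conj (@expi_cont R 0 1)) (cont_on_cst _)).
have cphi : cont_on 0 1 (fun t => f (r%:C * expi t)).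
  by apply: cont_on_circle; [rewrite ltW|move=> z; exact: analytic_continuous].
apply: (cint_bound ler01).
  exact: (cont_onM cphi (cont_onM cu (cont_onX (n := 2) (circle_kernel_cont (a := 0) (b := 1) wr)))).
move=> t t01; rewrite cabsM ler_pM ?cabs_ge0//.
  by apply: fM; rewrite cabsM cabsR cabs_expi mulr1 gtr0_norm.
rewrite cabsM cabs_div cabs_conj cabs_expi cabsR gtr0_norm// mul1r cabsX.
have k0 : 0 < 1 - rho / r by rewrite subr_gt0 ltr_pdivrMr// mul1r.
rewrite ler_wpM2l ?invr_ge0 ?(ltW r0)// lerXn2r ?nnegrE ?cabs_ge0 ?invr_ge0 ?(ltW k0)//.
rewrite (le_trans (cabs_circle_kernel wr t))// lef_pV2 ?posrE ?kernel_ratio//.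
by rewrite lerB// ler_pM2r ?invr_gt0.
Qed.

(** Equivalent to analyticity by the lemmas below. Stability under uniform limits, derivation and
    integration is immediate in this form. *)
Definition locally_poly f := forall r (e : R), 0 < r < 1 -> 0 < e ->
  exists p, forall z, cabs z <= r -> cabs (f z - p.[z]) <= e.

(** The polynomials are Taylor sums, with coefficients computed on an intermediate circle of radius
    [r'] between r and 1. *)
Lemma analytic_locally_poly f : analytic disc f -> locally_poly f.
Proof.
move=> fan r e /andP[r0 r1] e0.
pose r' := (r + 1) / 2.
have rr' : r < r' by rewrite /r' midf_lt.
have r'1 : r' < 1 by rewrite /r' midf_lt.
have r'0 : 0 < r' := lt_trans r0 rr'.
have cphi : cont_on 0 1 (fun t => f (r'%:C * expi t)).
  by apply: cont_on_circle; [rewrite ltW|move=> z; exact: analytic_continuous].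
have [M M0 phiM] := cont_on_bounded ler01 cphi.
pose q := r / r'.
have q0 : 0 <= q by rewrite divr_ge0 ?ltW.
have q1 : q < 1 by rewrite ltr_pdivrMr// mul1r.
have q1' : 0 < 1 - q by rewrite subr_gt0.
have [N hN] := expr_small q0 q1 (divr_gt0 (mulr_gt0 e0 q1') (mulr_gt0 (ltr0Sn R 1) M0)).
exists (\poly_(k < N) taylor_coef r' (fun t => f (r'%:C * expi t)) k) => z zr.
have zr' := le_lt_trans zr rr'.
rewrite horner_poly (cauchy_formula fan r'1 zr').
rewrite (le_trans (cauchy_int_taylor N cphi phiM zr'))//.
have zq : cabs z / r' <= q by rewrite ler_pM2r ?invr_gt0.
rewrite ler_pdivrMr ?kernel_ratio//.
apply: (@le_trans _ _ (e * (1 - q))); last by rewrite ler_wpM2l ?(ltW e0)// lerB.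
have M2 : 0 < 2 * M by rewrite mulr_gt0.
rewrite mulrC -ler_pdivlMr//; apply: le_trans (hN N (leqnn N)).
by rewrite lerXn2r// nnegrE divr_ge0 ?cabs_ge0 ?ltW.
Qed.

Lemma is_derive_horner p z : is_derive z 1 (horner p) (p^`()).[z].
Proof.
elim/poly_ind: p => [|p c IH].
  rewrite (_ : horner 0 = cst 0); last by apply/funext => x; rewrite horner0.
  by rewrite deriv0 horner0; exact: is_derive_cst.
rewrite (_ : horner _ = (horner p * id) + cst c); last first.
  by apply/funext => x; rewrite hornerD hornerMX hornerC.
have h := is_deriveD (is_deriveM IH (is_derive_id z 1)) (is_derive_cst c z 1).
apply: (is_derive_eq h).
rewrite -[_ *: _]/(_ * _) -[_ *: (p^`()).[z]]/(_ * _) derivD derivC addr0 derivM derivX.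
by rewrite mulr1 addr0 hornerD mulr1 hornerMX addrC [in RHS]mulrC.
Qed.

Lemma analytic_horner p D : analytic D (horner p).
Proof. by move=> z _; have [] := is_derive_horner p z. Qed.

Lemma derive1_horner p z : derive1 (horner p) z = (p^`()).[z].
Proof. by rewrite derive1E; have [_ ->] := is_derive_horner p z. Qed.

Lemma horner_continuous p z : {for z, continuous (horner p)}.
Proof. by apply: derivable_continuous; have [] := is_derive_horner p z. Qed.

Lemma mid_disc z : disc z -> let r := (cabs z + 1) / 2 in
  [/\ 0 < r, r < 1 & cabs z < r].
Proof.
move=> /discP z1 r.
have [h1 h2] : cabs z < r /\ r < 1 by rewrite /r !midf_lt.
by split=> //; exact: le_lt_trans (cabs_ge0 z) h1.
Qed.

Lemma locally_poly_continuous f z : locally_poly f -> disc z ->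
  {for z, continuous f}.
Proof.
move=> flp Dz; have [r0 r1 zr] := mid_disc Dz; set r := _ / 2 in r0 r1 zr.
apply/continuous_cabsP => e e0.
have e4 : 0 < e / 4 by rewrite divr_gt0.
have [|p hp] := flp r _ _ e4; first by rewrite r0.
have [d d0 hd] := (continuous_cabsP _ _).1 (@horner_continuous p z) _ e4.
exists (Num.min d (r - cabs z)); first by rewrite lt_min d0 subr_gt0.
move=> w; rewrite lt_min => /andP[wd wr].
have wr' : cabs w <= r.
  rewrite -(subrK z w) (le_trans (ler_cabsD _ _))// -lerBrDr ltW//.
apply: (@le_lt_trans _ _ (e / 4 + e / 4 + e / 4)); last by lra.
rewrite (_ : f w - f z = (f w - p.[w]) + (p.[w] - p.[z]) - (f z - p.[z])); last by ring.
rewrite (le_trans (ler_cabsD _ _))// cabsN lerD//; last exact: hp (ltW zr).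
by rewrite (le_trans (ler_cabsD _ _))// lerD//; [exact: hp|exact/ltW/hd].
Qed.

(** The Cauchy formula of the approximating polynomials passes to the limit, and a function given by
    a Cauchy integral is differentiable. *)
Lemma locally_poly_analytic f : locally_poly f -> analytic disc f.
Proof.
move=> flp z Dz; have [r0 r1 zr] := mid_disc Dz; set r := _ / 2 in r0 r1 zr.
have r01 : 0 <= r < 1 by rewrite ltW.
have cf : cont_on 0 1 (fun t => f (r%:C * expi t)).
  by apply: cont_on_circle => // x; exact: locally_poly_continuous.
have [] // := @cauchy_rep_derivable f r _ z cf _ zr.
move=> x xr; apply/eqP; rewrite -subr_eq0; apply/eqP/cabs_eq0P => e e0.
have kr := kernel_ratio xr; pose k := (1 - cabs x / r)^-1.
have k0 : 0 < k by rewrite invr_gt0.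
(* The error at [x] and the error under the integral add up to (1 + 2 k) times this quantity. *)
have e1 : 0 < e / (1 + 2 * k) by rewrite divr_gt0// addr_gt0// mulr_gt0.
have [|p hp] := flp r _ _ e1; first by rewrite r0.
set e' := e / _ in e1 hp.
have cp : cont_on 0 1 (fun t => p.[r%:C * expi t]).
  by apply: (@cont_on_circle (horner p)) => // y _; exact: horner_continuous.
have cK := circle_kernel_cont (a := 0) (b := 1) xr.
rewrite (_ : f x - _ = (f x - p.[x]) -
    (cauchy_int r (fun t => f (r%:C * expi t)) x - cauchy_int r (fun t => p.[r%:C * expi t]) x)); last first.
  rewrite -(@cauchy_formula _ (horner p) r x)//; first by ring.
  exact: analytic_horner.
rewrite (le_trans (ler_cabsD _ _))// cabsN.
rewrite (_ : e = e' + 2 * (e' * k) * (1 - 0)); last first.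
  by rewrite /e'; field; rewrite gt_eqF// addr_gt0// mulr_gt0.
rewrite lerD//; first exact: hp (ltW xr).
rewrite /cauchy_int -(cintB (cont_onM cf cK) (cont_onM cp cK)).
apply: (cint_bound ler01); first exact: (cont_onB (cont_onM cf cK) (cont_onM cp cK)).
move=> t _; rewrite -mulrBl cabsM ler_pM ?cabs_ge0 ?cabs_circle_kernel//.
by apply: hp; rewrite cabsM cabsR cabs_expi mulr1 gtr0_norm.
Qed.

Lemma analyticB D f g : analytic D f -> analytic D g ->
  analytic D (fun z => f z - g z).
Proof. by move=> fan gan z Dz; exact: (derivableB (fan z Dz) (gan z Dz)). Qed.

Lemma derive1_subE f g z : derivable f z 1 -> derivable g z 1 ->
  derive1 (fun z => f z - g z) z = derive1 f z - derive1 g z.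
Proof. by move=> df dg; rewrite !derive1E; exact: (deriveB df dg). Qed.

Lemma derive1_close f p r rho (e : R) w : analytic disc f -> 0 < r -> r < 1 ->
  (forall z, cabs z <= r -> cabs (f z - p.[z]) <= e) ->
  cabs w <= rho -> rho < r ->
  cabs (derive1 f w - (p^`()).[w]) <= 2 * (e * (r^-1 * (1 - rho / r)^-1 ^+ 2)).
Proof.
move=> fan r0 r1 fp wr rhor.
have Dw : disc w by apply/discP; exact: le_lt_trans wr (lt_trans rhor r1).
rewrite -derive1_horner -(derive1_subE (fan w Dw) (@analytic_horner p disc w Dw)).
apply: (derive1_bound (analyticB fan (@analytic_horner p disc)) r1 _ wr rhor) => z zr.
by apply: fp; rewrite zr.
Qed.

(** By the Cauchy estimate the derivatives of the approximating polynomials approximate the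
    derivative on a smaller disc. *)
Lemma analytic_derive1 f : analytic disc f -> analytic disc (derive1 f).
Proof.
move=> fan; apply: locally_poly_analytic => rho e /andP[rho0 rho1] e0.
pose r := (rho + 1) / 2.
have rhor : rho < r by rewrite /r midf_lt.
have r1 : r < 1 by rewrite /r midf_lt.
have r0 : 0 < r := lt_trans rho0 rhor.
pose k := 2 * (r^-1 * (1 - rho / r)^-1 ^+ 2).
have k0 : 0 < k.
  by rewrite !mulr_gt0 ?invr_gt0// ?exprn_gt0 ?invr_gt0// subr_gt0 ltr_pdivrMr// mul1r.
have [|p hp] := analytic_locally_poly fan (r := r) _ (divr_gt0 e0 k0).
  by rewrite r0.
exists (p^`()) => z zr.
rewrite (le_trans (derive1_close fan r0 r1 hp zr rhor))//.
by rewrite mulrCA -/k -mulrA mulVf ?mulr1// gt_eqF.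
Qed.

Lemma analytic_uniform_limit f :
  (forall e : R, 0 < e -> exists2 h, analytic disc h &
     forall z, disc z -> cabs (f z - h z) <= e) -> analytic disc f.
Proof.
move=> fh; apply: locally_poly_analytic => r e r01 e0.
have e2 : 0 < e / 2 by rewrite divr_gt0.
have [h han hf] := fh _ e2.
have [p hp] := analytic_locally_poly han r01 e2.
exists p => z zr; rewrite (splitr e) (le_trans (ler_cabs_dist _ _ (h z)))// lerD//.
  by apply: hf; apply/discP; case/andP: r01 => _; exact: le_lt_trans.
exact: hp.
Qed.

Lemma analyticM f g : analytic disc f -> analytic disc g ->
  analytic disc (fun z => f z * g z).
Proof. by move=> fan gan z Dz; apply: derivableM; [exact: fan|exact: gan]. Qed.

Lemma scale_disc z (t : R) : disc z -> 0 <= t <= 1 -> disc (t%:C * z).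
Proof.
move=> /discP z1 /andP[t0 t1]; apply/discP; rewrite cabsM cabsR ger0_norm//.
by rewrite (le_lt_trans _ z1)// ler_piMl ?cabs_ge0.
Qed.

Lemma cont_on_segment f z : analytic disc f -> disc z ->
  cont_on 0 1 (fun t => f (t%:C * z)).
Proof.
move=> fan Dz; apply: (@cont_on_comp _ _ _ (fun t => t%:C * z)).
  exact: (cont_onM cont_on_id (cont_on_cst z)).
by move=> t t01; apply: analytic_continuous => //; exact: scale_disc.
Qed.

Lemma segment_integralE f z : segment_integral f z = z * cint 0 1 (fun t => f (t%:C * z)).
Proof. by []. Qed.

Lemma eq_segment_integral f g z : {in disc, f =1 g} -> disc z ->
  segment_integral f z = segment_integral g z.
Proof.
move=> fg Dz; rewrite !segment_integralE; congr (_ * _); apply: eq_cint => t t01.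
by apply: fg; apply/mem_set; exact: scale_disc.
Qed.

Lemma segment_integralD f g z : analytic disc f -> analytic disc g -> disc z ->
  segment_integral (fun x => f x + g x) z = segment_integral f z + segment_integral g z.
Proof.
move=> fan gan Dz; rewrite !segment_integralE -mulrDr; congr (_ * _).
exact: (cintD (cont_on_segment fan Dz) (cont_on_segment gan Dz)).
Qed.

Lemma segment_integralZ (c : C) f z : analytic disc f -> disc z ->
  segment_integral (fun x => c * f x) z = c * segment_integral f z.
Proof.
move=> fan Dz; rewrite !segment_integralE mulrCA; congr (_ * _).
exact: (cintZ c (cont_on_segment fan Dz)).
Qed.

Lemma segment_integralB f g z : analytic disc f -> analytic disc g -> disc z ->
  segment_integral (fun x => f x - g x) z = segment_integral f z - segment_integral g z.
Proof.
move=> fan gan Dz; rewrite !segment_integralE -mulrBr; congr (_ * _).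
exact: (cintB (cont_on_segment fan Dz) (cont_on_segment gan Dz)).
Qed.

Lemma segment_integral_bound f z (M : R) : analytic disc f -> disc z ->
  (forall t : R, 0 <= t <= 1 -> cabs (f (t%:C * z)) <= M) ->
  cabs (segment_integral f z) <= 2 * M.
Proof.
move=> fan Dz fM; rewrite segment_integralE cabsM.
have M0 : 0 <= M by rewrite (le_trans _ (fM 0 _)) ?cabs_ge0// lexx ler01.
have h := cint_bound ler01 (cont_on_segment fan Dz) fM.
rewrite subr0 mulr1 in h; rewrite -[leRHS]mul1r ler_pM ?cabs_ge0//.
by apply/ltW/discP.
Qed.

Definition antideriv p : {poly C} := \sum_(k < size p) (p`_k / k.+1%:R) *: 'X^(k.+1).

Lemma segment_integral_horner p z : disc z ->
  segment_integral (horner p) z = (antideriv p).[z].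
Proof.
move=> Dz; rewrite segment_integralE /antideriv horner_sum.
pose F (k : 'I_(size p)) (t : R) := (p`_k * z ^+ k) * (t%:C) ^+ k.
have cX (k : nat) : cont_on 0 1 (fun t : R => t%:C ^+ k : C).
  exact: (cont_onX cont_on_id).
have cF k : cont_on 0 1 (F k) by exact: (cont_onM (cont_on_cst _) (cX k)).
rewrite (@eq_cint _ _ _ _ (fun t => \sum_(k <- index_enum 'I_(size p)) F k t)); last first.
  move=> t _; rewrite horner_coef; apply: eq_bigr => k _.
  by rewrite /F exprMn mulrA mulrAC.
rewrite (cint_sum _ cF) mulr_sumr; apply: eq_bigr => k _.
rewrite (cintZ _ (cX k)).
rewrite (@cint_FTC _ 0 1 (fun t => (k.+1%:R)^-1 * t%:C ^+ k.+1) _ ler01 (cX k)); last first.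
  move=> t _; apply: is_cderive_eq.
    exact: (is_cderiveZ _ (is_cderiveX k.+1 (is_cderive_id t))).
  by rewrite /= mulr1 mulrA mulVf ?mul1r// pnatr_eq0.
by rewrite !expr1n expr0n/= mulr0 subr0 mulr1 hornerZ hornerXn exprS; ring.
Qed.

Lemma deriv_antideriv p : (antideriv p)^`() = p.
Proof.
rewrite /antideriv linear_sum -[RHS]coefK poly_def; apply: eq_bigr => k _.
rewrite /= derivZ derivXn/= -scalerMnr scalerMnl -mulr_natr mulfVK//.
Qed.

Lemma segment_integral_close f p r (e : R) z : analytic disc f -> r < 1 ->
  (forall z, cabs z <= r -> cabs (f z - p.[z]) <= e) -> cabs z <= r ->
  cabs (segment_integral f z - (antideriv p).[z]) <= 2 * e.
Proof.
move=> fan r1 hp zr; have Dz : disc z by apply/discP; exact: le_lt_trans r1.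
rewrite -(segment_integral_horner p Dz) -(segment_integralB fan (@analytic_horner p disc) Dz).
apply: (segment_integral_bound (analyticB fan (@analytic_horner p disc)) Dz) => t.
move=> /andP[t0 t1].
apply: hp; rewrite cabsM cabsR ger0_norm// (le_trans _ zr)//.
by rewrite ler_piMl ?cabs_ge0.
Qed.

Lemma analytic_segment_integral f : analytic disc f ->
  analytic disc (segment_integral f).
Proof.
move=> fan; apply: locally_poly_analytic => r e /[dup] r01 /andP[r0 r1] e0.
have e2 : 0 < e / 2 by rewrite divr_gt0.
have [p hp] := analytic_locally_poly fan r01 e2.
exists (antideriv p) => z zr.
rewrite (le_trans (segment_integral_close fan r1 hp zr))//.
by rewrite mulrCA divff ?mulr1// pnatr_eq0.
Qed.

(** For polynomials this is [deriv_antideriv]. An approximation of [f] by p approximates the segment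
    integral by [antideriv p], hence its derivative by p, so both sides are close to p(z). *)
Lemma derive1_segment_integral f z : analytic disc f -> disc z ->
  derive1 (segment_integral f) z = f z.
Proof.
move=> fan Dz; have [r0 r1 zr] := mid_disc Dz; set r := _ / 2 in r0 r1 zr.
apply/eqP; rewrite -subr_eq0; apply/eqP/cabs_eq0P => e e0.
have kr := kernel_ratio zr.
pose k := 1 + 4 * (r^-1 * (1 - cabs z / r)^-1 ^+ 2).
have k0 : 0 < k.
  by rewrite addr_gt0// !mulr_gt0 ?invr_gt0 ?exprn_gt0 ?invr_gt0.
have [|p hp] := analytic_locally_poly fan (r := r) _ (divr_gt0 e0 k0).
  by rewrite r0.
have hP (x : C) : cabs x <= r -> _ := fun xr => segment_integral_close fan r1 hp xr.
have := derive1_close (analytic_segment_integral fan) r0 r1 hP (lexx _) zr.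
rewrite deriv_antideriv => h.
rewrite (le_trans (ler_cabs_dist _ _ p.[z]))//.
rewrite (le_trans (lerD h (_ : _ <= e / k)))//; first by rewrite cabsB hp// ltW.
rewrite le_eqVlt; apply/orP; left; apply/eqP.
rewrite (_ : _ + _ = e / k * k); last by rewrite /k; ring.
by rewrite mulfVK// gt_eqF.
Qed.

End analytic_toolkit.

(** * Mean value estimate and polynomial approximation inside the unit ball *)

Section mean_value.
Context {R : realType}.
Local Notation C := R[i].
Implicit Types (w x y z : C) (r : R) (f g : C -> C) (p : {poly C}).

Lemma is_derive_little_o (f : R -> R) (t d : R) :
  (forall e : R, 0 < e -> exists2 r : R, 0 < r & forall h, `|h| < r ->
    `|f (t + h) - f t - h * d| <= e * `|h|) -> is_derive t (1 : R) f d.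
Proof.
move=> fd.
have cv : h^-1 *: (f (h + t) - f t) @[h --> 0^'] --> d.
  apply/cvgrPdist_le => e e0; have [r r0 hr] := fd e e0.
  near=> h.
  have h0 : h != 0 by near: h; exact: nbhs_dnbhs_neq.
  have hp : 0 < `|h| by rewrite normr_gt0.
  rewrite distrC -[_ *: _]/(h^-1 * _) (_ : _ - d = h^-1 * (f (t + h) - f t - h * d)).
    rewrite normrM normfV mulrC ler_pdivrMr//; apply: hr.
    near: h; rewrite near_simpl; apply: dnbhs0_lt => //.
  by rewrite [t + h]addrC [RHS]mulrBr mulrA mulVf// mul1r.
have dE : (fun h : R => h^-1 *: ((f \o shift t) (h *: (1 : R)) - f t)) =
    (fun h => h^-1 *: (f (h + t) - f t)).
  by apply/funext => h /=; rewrite [h%:A](mulr1).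
apply: DeriveDef; first by rewrite /derivable dE; apply/cvg_ex; exists d.
by rewrite /derive dE; exact: (cvg_lim _ cv).
Unshelve. all: by end_near. Qed.

(** Chain rule between two scalar fields: [f] is differentiable over [R[i]] and the line is
    parametrized by [R], hence the return to first-order expansions. *)
Lemma is_cderive_line f x v t : derivable f (x + t%:C * v) 1 ->
  is_cderive (fun t => f (x + t%:C * v)) (derive1 f (x + t%:C * v) * v) t.
Proof.
set z := x + _ => fz.
have H (e : R) : 0 < e -> exists2 r : R, 0 < r & forall h : R, `|h| < r ->
    cabs (f (x + (t + h)%:C * v) - f z - h%:C * (derive1 f z * v)) <= e * `|h|.
  move=> e0; have v1 : 0 < 1 + cabs v by rewrite ltr_pwDl ?cabs_ge0.
  have [r r0 hr] := derivable_little_o fz (divr_gt0 e0 v1).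
  exists (r / (1 + cabs v)); first by rewrite divr_gt0.
  move=> h; rewrite ltr_pdivlMr// => hlt.
  have zE : x + (t + h)%:C * v - z = h%:C * v by rewrite /z rmorphD/=; ring.
  have cz : cabs (x + (t + h)%:C * v - z) <= `|h| * (1 + cabs v).
    by rewrite zE cabsM cabsR ler_wpM2l// lerDr.
  have := hr _ (le_lt_trans cz hlt).
  rewrite zE [h%:C * v * _]mulrAC -mulrA => /le_trans; apply.
  rewrite -zE (le_trans (ler_wpM2l _ cz))//; first by rewrite divr_ge0 ?ltW.
  by rewrite mulrCA divfK ?gt_eqF// mulrC.
have ReE (u v' : C) (h : R) : complex.Re u - complex.Re v' - h * complex.Re (derive1 f z * v) =
    complex.Re (u - v' - h%:C * (derive1 f z * v)).
  by case: u v' (derive1 f z * v) => a b [c d] [a' b'] /=; ring.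
have ImE (u v' : C) (h : R) : complex.Im u - complex.Im v' - h * complex.Im (derive1 f z * v) =
    complex.Im (u - v' - h%:C * (derive1 f z * v)).
  by case: u v' (derive1 f z * v) => a b [c d] [a' b'] /=; ring.
split; apply: is_derive_little_o => e /H[r r0 hr]; exists r => // h /hr.
  by rewrite ReE; exact: le_trans (cabs_Re _).
by rewrite ImE; exact: le_trans (cabs_Im _).
Qed.

Lemma disc_convex x y (t : R) r : 0 <= t <= 1 -> cabs x <= r -> cabs y <= r ->
  cabs (x + t%:C * (y - x)) <= r.
Proof.
move=> /andP[t0 t1] xr yr.
rewrite (_ : _ + _ = (1 - t)%:C * x + t%:C * y); last by rewrite rmorphB rmorph1; ring.
rewrite (le_trans (ler_cabsD _ _))// !cabsM !cabsR !ger0_norm ?subr_ge0//.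
rewrite (le_trans (lerD (ler_wpM2l _ xr) (ler_wpM2l _ yr))) ?subr_ge0//.
by rewrite -mulrDl subrK mul1r.
Qed.

(** The derivative is bounded at points of the disc only, so that r = 1 is allowed; the segment from
    [x] to [y] stays in a disc of radius below 1. *)
Lemma mean_value_bound f (L r : R) x y : analytic disc f ->
  (forall z, cabs z <= r -> disc z -> cabs (derive1 f z) <= L) ->
  disc x -> disc y -> cabs x <= r -> cabs y <= r ->
  cabs (f y - f x) <= 2 * L * cabs (y - x).
Proof.
move=> fan fL /discP x1 /discP y1 xr yr.
have L0 : 0 <= L by rewrite (le_trans _ (fL x _ _)) ?cabs_ge0//; apply/discP.
have [m [xm ym m1]] : exists m : R, [/\ cabs x <= m, cabs y <= m & m < 1].
  exists (Num.max (cabs x) (cabs y)).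
  by rewrite !le_max !lexx orbT gt_max x1 y1.
have Dt (t : R) : 0 <= t <= 1 -> disc (x + t%:C * (y - x)).
  by move=> t01; apply/discP; rewrite (le_lt_trans _ m1)//; exact: disc_convex.
have cont : cont_on 0 1 (fun t => derive1 f (x + t%:C * (y - x)) * (y - x)).
  apply: (cont_onM _ (cont_on_cst _)).
  apply: (@cont_on_comp _ _ _ (fun t => x + t%:C * (y - x))).
    exact: (cont_onD (cont_on_cst x) (cont_onM cont_on_id (cont_on_cst _))).
  by move=> t t01; apply: analytic_continuous; [exact: analytic_derive1|exact: Dt].
have ftc := @cint_FTC _ 0 1 (fun t => f (x + t%:C * (y - x))) _ ler01 cont
  (fun t t01 => @is_cderive_line f x (y - x) t (fan _ (Dt t t01))).
rewrite mul0r addr0 mul1r [x + _]addrC subrK in ftc; rewrite -ftc.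
rewrite -mulrA -[leRHS]mulr1 -[X in _ * X](subr0 (1 : R)).
apply: (cint_bound ler01 cont) => t t01.
rewrite cabsM ler_wpM2r ?cabs_ge0//; apply: fL; last exact: Dt.
exact: disc_convex.
Qed.

Lemma horner_bound p z : cabs z <= 1 -> cabs p.[z] <= \sum_(k < size p) cabs p`_k.
Proof.
move=> z1; rewrite horner_coef (le_trans (cabs_sum _ _ _))//; apply: ler_sum => k _.
by rewrite cabsM cabsX ler_piMr ?cabs_ge0// exprn_ile1 ?cabs_ge0.
Qed.

Lemma analytic_locally_bounded f r : analytic disc f -> r < 1 ->
  exists2 L : R, 0 < L & forall z, cabs z <= r -> cabs (f z) <= L.
Proof.
move=> fan r1; pose s := Num.max r (1 / 2).
have s01 : 0 < s < 1.
  by rewrite lt_max divr_gt0 ?orbT// gt_max r1/= ltr_pdivrMr// mul1r ltr1n.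
have [p hp] := analytic_locally_poly fan s01 ltr01.
exists (1 + \sum_(k < size p) cabs p`_k).
  by rewrite ltr_pwDl// sumr_ge0// => k _; exact: cabs_ge0.
move=> z zr; have zs : cabs z <= s by rewrite le_max zr.
rewrite -(subrK p.[z] (f z)) (le_trans (ler_cabsD _ _))// lerD ?hp//.
by apply: horner_bound; rewrite (le_trans zs)// ltW//; case/andP: s01.
Qed.

Definition unit_ball p := forall z, cabs z <= 1 -> cabs p.[z] <= 1.

(** The dilation f(s z) is approximated by a polynomial on the closed disc, and the result is
    divided by 1 + e' to bring it back into the unit ball. *)
Lemma poly_approx f r (e : R) : analytic disc f ->
  (forall z, disc z -> cabs (f z) <= 1) -> 0 < r < 1 -> 0 < e ->
  exists2 p, unit_ball p & forall z, cabs z <= r -> cabs (f z - p.[z]) <= e.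
Proof.
move=> fan f1 /andP[r0 r1] e0.
have [K K0 hK] := analytic_locally_bounded (analytic_derive1 fan) r1.
(* u <= 1 / 2 keeps the dilation factor s = 1 - u positive, and 2 K u <= e / 2 bounds |f(z) - f(s
   z)|. *)
pose u := Num.min (1 / 2) (e / (4 * K)).
have u0 : 0 < u by rewrite lt_min !divr_gt0// mulr_gt0.
have u1 : u <= 1 / 2 by rewrite ge_min lexx.
have u1' : u < 1 by rewrite (le_lt_trans u1)// ltr_pdivrMr// mul1r ltr1n.
have uK : 2 * K * u <= e / 2.
  rewrite -ler_pdivlMl ?mulr_gt0// (_ : _ * (e / 2) = e / (4 * K)).
    by rewrite ge_min lexx orbT.
  by field; rewrite gt_eqF.
pose s := 1 - u.
have s0 : 0 < s by rewrite subr_gt0.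
have s1 : s < 1 by rewrite gtrBl.
have e4 : 0 < e / 4 by rewrite divr_gt0.
have [p hp] := analytic_locally_poly fan (introT andP (conj s0 s1)) e4.
set e' := e / 4 in e4 hp.
have e1 : 0 < 1 + e' by rewrite addr_gt0.
pose q := ((1 + e')^-1)%:C *: (p \Po (s%:C *: 'X)).
have qE z : q.[z] = ((1 + e')^-1)%:C * p.[s%:C * z].
  by rewrite /q hornerZ horner_comp hornerZ hornerX.
have sz z : cabs z <= 1 -> cabs (s%:C * z) <= s.
  by move=> z1; rewrite cabsM cabsR gtr0_norm// ler_piMr// ltW.
have pb z : cabs z <= 1 -> cabs p.[s%:C * z] <= 1 + e'.
  move=> z1; have zs := sz z z1.
  rewrite -(subrK (f (s%:C * z)) p.[_]) (le_trans (ler_cabsD _ _))//.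
  rewrite addrC lerD//; last by rewrite cabsB hp.
  by apply: f1; apply/discP; exact: le_lt_trans s1.
exists q => z zr.
  by rewrite qE cabsM cabsR gtr0_norm ?invr_gt0// ler_pdivrMl// mulr1 pb.
have z1 : cabs z <= 1 := le_trans zr (ltW r1).
have Dz : disc z by apply/discP; exact: le_lt_trans r1.
have szr : cabs (s%:C * z) <= r.
  by rewrite cabsM cabsR gtr0_norm// (le_trans _ zr)// ler_piMl ?cabs_ge0// ltW.
have Dsz : disc (s%:C * z) by apply/discP; exact: le_lt_trans r1.
have m := mean_value_bound fan (fun x xr _ => hK x xr) Dsz Dz szr zr.
have m' : cabs (f z - f (s%:C * z)) <= e / 2.
  apply: le_trans m _; apply: le_trans uK; rewrite ler_wpM2l ?mulr_ge0 ?(ltW K0)//.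
  rewrite (_ : z - _ = u%:C * z); last by rewrite /s rmorphB rmorph1; ring.
  by rewrite cabsM cabsR gtr0_norm// ler_piMr// ltW.
rewrite (_ : f z - q.[z] = (f z - f (s%:C * z)) + (f (s%:C * z) - p.[s%:C * z])
   + (e' / (1 + e'))%:C * p.[s%:C * z]); last first.
  have -> : e' / (1 + e') = 1 - (1 + e')^-1 by field; rewrite gt_eqF.
  by rewrite qE rmorphB rmorph1; ring.
rewrite (_ : e = e / 2 + e' + e'); last by rewrite /e'; field.
rewrite (le_trans (ler_cabsD _ _))// lerD//.
  by rewrite (le_trans (ler_cabsD _ _))// lerD// hp// sz.
rewrite cabsM cabsR gtr0_norm ?divr_gt0// mulrAC ler_pdivrMr// ler_wpM2l ?pb//.
exact: ltW.
Qed.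

End mean_value.

(** * Equicontinuity of T_g on polynomials *)

Section equicontinuity.
Context {R : realType}.
Local Notation C := R[i].
Implicit Types (w x y z xi : C) (r : R) (f : C -> C) (p q : {poly C}).
Variable g : C -> C.
Hypothesis gan : analytic disc g.

Let gan' : analytic disc (derive1 g) := analytic_derive1 gan.

Lemma analytic_Tg_arg f : analytic disc f -> analytic disc (fun z => f z * derive1 g z).
Proof. by move=> fan; exact: analyticM. Qed.

Lemma analytic_Tg f : analytic disc f -> analytic disc (Tg g f).
Proof. by move=> fan; apply: analytic_segment_integral; exact: analytic_Tg_arg. Qed.

Lemma derive1_Tg f z : analytic disc f -> disc z ->
  derive1 (Tg g f) z = f z * derive1 g z.
Proof.
by move=> fan Dz; exact: (derive1_segment_integral (analytic_Tg_arg fan) Dz).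
Qed.

Lemma eq_Tg f1 f2 z : {in disc, f1 =1 f2} -> disc z -> Tg g f1 z = Tg g f2 z.
Proof.
by move=> f12 Dz; apply: eq_segment_integral => // x Dx; rewrite f12.
Qed.

Lemma TgD f1 f2 z : analytic disc f1 -> analytic disc f2 -> disc z ->
  Tg g (fun x => f1 x + f2 x) z = Tg g f1 z + Tg g f2 z.
Proof.
move=> an1 an2 Dz.
rewrite -(segment_integralD (analytic_Tg_arg an1) (analytic_Tg_arg an2) Dz).
by apply: eq_segment_integral => // x _; rewrite mulrDl.
Qed.

Lemma TgZ (c : C) f z : analytic disc f -> disc z ->
  Tg g (fun x => c * f x) z = c * Tg g f z.
Proof.
move=> fan Dz; rewrite -(segment_integralZ c (analytic_Tg_arg fan) Dz).
by apply: eq_segment_integral => // x _; rewrite mulrA.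
Qed.

Definition Tp p z := Tg g (horner p) z.

Lemma TpD p q z : disc z -> Tp (p + q) z = Tp p z + Tp q z.
Proof.
move=> Dz; rewrite -(TgD (@analytic_horner _ p disc) (@analytic_horner _ q disc) Dz).
by apply: eq_Tg => // x _; rewrite hornerD.
Qed.

Lemma TpZ (c : C) p z : disc z -> Tp (c *: p) z = c * Tp p z.
Proof.
move=> Dz; rewrite -(TgZ c (@analytic_horner _ p disc) Dz).
by apply: eq_Tg => // x _; rewrite hornerZ.
Qed.

Lemma analytic_Tp p : analytic disc (Tp p).
Proof. exact: (analytic_Tg (@analytic_horner _ p disc)). Qed.

Lemma derive1_Tp p z : disc z -> derive1 (Tp p) z = p.[z] * derive1 g z.
Proof. exact: (derive1_Tg (@analytic_horner _ p disc)). Qed.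

Definition Tp_bounded := exists2 M : R, 0 < M &
  forall p, unit_ball p -> forall z, disc z -> cabs (Tp p z) <= M.

Lemma conjc_unit xi : cabs xi = 1 -> conjc xi * xi = 1.
Proof.
case: xi => a b; rewrite /cabs normc_def/= => h.
have ab : a ^+ 2 + b ^+ 2 = 1.
  by rewrite -[LHS]sqr_sqrtr ?addr_ge0 ?sqr_ge0// h expr1n.
by apply/eqP; rewrite eq_complex/=; apply/andP; split; apply/eqP; [rewrite -ab|]; ring.
Qed.

Definition peak xi n : {poly C} := ((1 / 2) *: (1 + conjc xi *: 'X)) ^+ n.

Definition Tp_peak := forall xi, cabs xi = 1 -> forall e : R, 0 < e ->
  exists n, forall p, unit_ball p -> forall z, disc z ->
    cabs (Tp (p * peak xi n) z) <= e.

Definition Tp_equicontinuous := forall xi, cabs xi <= 1 -> forall e : R, 0 < e ->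
  exists2 d : R, 0 < d & forall p, unit_ball p -> forall z z', disc z -> disc z' ->
    cabs (z - xi) < d -> cabs (z' - xi) < d -> cabs (Tp p z - Tp p z') <= e.

Lemma peakE xi n z : (peak xi n).[z] = ((1 + conjc xi * z) / 2) ^+ n.
Proof.
rewrite /peak horner_exp hornerZ hornerD hornerZ hornerX hornerC.
by rewrite mul1r mulrC.
Qed.

Lemma half_bound xi z (r : R) : cabs xi <= 1 -> cabs z <= r ->
  cabs ((1 + conjc xi * z) / 2) <= (1 + r) / 2.
Proof.
move=> xi1 zr; have r0 := le_trans (cabs_ge0 z) zr.
have -> : (2 : C) = 2%:C by rewrite rmorph_nat.
rewrite cabs_div cabsR ger0_norm// ler_pM2r ?invr_gt0//.
rewrite (le_trans (ler_cabsD _ _))// cabs1 lerD2l cabsM cabs_conj.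
by rewrite (le_trans _ zr)// ler_piMl ?cabs_ge0.
Qed.

Lemma peak_bound xi n z (r : R) : cabs xi <= 1 -> cabs z <= r ->
  cabs (peak xi n).[z] <= ((1 + r) / 2) ^+ n.
Proof.
move=> xi1 zr; have r0 := le_trans (cabs_ge0 z) zr.
rewrite peakE cabsX lerXn2r ?nnegrE ?cabs_ge0//; last exact: half_bound.
by rewrite divr_ge0// addr_ge0.
Qed.

Lemma peak_ball xi n : cabs xi <= 1 -> unit_ball (peak xi n).
Proof.
move=> xi1 z z1; rewrite (le_trans (peak_bound n xi1 z1))//.
by rewrite (_ : (1 + 1) / 2 = 1 :> R) ?expr1n// -mulr2n divff// pnatr_eq0.
Qed.

Lemma unit_ballM p q : unit_ball p -> unit_ball q -> unit_ball (p * q).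
Proof.
move=> pb qb z z1; rewrite hornerM cabsM -[leRHS]mulr1.
by rewrite ler_pM ?cabs_ge0 ?pb ?qb.
Qed.

Lemma deriv_peak xi n z : cabs xi <= 1 -> cabs z <= 1 ->
  cabs ((peak xi n)^`()).[z] <= n%:R.
Proof.
move=> xi1 z1; rewrite /peak deriv_exp -/(peak xi n.-1).
rewrite derivZ derivD derivZ derivX derivC add0r.
rewrite hornerMn hornerM !hornerZ hornerC mulr1 -mulr_natl.
rewrite cabsM -(rmorph_nat (@real_complex R)) cabsR ger0_norm// ler_piMr//.
rewrite cabsM -[leRHS]mulr1 ler_pM ?cabs_ge0//; last exact: (peak_ball n.-1 xi1).
rewrite cabsM cabs_conj.
have -> : (1 / 2 : C) = (1 / 2)%:C by rewrite rmorphM fmorphV rmorph1 rmorph_nat.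
rewrite cabsR ger0_norm ?divr_ge0// -[leRHS]mulr1 ler_pM ?cabs_ge0 ?divr_ge0//.
by rewrite ler_pdivrMr// mul1r ler1n.
Qed.

(** In 1 - s^n = (1 - s) (1 + ... + s^(n-1)) the first factor vanishes at [xi] because conj xi * xi
    = 1, and the second has n terms of modulus at most 1. *)
Lemma peak_lipschitz xi n z : cabs xi = 1 -> cabs z <= 1 ->
  cabs (1 - peak xi n).[z] <= n%:R * cabs (z - xi).
Proof.
move=> xi1 z1; rewrite hornerD hornerC hornerN peakE; set s := _ / 2.
have -> : 1 - s ^+ n = (1 - s) * \sum_(k < n) s ^+ k.
  by rewrite -[LHS]opprB subrX1 -mulNr opprB.
have s1 : cabs s <= 1.
  have xi1' : cabs xi <= 1 by rewrite xi1.
  rewrite (le_trans (half_bound xi1' z1))//.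
  by rewrite -mulr2n divff ?pnatr_eq0.
have xx := conjc_unit xi1.
have sE : cabs (1 - s) <= cabs (z - xi).
  have -> : 1 - s = (1 / 2)%:C * (conjc xi * (xi - z)).
    have -> : (1 / 2)%:C = 1 / 2 :> C by rewrite rmorphM fmorphV rmorph1 rmorph_nat.
    by rewrite mulrBr xx /s; field.
  rewrite !cabsM cabsR cabs_conj xi1 !mul1r cabsB ger0_norm ?invr_ge0//.
  by rewrite ler_piMl ?cabs_ge0// invf_le1// ler1n.
rewrite cabsM mulrC ler_pM ?cabs_ge0// (le_trans (cabs_sum _ _ _))//.
rewrite (le_trans (y := \sum_(k < n) (1 : R)))//.
  by apply: ler_sum => k _; rewrite cabsX exprn_ile1 ?cabs_ge0.
by rewrite sumr_const card_ord.
Qed.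

(** Around an interior point g' is bounded, so the functions T_g p are Lipschitz there with a common
    constant. *)
Lemma interior_equicontinuous xi (e : R) : cabs xi < 1 -> 0 < e ->
  exists2 d : R, 0 < d & forall p, unit_ball p -> forall z z', disc z -> disc z' ->
    cabs (z - xi) < d -> cabs (z' - xi) < d -> cabs (Tp p z - Tp p z') <= e.
Proof.
move=> xi1 e0; pose r := (cabs xi + 1) / 2.
have xr : cabs xi < r by rewrite /r midf_lt.
have r1 : r < 1 by rewrite /r midf_lt.
have [L L0 hL] := analytic_locally_bounded gan' r1.
exists (Num.min (r - cabs xi) (e / (4 * L))).
  by rewrite lt_min subr_gt0 xr divr_gt0// mulr_gt0.
move=> p pb z z' Dz Dz'; rewrite !lt_min => /andP[z1 z2] /andP[z1' z2'].
have br x : cabs (x - xi) < r - cabs xi -> cabs x <= r.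
  by move=> h; rewrite -(subrK xi x) (le_trans (ler_cabsD _ _))// -lerBrDr ltW.
have dT x : cabs x <= r -> disc x -> cabs (derive1 (Tp p) x) <= L.
  move=> hx Dx; rewrite derive1_Tp// cabsM -[leRHS]mul1r ler_pM ?cabs_ge0 ?hL//.
  by apply: pb; exact: le_trans (ltW r1).
rewrite (le_trans (mean_value_bound (@analytic_Tp p) dT Dz' Dz (br _ z1') (br _ z1)))//.
have zz : cabs (z - z') <= e / (4 * L) + e / (4 * L).
  by rewrite (le_trans (ler_cabs_dist _ _ xi))// lerD ?ltW// cabsB.
rewrite (le_trans (ler_wpM2l _ zz)) ?mulr_ge0 ?(ltW L0)//.
by rewrite le_eqVlt; apply/orP; left; apply/eqP; field; rewrite gt_eqF.
Qed.

(* Integration by parts: Phi = T_g (p q) - (T_g p) q has derivative - (T_g p) q',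
   which is bounded even where g' is not. *)
Lemma boundary_equicontinuous xi (e : R) : Tp_bounded -> Tp_peak ->
  cabs xi = 1 -> 0 < e ->
  exists2 d : R, 0 < d & forall p, unit_ball p -> forall z z', disc z -> disc z' ->
    cabs (z - xi) < d -> cabs (z' - xi) < d -> cabs (Tp p z - Tp p z') <= e.
Proof.
move=> [M M0 hM] hN xi1 e0.
have e4 : 0 < e / 4 by rewrite divr_gt0.
(* [K] is n + 1 because n may be 0 and [K] is divided by. *)
have [n hn] := hN xi xi1 _ e4; pose K : R := n.+1%:R.
have K0 : 0 < K by rewrite ltr0Sn.
have nK : n%:R <= K by rewrite ler_nat.
(* The errors sum to e / 4 + e / 4 + 6 M K d, and 6 M K d = e / 2. *)
exists (e / (12 * (M * K))); first by rewrite divr_gt0// !mulr_gt0.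
set d := e / _ => p pb z z' Dz Dz' zd zd'.
pose q := 1 - peak xi n.
have pE : p = p * peak xi n + p * q by rewrite /q -mulrDr addrCA subrr addr0 mulr1.
pose Phi x := Tp (p * q) x - Tp p x * q.[x].
have hq := @analytic_horner _ q disc.
have Pan : analytic disc Phi.
  exact: (analyticB (@analytic_Tp (p * q)) (analyticM (@analytic_Tp p) hq)).
have Dcl x : disc x -> cabs x <= 1 by move=> /discP/ltW.
have dPhi x : cabs x <= 1 -> disc x -> cabs (derive1 Phi x) <= M * K.
  move=> x1 Dx.
  rewrite (derive1_subE (@analytic_Tp (p * q) x Dx) (analyticM (@analytic_Tp p) hq Dx)).
  rewrite derive1_Tp// hornerM.
  have -> : derive1 (fun z => Tp p z * q.[z]) x =
      Tp p x * (q^`()).[x] + q.[x] * (p.[x] * derive1 g x).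
    have dT : derivable (Tp p) x 1 by exact: analytic_Tp.
    have dq : derivable (horner q) x 1 by exact: (@analytic_horner _ q disc).
    rewrite derive1E; transitivity ('D_1 (Tp p * horner q) x) => //.
    rewrite (deriveM dT dq) -!derive1E derive1_horner derive1_Tp//.
  rewrite (_ : _ - _ = - (Tp p x * (q^`()).[x])); last by ring.
  rewrite cabsN cabsM ler_pM ?cabs_ge0 ?hM// /q derivB -[1]/(1%:P) derivC sub0r hornerN.
  by rewrite cabsN (le_trans (deriv_peak n _ x1))// xi1.
have d0 : 0 < d by rewrite divr_gt0// !mulr_gt0.
have MKd : M * K * d = e / 12.
  by rewrite /d; field; rewrite !gt_eqF.
have zz : cabs (z - z') <= d + d.
  by rewrite (le_trans (ler_cabs_dist _ _ xi))// lerD ?ltW// cabsB.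
have P1 : cabs (Phi z - Phi z') <= 4 * (M * K * d).
  rewrite (le_trans (mean_value_bound Pan dPhi Dz' Dz (Dcl _ Dz') (Dcl _ Dz)))//.
  rewrite (le_trans (ler_wpM2l _ zz)) ?mulr_ge0 ?(ltW M0) ?(ltW K0)//.
  by rewrite le_eqVlt; apply/orP; left; apply/eqP; ring.
have P2 x : disc x -> cabs (x - xi) < d -> cabs (Tp p x * q.[x]) <= M * K * d.
  move=> Dx xd; rewrite cabsM -mulrA ler_pM ?cabs_ge0 ?hM//.
  rewrite (le_trans (peak_lipschitz n xi1 (Dcl _ Dx)))//.
  by rewrite ler_pM ?cabs_ge0 ?ler0n// ltW.
have Px : unit_ball (p * peak xi n).
  by apply: unit_ballM => //; apply: peak_ball; rewrite xi1.
have -> : Tp p z - Tp p z' = Tp (p * peak xi n) z - Tp (p * peak xi n) z' +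
    (Phi z - Phi z') + Tp p z * q.[z] - Tp p z' * q.[z'].
  have alg (a b c c' u v : C) : a + c - (b + c') = a - b + ((c - u) - (c' - v)) + u - v.
    by ring.
  rewrite [X in Tp X z - _]pE [X in _ - Tp X z']pE (TpD _ _ Dz) (TpD _ _ Dz').
  exact: alg.
apply: le_trans (ler_cabsD _ _) _; rewrite cabsN.
apply: (@le_trans _ _ (e / 4 + e / 4 + 4 * (M * K * d) + M * K * d + M * K * d)).
  apply: lerD; last exact: (P2 _ Dz' zd').
  apply: le_trans (ler_cabsD _ _) _; apply: lerD; last exact: (P2 _ Dz zd).
  apply: le_trans (ler_cabsD _ _) _; apply: lerD; last exact: P1.
  apply: le_trans (ler_cabsD _ _) _; rewrite cabsN.
  by apply: lerD; [exact: (hn _ pb _ Dz)|exact: (hn _ pb _ Dz')].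
by rewrite MKd; lra.
Qed.

Lemma Tp_bounded_peak_equicontinuous : Tp_bounded -> Tp_peak -> Tp_equicontinuous.
Proof.
move=> hB hN xi; rewrite le_eqVlt => /predU1P[xi1|xi1] e e0.
  exact: boundary_equicontinuous.
exact: interior_equicontinuous.
Qed.

(** For |z| <= r the segment from 0 to z lies where g' is bounded and where [poly_approx]
    applies. *)
Lemma Tp_approx f r (e : R) : analytic disc f ->
  (forall z, disc z -> cabs (f z) <= 1) -> 0 < r < 1 -> 0 < e ->
  exists2 p, unit_ball p & forall z, cabs z <= r -> cabs (Tg g f z - Tp p z) <= e.
Proof.
move=> fan f1 /[dup] r01 /andP[r0 r1] e0.
have [L L0 hL] := analytic_locally_bounded gan' r1.
have e2 : 0 < e / (2 * L) by rewrite divr_gt0// mulr_gt0.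
have [p pb hp] := poly_approx fan f1 r01 e2.
exists p => // z zr; have Dz : disc z by apply/discP; exact: le_lt_trans r1.
have pan := @analytic_horner _ p disc.
rewrite /Tp /Tg -(segment_integralB (analytic_Tg_arg fan) (analytic_Tg_arg pan) Dz).
have h : cabs (segment_integral (fun x => f x * derive1 g x - p.[x] * derive1 g x) z)
    <= 2 * (e / (2 * L) * L).
  apply: (segment_integral_bound (analyticB (analytic_Tg_arg fan) (analytic_Tg_arg pan)) Dz).
  move=> t /andP[t0 t1].
  have tzr : cabs (t%:C * z) <= r.
    by rewrite cabsM cabsR ger0_norm// (le_trans _ zr)// ler_piMl ?cabs_ge0.
  by rewrite -mulrBl cabsM ler_pM ?cabs_ge0//; [exact: hp|exact: hL].
rewrite (le_trans h)// le_eqVlt; apply/orP; left; apply/eqP; field.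
by rewrite gt_eqF.
Qed.

(** The radius [d] found for polynomials works for the whole unit ball of H^inf: once z and z' are
    given, [f] is replaced by a polynomial on a disc containing both. *)
Lemma Tg_equicontinuous : Tp_equicontinuous -> forall xi, cabs xi <= 1 ->
  forall e : R, 0 < e -> exists2 d : R, 0 < d & forall f, analytic disc f ->
    (forall z, disc z -> cabs (f z) <= 1) -> forall z z', disc z -> disc z' ->
    cabs (z - xi) < d -> cabs (z' - xi) < d -> cabs (Tg g f z - Tg g f z') <= e.
Proof.
move=> hU xi xi1 e e0; have [d d0 hd] := hU xi xi1 e e0.
exists d => // f fan f1 z z' Dz Dz' zd zd'; apply/ler_addgt0Pr => h h0.
pose r := (Num.max (cabs z) (cabs z') + 1) / 2.
have m1 : Num.max (cabs z) (cabs z') < 1 by rewrite gt_max; apply/andP; split; apply/discP.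
have mr : Num.max (cabs z) (cabs z') < r by rewrite /r midf_lt.
have r1 : r < 1 by rewrite /r midf_lt.
have zr : cabs z <= r by rewrite (le_trans _ (ltW mr))// le_max lexx.
have zr' : cabs z' <= r by rewrite (le_trans _ (ltW mr))// le_max lexx orbT.
have r0 : 0 < r by rewrite (le_lt_trans _ mr)// le_max cabs_ge0.
have h2 : 0 < h / 2 by rewrite divr_gt0.
have [p pb hp] := Tp_approx fan f1 (introT andP (conj r0 r1)) h2.
have alg (a b c c' : C) : a - b = (a - c) + (c - c') - (b - c') by ring.
rewrite (alg _ _ (Tp p z) (Tp p z')); apply: le_trans (ler_cabsD _ _) _.
rewrite cabsN (_ : e + h = h / 2 + e + h / 2); last by field.
apply: lerD; last exact: hp.
apply: le_trans (ler_cabsD _ _) _; apply: lerD; first exact: hp.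
exact: (hd _ pb _ _ Dz Dz' zd zd').
Qed.

End equicontinuity.

(** * Norms with values in the real field *)

Section real_norm.
Context {R : realType} {V : normedModType R[i]}.
Implicit Types (v w : V).

Definition rnorm v : R := complex.Re `|v|.

Lemma rnormE v : `|v| = (rnorm v)%:C.
Proof. by rewrite RRe_real// ger0_real. Qed.

Lemma rnorm_ge0 v : 0 <= rnorm v.
Proof. by rewrite -lecR -rnormE normr_ge0. Qed.

Lemma ler_rnormD v w : rnorm (v + w) <= rnorm v + rnorm w.
Proof. by rewrite -lecR rmorphD/= -!rnormE ler_normD. Qed.

Lemma rnormN v : rnorm (- v) = rnorm v.
Proof. by rewrite /rnorm normrN. Qed.

Lemma rnormB v w : rnorm (v - w) = rnorm (w - v).
Proof. by rewrite /rnorm distrC. Qed.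

Lemma nbhs_rnormP v (A : set V) :
  nbhs v A <-> exists2 d : R, 0 < d & forall w, rnorm (w - v) < d -> A w.
Proof.
split=> [/nbhs_ballP[[a b]/= + vA]|[d d0 vA]].
  rewrite ltcE/= => /andP[/eqP b0 a0]; rewrite b0 in vA.
  exists a => // w wv; apply: vA; rewrite -ball_normE/= distrC rnormE.
  by rewrite -[_ +i* _]/(a%:C) ltcR.
apply/nbhs_ballP; exists d%:C => [|w]; first by rewrite /= ltcR.
by rewrite -ball_normE/= distrC rnormE ltcR; exact: vA.
Qed.

Lemma bounded_setP (B : set V) :
  bounded_set B <-> exists M : R, forall v, B v -> rnorm v <= M.
Proof.
split=> [[M [Mr hM]]|[M hM]].
  have /hM h : M < M + 1 by rewrite ltrDl.
  exists (complex.Re (M + 1)) => v Bv.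
  by rewrite -lecR -rnormE RRe_real ?h// rpredD// real1.
exists M%:C; split; first by rewrite realE -[0]/(0%:C) !lecR le_total.
move=> x Mx v Bv /=; rewrite rnormE (le_trans _ (ltW Mx))// lecR; exact: hM.
Qed.

End real_norm.

(** * Limits, extension to the closed disc and Arzela-Ascoli *)

Section complex_completeness.
Context {R : realType}.
Local Notation C := R[i].

Lemma half_lt (x : R) : 0 < x -> x / 2 < x.
Proof. by move=> x0; rewrite ltr_pdivrMr// ltr_pMr// ltr1n. Qed.

Lemma complex_cauchy_lim (T : Type) (F : set_system T) (FF : ProperFilter F)
    (V : T -> C) :
  (forall e : R, 0 < e -> exists2 A, F A &
     forall x y, A x -> A y -> cabs (V x - V y) <= e) ->
  exists l : C, forall e : R, 0 < e -> F [set x | cabs (V x - l) <= e].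
Proof.
move=> hV.
have real_lim (u : T -> R) :
    (forall x y, `|u x - u y| <= cabs (V x - V y)) ->
    exists l : R, forall e : R, 0 < e -> F [set x | `|u x - l| <= e].
  move=> uV; have cF : cauchy (u x @[x --> F]).
    apply: cauchy_exP => e e0.
    have [A FA hA] := hV _ (divr_gt0 e0 (ltr0Sn R 1)).
    have [x0 Ax0] := filter_ex FA.
    exists (u x0); rewrite /= nbhs_simpl/=; apply: filterS FA => x Ax.
    by rewrite /ball/= (le_lt_trans (uV _ _))// (le_lt_trans (hA _ _ Ax0 Ax))// half_lt.
  exists (lim (u x @[x --> F])) => e e0.
  have /cvgrPdist_le/(_ e e0) := R_complete (fmap_proper_filter u FF) cF.
  by apply: filterS => x; rewrite /= distrC.
have subRe (u v : C) : complex.Re u - complex.Re v = complex.Re (u - v).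
  by case: u v => a b [c d].
have subIm (u v : C) : complex.Im u - complex.Im v = complex.Im (u - v).
  by case: u v => a b [c d].
have [|a ha] := real_lim (fun x => complex.Re (V x)).
  by move=> x y; rewrite subRe cabs_Re.
have [|b hb] := real_lim (fun x => complex.Im (V x)).
  by move=> x y; rewrite subIm cabs_Im.
exists (a +i* b) => e e0; have e2 : 0 < e / 2 by rewrite divr_gt0.
apply: filterS (filterI (ha _ e2) (hb _ e2)) => x [/= xa xb].
rewrite (le_trans (cabs_ReIm _))// (splitr e) lerD//.
  by rewrite -subRe.
by rewrite -subIm.
Qed.

Lemma disc_near (xi : C) (d : R) : cabs xi <= 1 -> 0 < d ->
  exists2 x, disc x & cabs (x - xi) < d.
Proof.
move=> xi1 d0; pose u := Num.min (1 / 2) (d / 2).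
have u0 : 0 < u by rewrite lt_min !divr_gt0.
have u1 : u < 1 by rewrite gt_min ltr_pdivrMr// mul1r ltr1n.
have ud : u < d by rewrite gt_min (half_lt d0) orbT.
exists ((1 - u)%:C * xi).
  apply/discP; rewrite cabsM cabsR ger0_norm ?subr_ge0 ?(ltW u1)//.
  rewrite (@le_lt_trans _ _ (1 - u))// ?gtrBl//.
  by rewrite ler_piMr ?subr_ge0 ?(ltW u1).
rewrite (_ : _ - _ = - (u%:C * xi)); last by rewrite rmorphB rmorph1; ring.
rewrite cabsN cabsM cabsR gtr0_norm// (le_lt_trans _ ud)//.
by rewrite ler_piMr// ltW.
Qed.

Lemma within_continuous_cabsP (A : set C) (f : C -> C) :
  {within A, continuous f} <-> forall xi, A xi -> forall e : R, 0 < e ->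
    exists2 d : R, 0 < d & forall z, A z -> cabs (z - xi) < d -> cabs (f z - f xi) <= e.
Proof.
rewrite (subspace_continuousP A f); split=> [cf xi Axi e e0|cf xi Axi].
  have /(cf xi Axi)/nbhs_cabsP[d d0 hd] : nbhs (f xi) [set v | cabs (v - f xi) <= e].
    by apply/nbhs_cabsP; exists e => // w /ltW.
  by exists d => // z Az zd; exact: hd.
move=> B /nbhs_cabsP[e e0 hB].
have [d d0 hd] := cf xi Axi _ (divr_gt0 e0 (ltr0Sn R 1)).
apply/nbhs_cabsP; exists d => // z zd Az; apply: hB.
by rewrite (le_lt_trans (hd z Az zd))// half_lt.
Qed.

Lemma disc_algebra_eq (E1 E2 : C -> C) : disc_algebra_set E1 -> disc_algebra_set E2 ->
  {in disc, E1 =1 E2} -> E1 = E2.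
Proof.
move=> [_ c1 z1] [_ c2 z2] E12; apply/funext => xi.
have [cxi|cxi] := pselect (closed_disc xi); last by rewrite z1// z2.
apply/eqP; rewrite -subr_eq0; apply/eqP/cabs_eq0P => e e0.
have e2 : 0 < e / 2 by rewrite divr_gt0.
have [d1 d10 h1] := (within_continuous_cabsP _ _).1 c1 xi cxi _ e2.
have [d2 d20 h2] := (within_continuous_cabsP _ _).1 c2 xi cxi _ e2.
have d0 : 0 < Num.min d1 d2 by rewrite lt_min d10.
have [x Dx] := disc_near ((closed_discP xi).1 cxi) d0.
rewrite lt_min => /andP[x1 x2]; have cx := disc_closed_disc Dx.
rewrite (splitr e) (le_trans (ler_cabs_dist _ _ (E1 x)))// lerD//.
  by rewrite cabsB h1.
by rewrite E12 ?h2// inE.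
Qed.

(** The hypothesis says that [V] is Cauchy along the disc at every point of the closed disc; the
    extension takes the limits as values, and is 0 elsewhere. *)
Lemma disc_algebra_extension (V : C -> C) : analytic disc V ->
  (forall xi, cabs xi <= 1 -> forall e : R, 0 < e -> exists2 d : R, 0 < d &
     forall z z', disc z -> disc z' -> cabs (z - xi) < d -> cabs (z' - xi) < d ->
       cabs (V z - V z') <= e) ->
  exists2 E, disc_algebra_set E & {in disc, E =1 V}.
Proof.
move=> Van hV.
pose near_val xi l := forall e : R, 0 < e -> exists2 d : R, 0 < d &
  forall x, disc x -> cabs (x - xi) < d -> cabs (V x - l) <= e.
have nv xi : closed_disc xi -> exists l, near_val xi l.
  move=> /closed_discP xi1.
  have FP : ProperFilter (within disc (nbhs xi)).
    apply: within_nbhs_proper => A /nbhs_cabsP[d d0 hd].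
    by have [x Dx xd] := disc_near xi1 d0; exists x; split=> //; exact: hd.
  have [|l hl] := complex_cauchy_lim FP (V := V).
    move=> e e0; have [d d0 hd] := hV xi xi1 e e0.
    exists [set x | disc x /\ cabs (x - xi) < d].
      by apply/nbhs_cabsP; exists d.
    by move=> x y [Dx xd] [Dy yd]; exact: hd.
  exists l => e e0; have /nbhs_cabsP[d d0 hd] := hl e e0.
  by exists d => // x Dx xd; exact: hd.
pose E z := if pselect (closed_disc z) then xget 0 [set l | near_val z l] else 0.
have nvE xi : closed_disc xi -> near_val xi (E xi).
  move=> cxi; rewrite /E; case: (pselect (closed_disc xi)) => [c|/(_ cxi)[]].
  by have := @xgetPex _ 0 [set l | near_val xi l] (nv xi cxi).
have EV : {in disc, E =1 V}.
  move=> z /set_mem Dz; apply/esym/eqP; rewrite -subr_eq0; apply/eqP/cabs_eq0P => e e0.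
  have [d d0 hd] := nvE z (disc_closed_disc Dz) e e0.
  (* Inside the disc [z] itself is an admissible point of approach. *)
  by apply: hd => //; rewrite subrr cabs0.
exists E; last exact: EV.
split.
- apply: analytic_uniform_limit => e e0; exists V => // z Dz.
  by rewrite EV ?inE// subrr cabs0 ltW.
- apply/within_continuous_cabsP => xi cxi e e0.
  have e3 : 0 < e / 3 by rewrite divr_gt0.
  have [d d0 hd] := hV xi ((closed_discP xi).1 cxi) _ e3.
  exists d => // z cz zd.
  have [d1 d10 h1] := nvE z cz _ e3.
  have [d2 d20 h2] := nvE xi cxi _ e3.
  have m1 : 0 < Num.min d1 (d - cabs (z - xi)) by rewrite lt_min d10 subr_gt0.
  have [x Dx] := disc_near ((closed_discP z).1 cz) m1.
  rewrite lt_min ltrBrDr => /andP[x1 x2].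
  have m2 : 0 < Num.min d2 d by rewrite lt_min d20.
  have [y Dy] := disc_near ((closed_discP xi).1 cxi) m2.
  rewrite lt_min => /andP[y1 y2].
  have xxi : cabs (x - xi) < d by rewrite (le_lt_trans (ler_cabs_dist _ _ z)).
  have alg (a b c c' : C) : a - b = - (c - a) + (c - c') + (c' - b) by ring.
  rewrite (alg _ _ (V x) (V y)) (_ : e = e / 3 + e / 3 + e / 3); last by field.
  apply: le_trans (ler_cabsD _ _) _; apply: lerD; last exact: h2.
  apply: le_trans (ler_cabsD _ _) _; rewrite cabsN; apply: lerD; first exact: h1.
  exact: hd.
- by move=> z cz; rewrite /E; case: (pselect (closed_disc z)) => [/cz[]|].
Qed.

Lemma compact_cball (M : R) : 0 < M -> compact [set z : C | cabs z <= M].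
Proof.
move=> M0; have MC : M%:C != 0 by rewrite -cabs_gt0 cabsR gtr0_norm.
have -> : [set z : C | cabs z <= M] = (fun z => 0 + M%:C * (z - 0)) @` closed_disc.
  apply/seteqP; split=> [z/= zM|_ [z /closed_discP z1 <-]]/=.
    exists (z / M%:C); last by rewrite subr0 add0r mulrC divfK.
    by apply/closed_discP; rewrite cabs_div cabsR gtr0_norm// ler_pdivrMr// mul1r.
  by rewrite subr0 add0r cabsM cabsR gtr0_norm// ler_piMr// ltW.
apply: continuous_compact; last exact: closed_disc_compact.
by apply: continuous_subspaceT => z; exact: continuous_affine.
Qed.

Lemma ultra_lim (T : Type) (F : set_system T) (FF : UltraFilter F) (V : T -> C) (M : R) :
  0 < M -> F [set x | cabs (V x) <= M] ->
  exists l : C, forall e : R, 0 < e -> F [set x | cabs (V x - l) <= e].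
Proof.
move=> M0 FM.
have PF : ProperFilter (V x @[x --> F]) by apply: fmap_proper_filter; exact: ultra_proper.
have [l [_ cl]] := compact_cball M0 PF FM.
exists l => e e0.
have [//|FC] := in_ultra_setVsetC [set x | cabs (V x - l) <= e] FF.
exfalso.
have : nbhs l [set v | cabs (v - l) < e] by apply/nbhs_cabsP; exists e.
move=> /(cl [set v | ~ cabs (v - l) <= e] _ FC)[v [/= nv /ltW v1]].
exact: nv.
Qed.

Lemma rnorm_disc_algebra_le (k : disc_algebra R) (e : R) :
  (forall z, closed_disc z -> cabs (k z) <= e) -> rnorm k <= e.
Proof.
move=> ke; apply: sup_norm_le => //.
by exists 0; exact/disc_closed_disc/disc0.
Qed.

(** The modulus [delta] may vary with the point [xi]; uniformity is recovered from the compactness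
    of the closed disc. *)
Definition equicontinuous_ball (M : R) (delta : C -> R -> R) : set (disc_algebra R) :=
  fun k => (forall z, closed_disc z -> cabs (k z) <= M) /\
    (forall xi e, closed_disc xi -> 0 < e -> forall z z', closed_disc z -> closed_disc z' ->
     cabs (z - xi) < delta xi e -> cabs (z' - xi) < delta xi e -> cabs (k z - k z') <= e).

(** Along an ultrafilter the values at each point converge, by boundedness. The limit [E] inherits
    the modulus [delta], so convergence is uniform near each point, hence on the compact closed
    disc, and [E] belongs to the disc algebra. *)
Lemma disc_algebra_arzela (M : R) (delta : C -> R -> R) : 0 < M ->
  (forall xi e, 0 < e -> 0 < delta xi e) -> compact (equicontinuous_ball M delta).
Proof.
move=> M0 d0; rewrite compact_ultra => F UF.
set S := equicontinuous_ball M delta => FS.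
have PF : ProperFilter F by exact: ultra_proper.
have pl z : exists l : C, closed_disc z -> forall e : R, 0 < e ->
    F [set k | cabs ((k : disc_algebra R) z - l) <= e].
  have [cz|cz] := pselect (closed_disc z); last by exists 0.
  have [|l hl] := @ultra_lim _ F UF (fun k : disc_algebra R => k z) M M0.
    by apply: filterS FS => k [h _]; exact: h.
  by exists l.
have [L hL] := choice pl.
pose E z := if pselect (closed_disc z) then L z else 0.
have hE z : closed_disc z -> forall e : R, 0 < e ->
    F [set k | cabs ((k : disc_algebra R) z - E z) <= e].
  by move=> cz; rewrite /E; case: (pselect (closed_disc z)) => [c|/(_ cz)[]]; exact: hL.
have Eeq xi (e : R) : closed_disc xi -> 0 < e -> forall z z', closed_disc z -> closed_disc z' ->
    cabs (z - xi) < delta xi e -> cabs (z' - xi) < delta xi e -> cabs (E z - E z') <= e.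
  move=> cxi e0 z z' cz cz' zd zd'; apply/ler_addgt0Pr => h h0.
  have h2 : 0 < h / 2 by rewrite divr_gt0.
  have [k [[[_ ke] k1] k2]] := filter_ex (filterI (filterI FS (hE z cz _ h2)) (hE z' cz' _ h2)).
  have alg (a b c c' : C) : a - b = (c - c') - (c - a) + (c' - b) by ring.
  rewrite (alg _ _ (k z) (k z')) (_ : e + h = e + h / 2 + h / 2); last by field.
  apply: le_trans (ler_cabsD _ _) _; apply: lerD; last exact: k2.
  apply: le_trans (ler_cabsD _ _) _; rewrite cabsN; apply: lerD; last exact: k1.
  exact: (ke xi e).
have unif (e : R) : 0 < e ->
    F [set k | forall z, closed_disc z -> cabs ((k : disc_algebra R) z - E z) <= e].
  move=> e0; have e3 : 0 < e / 3 by rewrite divr_gt0.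
  have := (compact_near_coveringP _).1 closed_disc_compact _ F
    (fun (k : disc_algebra R) z => closed_disc z -> cabs (k z - E z) <= e).
  have H : forall xi, @closed_disc R xi -> \forall x' \near xi & k \near F,
      closed_disc x' -> cabs ((k : disc_algebra R) x' - E x') <= e.
    move=> xi cxi.
    exists ([set x | cabs (x - xi) < delta xi (e / 3)],
      [set k | S k /\ cabs (k xi - E xi) <= e / 3]) => /=.
      split; first by apply/nbhs_cabsP; exists (delta xi (e / 3)) => //; exact: d0.
      exact: filterI FS (hE xi cxi _ e3).
    move=> [z k]/= [zd [[_ ke] k1]] cz.
    have dxi : cabs (xi - xi) < delta xi (e / 3) by rewrite subrr cabs0 d0.
    have alg (a b c c' : C) : a - b = (a - c) + (c - c') - (b - c') by ring.
    rewrite (alg _ _ (k xi) (E xi)) (_ : e = e / 3 + e / 3 + e / 3); last by field.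
    apply: le_trans (ler_cabsD _ _) _; rewrite cabsN; apply: lerD; last exact: (Eeq xi (e / 3)).
    apply: le_trans (ler_cabsD _ _) _; apply: lerD; last exact: k1.
    exact: (ke xi (e / 3)).
  move=> /(_ _ H); apply: filterS => k hk z cz; exact: hk.
have EA : disc_algebra_set E.
  split.
  - apply: analytic_uniform_limit => e e0.
    have [k hk] := filter_ex (unif e e0).
    exists k; first by have /disc_algebra_predP[] := valP k.
    by move=> z Dz; rewrite cabsB; apply: hk; exact: disc_closed_disc.
  - apply/within_continuous_cabsP => xi cxi e e0.
    exists (delta xi e) => [|z cz zd]; first exact: d0.
    by apply: (Eeq xi e) => //; rewrite subrr cabs0 d0.
  - by move=> z cz; rewrite /E; case: (pselect (closed_disc z)) => [/cz[]|].
pose EE : disc_algebra R := exist _ E ((disc_algebra_predP E).2 EA).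
exists EE; split.
  split=> [z cz|xi e cxi e0 z z' cz cz']; last exact: Eeq.
  apply/ler_addgt0Pr => h h0.
  have [k [[kM _] k1]] := filter_ex (filterI FS (hE z cz _ h0)).
  rewrite -[X in cabs X](subrK (k z)) (le_trans (ler_cabsD _ _))// addrC.
  by apply: lerD; [exact: kM|rewrite cabsB].
move=> A /nbhs_rnormP[d dd hA]; have d2 : 0 < d / 2 by rewrite divr_gt0.
apply: filterS (unif _ d2) => k hk; apply: hA.
apply: (@le_lt_trans _ _ (d / 2)); last exact: half_lt.
by apply: rnorm_disc_algebra_le => z cz; exact: hk.
Qed.

End complex_completeness.

(** * Compactness of T_g *)

Section compact_operators.
Context {R : realType}.
Local Notation C := R[i].

Lemma precompact_of_compact (V : normedModType C) (A K : set V) :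
  compact K -> A `<=` K -> precompact A.
Proof.
move=> cK AK; exists K; first exact: AK.
by split=> //; apply: compact_closed => //; exact: norm_hausdorff.
Qed.

Lemma compact_operator_compl (X Y Z : normedModType C) (T : {linear X -> Y})
    (L : {linear Y -> Z}) :
  (forall y, rnorm (L y) <= rnorm y) -> compact_operator T ->
  compact_operator (L \o T : {linear X -> Z}).
Proof.
move=> L1 cT B /cT[K TK [cK _]].
apply: (precompact_of_compact (K := L @` K)).
  apply: continuous_compact => //; apply: continuous_subspaceT => y.
  move=> A /nbhs_rnormP[d d0 hd]; apply/nbhs_rnormP; exists d => // w wy.
  by apply: hd; rewrite -linearB (le_lt_trans (L1 _)).
by move=> _ [x Bx <-]; exists (T x) => //; apply: TK; exists x.
Qed.

Lemma compact_operator_compr (X Y Z : normedModType C) (L : {linear X -> Y})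
    (T : {linear Y -> Z}) :
  (forall x, rnorm (L x) <= rnorm x) -> compact_operator T ->
  compact_operator (T \o L : {linear X -> Z}).
Proof.
move=> L1 cT B /bounded_setP[M BM].
have : bounded_set (L @` B).
  apply/bounded_setP; exists M => _ [x Bx <-].
  by rewrite (le_trans (L1 _))// BM.
move=> /cT; apply: precompact_subset => _ [x Bx <-].
by exists (L x) => //; exists x.
Qed.

Lemma Hinf_analytic (f : Hinf R) : analytic disc f.
Proof. by have /Hinf_predP[] := valP f. Qed.

Lemma Hinf_le (f : Hinf R) z : disc z -> cabs (f z) <= rnorm f.
Proof. by move=> Dz; apply: sup_norm_ub => //; have /Hinf_predP[] := valP f. Qed.

Lemma rnorm_Hinf_le (f : Hinf R) (e : R) :
  (forall z, disc z -> cabs (f z) <= e) -> rnorm f <= e.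
Proof. by move=> fe; apply: sup_norm_le => //; exists 0; exact: disc0. Qed.

Lemma disc_algebra_analytic (f : disc_algebra R) : analytic disc f.
Proof. by have /disc_algebra_predP[] := valP f. Qed.

Lemma disc_algebra_le (f : disc_algebra R) z : closed_disc z -> cabs (f z) <= rnorm f.
Proof.
move=> Dz; apply: sup_norm_ub => //.
exact/disc_algebra_bounded/disc_algebra_predP/(valP f).
Qed.

(** Elements of [Hinf] are 0 off the open disc, so the inclusion of A into H^inf has to erase the
    values on the circle. *)
Definition restrict_disc (f : disc_algebra R) (z : C) : C :=
  if pselect (disc z) then f z else 0.

Lemma restrict_discE (f : disc_algebra R) : {in disc, restrict_disc f =1 f}.
Proof.
by move=> z /set_mem Dz; rewrite /restrict_disc; case: (pselect (disc z)) => [c|/(_ Dz)[]].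
Qed.

Lemma analytic_eq (f h : C -> C) : {in disc, f =1 h} -> analytic disc f -> analytic disc h.
Proof.
move=> fh fan; apply: analytic_uniform_limit => e e0; exists f; first exact: fan.
by move=> z Dz; rewrite fh ?inE// subrr cabs0 ltW.
Qed.

Lemma restrict_disc_Hinf (f : disc_algebra R) : restrict_disc f \in Hinf_pred.
Proof.
apply/Hinf_predP; split.
- apply: (analytic_eq (f := f)); last exact: disc_algebra_analytic.
  by move=> z Dz; rewrite restrict_discE.
- exists (rnorm f) => z Dz; rewrite restrict_discE ?inE//.
  by apply: disc_algebra_le; exact: disc_closed_disc.
- by move=> z Dz; rewrite /restrict_disc; case: (pselect (disc z)) => [/Dz[]|].
Qed.

Definition disc_algebra_to_Hinf (f : disc_algebra R) : Hinf R :=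
  exist _ (restrict_disc f) (restrict_disc_Hinf f).

Lemma disc_algebra_to_Hinf_linear : linear disc_algebra_to_Hinf.
Proof.
move=> c f h; apply/val_inj/funext => z.
rewrite -[RHS]/(c * restrict_disc f z + restrict_disc h z).
rewrite -[LHS]/(restrict_disc (c *: f + h) z) /restrict_disc.
by case: (pselect (disc z)) => [Dz|Dz] //; rewrite mulr0 addr0.
Qed.

HB.instance Definition _ := GRing.isLinear.Build C (disc_algebra R) (Hinf R) _
  disc_algebra_to_Hinf disc_algebra_to_Hinf_linear.

Lemma rnorm_disc_algebra_to_Hinf f : rnorm (disc_algebra_to_Hinf f) <= rnorm f.
Proof.
apply: rnorm_Hinf_le => z Dz; rewrite -[X in cabs X]/(restrict_disc f z).
by rewrite restrict_discE ?inE//; apply: disc_algebra_le; exact: disc_closed_disc.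
Qed.

Variable g : C -> C.

Lemma eq_Tg_disc (f h : C -> C) : {in disc, f =1 h} -> {in disc, Tg g f =1 Tg g h}.
Proof. by move=> fh z /set_mem; exact: eq_Tg. Qed.

(** Compactness survives composition with the inclusion of A into H^inf, which does not increase
    norms: on the right here, on the left in [Tg_compact_widen]. *)
Lemma Tg_compact_restrict (Y : normedModType C) (iY : Y -> C -> C) :
  Tg_compact (@Hinf_fun R) iY g -> Tg_compact (@disc_algebra_fun R) iY g.
Proof.
move=> [T [hT cT]]; exists (T \o disc_algebra_to_Hinf : {linear _ -> _}); split.
  move=> f z Dz; rewrite hT//; apply: eq_Tg_disc => //.
  exact: restrict_discE.
exact: compact_operator_compr rnorm_disc_algebra_to_Hinf cT.
Qed.

Lemma Tg_compact_widen (X : normedModType C) (iX : X -> C -> C) :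
  Tg_compact iX (@disc_algebra_fun R) g -> Tg_compact iX (@Hinf_fun R) g.
Proof.
move=> [T [hT cT]]; exists (disc_algebra_to_Hinf \o T : {linear _ -> _}); split.
  move=> f z Dz; rewrite -hT//; exact: restrict_discE.
exact: compact_operator_compl rnorm_disc_algebra_to_Hinf cT.
Qed.

Lemma disc_algebra_near (k : disc_algebra R) z (e d : R) : closed_disc z ->
  0 < e -> 0 < d -> exists2 x, disc x & cabs (x - z) < d /\ cabs (k x - k z) <= e.
Proof.
move=> cz e0 d0; have /disc_algebra_predP[_ kc _] := valP k.
have [d1 d10 hd] := (within_continuous_cabsP _ _).1 kc z cz e e0.
have m0 : 0 < Num.min d d1 by rewrite lt_min d0.
have [x Dx] := disc_near ((closed_discP z).1 cz) m0.
rewrite lt_min => /andP[x1 x2]; exists x => //; split=> //.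
by apply: hd => //; exact: disc_closed_disc.
Qed.

Hypothesis gan : analytic disc g.

Lemma Tg_bounded (M : R) f : (forall p, unit_ball p -> forall z, disc z -> cabs (Tp g p z) <= M) ->
  analytic disc f -> (forall z, disc z -> cabs (f z) <= 1) ->
  forall z, disc z -> cabs (Tg g f z) <= M.
Proof.
move=> hM fan f1 z Dz; apply/ler_addgt0Pr => e e0.
have [r0 r1 zr] := mid_disc Dz; set r := _ / 2 in r0 r1 zr.
have [p pb hp] := Tp_approx gan fan f1 (introT andP (conj r0 r1)) e0.
rewrite -[X in cabs X](subrK (Tp g p z)) (le_trans (ler_cabsD _ _))// addrC.
by apply: lerD; [exact: hM|exact: hp (ltW zr)].
Qed.

Let normalize (M : R) (f : C -> C) z : C := (M^-1)%:C * f z.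

Let normalize_analytic M f : analytic disc f -> analytic disc (normalize M f).
Proof. by move=> fan; exact: analyticZ. Qed.

Let normalize_le M f : 0 < M -> (forall z, disc z -> cabs (f z) <= M) ->
  forall z, disc z -> cabs (normalize M f z) <= 1.
Proof.
move=> M0 fM z Dz; rewrite /normalize cabsM cabsR gtr0_norm ?invr_gt0//.
by rewrite ler_pdivrMl// mulr1 fM.
Qed.

Let Tg_normalize M f z : 0 < M -> analytic disc f -> disc z ->
  Tg g f z = M%:C * Tg g (normalize M f) z.
Proof.
move=> M0 fan Dz; rewrite -(TgZ gan _ (@normalize_analytic M f fan) Dz).
apply: eq_Tg => // x _; rewrite /normalize mulrA -rmorphM/= mulfV ?gt_eqF//.
by rewrite mul1r.
Qed.

(** Equicontinuity extends each T_g f to the closed disc, and it places the image of a ball of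
    radius N in one compact set [equicontinuous_ball], with bound N M and a modulus rescaled by
    N. *)
Lemma equicontinuous_Tg_compact : Tp_bounded g -> Tp_equicontinuous g ->
  Tg_compact (@Hinf_fun R) (@disc_algebra_fun R) g.
Proof.
move=> [M M0 hM] hU.
(* The radii are to be gathered by choice into one function [delta] of (xi, e), with default value 1
   outside the meaningful range. *)
have hU' (xe : C * R) : exists d : R, 0 < d /\ (cabs xe.1 <= 1 -> 0 < xe.2 ->
    forall f, analytic disc f -> (forall z, disc z -> cabs (f z) <= 1) ->
    forall z z', disc z -> disc z' -> cabs (z - xe.1) < d -> cabs (z' - xe.1) < d ->
    cabs (Tg g f z - Tg g f z') <= xe.2).
  have [[xi1 e0]|nh] := pselect (cabs xe.1 <= 1 /\ 0 < xe.2); last first.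
    by exists 1; split=> // h1 h2; case: nh.
  by have [d d0 hd] := Tg_equicontinuous gan hU xi1 e0; exists d; split.
have [delta hdelta] := choice hU'.
(* For |f| <= N the modulus of f / N is used with tolerance e / N. *)
have ubE N f z z' xi (e : R) : 0 < N -> analytic disc f ->
    (forall z, disc z -> cabs (f z) <= N) -> cabs xi <= 1 -> 0 < e ->
    disc z -> disc z' -> cabs (z - xi) < delta (xi, e / N) ->
    cabs (z' - xi) < delta (xi, e / N) -> cabs (Tg g f z - Tg g f z') <= e.
  move=> N0 fan fN xi1 e0 Dz Dz' zd zd'.
  have [_ h] := hdelta (xi, e / N).
  have := h xi1 (divr_gt0 e0 N0) _ (@normalize_analytic N f fan) (normalize_le N0 fN) z z' Dz Dz' zd zd'.
  rewrite (Tg_normalize N0 fan Dz) (Tg_normalize N0 fan Dz') -mulrBr cabsM cabsR.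
  by rewrite gtr0_norm//= ler_pdivlMr// mulrC.
have rn0 (f : Hinf R) : 0 < rnorm f + 1 by rewrite ltr_wpDl// rnorm_ge0.
have fN (f : Hinf R) z : disc z -> cabs (f z) <= rnorm f + 1.
  by move=> Dz; rewrite (le_trans (Hinf_le f Dz))// lerDl.
have exT (f : Hinf R) : exists E : disc_algebra R, {in disc, E =1 Tg g f}.
  have [|E EA hE] := disc_algebra_extension (analytic_Tg gan (@Hinf_analytic f)).
    move=> xi xi1 e e0; exists (delta (xi, e / (rnorm f + 1))).
      by have [] := hdelta (xi, e / (rnorm f + 1)).
    move=> z z' Dz Dz' zd zd'.
    exact: (ubE _ _ _ _ _ _ (rn0 f) (@Hinf_analytic f) (fN f) xi1 e0 Dz Dz' zd zd').
  by exists (exist _ E ((disc_algebra_predP E).2 EA)).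
have [T hT] := choice exT.
(* Linearity holds on the open disc and extends by continuity, through [disc_algebra_eq]. *)
have linT : linear T.
  move=> c f h; apply/val_inj; apply: disc_algebra_eq.
  - exact/disc_algebra_predP/valP.
  - exact/disc_algebra_predP/valP.
  move=> z /[dup] Dz' /set_mem Dz; rewrite -[LHS]/(T (c *: f + h) z) hT//.
  rewrite -[RHS]/(c * T f z + T h z) !hT//.
  rewrite -(TgZ gan c (@Hinf_analytic f) Dz).
  rewrite -(TgD gan (analyticZ (c := c) (@Hinf_analytic f)) (@Hinf_analytic h) Dz).
  by apply: eq_Tg => //.
pose T' : {linear Hinf R -> disc_algebra R} :=
  HB.pack T (GRing.isLinear.Build C (Hinf R) (disc_algebra R) _ T linT).
exists T'; split; first exact: hT.
move=> B /bounded_setP[N0' hN'].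
pose N := Num.max N0' 1.
have N0 : 0 < N by rewrite lt_max ltr01 orbT.
have hN (f : Hinf R) : B f -> forall z, disc z -> cabs (f z) <= N.
  by move=> Bf z Dz; rewrite (le_trans (Hinf_le f Dz))// le_max hN'.
have dpos xi e : 0 < e -> 0 < delta (xi, e / N).
  by move=> _; have [] := hdelta (xi, e / N).
have cK := disc_algebra_arzela (M := N * M) (delta := fun xi e => delta (xi, e / N))
  (mulr_gt0 N0 M0) dpos.
suff key (f : Hinf R) : B f ->
    equicontinuous_ball (N * M) (fun xi e => delta (xi, e / N)) (T f).
  by apply: precompact_of_compact cK _ => _ [f Bf <-]; exact: key.
move=> Bf.
have fan := @Hinf_analytic f.
have TE z : disc z -> T f z = Tg g f z by move=> Dz; rewrite hT ?inE.
split=> [z cz|xi e cxi e0 z z' cz cz' zd zd'].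
  apply/ler_addgt0Pr => h h0.
  have [x Dx [_ hx]] := disc_algebra_near (T f) cz h0 (@ltr01 R).
  rewrite -[X in cabs X](subrK (T f x)) (le_trans (ler_cabsD _ _))// addrC.
  apply: lerD; last by rewrite cabsB.
  rewrite TE// (Tg_normalize N0 fan Dx) cabsM cabsR gtr0_norm// ler_wpM2l ?(ltW N0)//.
  apply: (Tg_bounded hM (@normalize_analytic N f fan) _ Dx).
  exact: normalize_le N0 (hN f Bf).
apply/ler_addgt0Pr => h h0; have h2 : 0 < h / 2 by rewrite divr_gt0.
(* The slack in these strict inequalities allows z and z' to be replaced by nearby points of the
   open disc. *)
move: zd zd'; rewrite -subr_gt0 => zd; rewrite -subr_gt0 => zd'.
have [x Dx [xd hx]] := disc_algebra_near (T f) cz h2 zd.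
have [y Dy [yd hy]] := disc_algebra_near (T f) cz' h2 zd'.
have alg (a b c c' : C) : a - b = (c - c') - (c - a) + (c' - b) by ring.
rewrite (alg _ _ (T f x) (T f y)) (_ : e + h = e + h / 2 + h / 2); last by field.
apply: le_trans (ler_cabsD _ _) _; apply: lerD; last exact: hy.
apply: le_trans (ler_cabsD _ _) _; rewrite cabsN; apply: lerD; last exact: hx.
rewrite TE// TE//; apply: (ubE N f x y xi e N0 fan (hN f Bf)) => //.
- exact/closed_discP.
- by rewrite (le_lt_trans (ler_cabs_dist _ _ z))// -ltrBrDr.
- by rewrite (le_lt_trans (ler_cabs_dist _ _ z'))// -ltrBrDr.
Qed.

End compact_operators.

(** * From compactness of T_g to boundedness and decay along peak functions *)

Section compact_to_bounded.
Context {R : realType}.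
Local Notation C := R[i].

Lemma compact_rnorm_bounded (V : normedModType C) (K : set V) : compact K ->
  exists2 M : R, 0 < M & forall v, K v -> rnorm v <= M.
Proof.
move=> cK.
have := (compact_near_coveringP K).1 cK nat \oo (fun n v => rnorm v <= n%:R) _.
have H v : K v -> \forall v' \near v & n \near \oo, rnorm v' <= n%:R :> R.
  move=> Kv; have [N _ hN] := nbhs_infty_ger (rnorm v + 1).
  exists ([set w | rnorm (w - v) < 1], [set n | (N <= n)%N]) => /=.
    by split; [apply/nbhs_rnormP; exists 1|exists N].
  move=> [w n]/= [wv Nn]; have := hN n Nn; rewrite /= => /(le_trans _); apply.
  by rewrite -{1}(subrK v w) (le_trans (ler_rnormD _ _))// addrC lerD// ltW.
move=> /(_ _ H)[N _ hN]; exists N.+1%:R => // v Kv.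
by rewrite (hN N.+1 (leqnSn N))//.
Qed.

Lemma compact_seq_cluster (V : normedModType C) (K : set V) (v : nat -> V) :
  compact K -> (forall n, K (v n)) -> exists h : V, forall (e : R) N, 0 < e ->
    exists2 n, (N <= n)%N & rnorm (v n - h) < e.
Proof.
move=> cK vK.
have FK : (v n @[n --> \oo]) K by exists 0%N => // n _; exact: vK.
have [h [_ ch]] := cK _ _ FK.
exists h => e N e0.
have A1 : (v n @[n --> \oo]) [set v n | n in [set n | (N <= n)%N]].
  by exists N => // n /= Nn; exists n.
have A2 : nbhs h [set w | rnorm (w - h) < e] by apply/nbhs_rnormP; exists e.
have [_ [[n Nn <-] he]] := ch _ _ A1 A2.
by exists n.
Qed.

Definition horner_closed_disc (p : {poly C}) (z : C) : C :=
  if pselect (closed_disc z) then p.[z] else 0.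

Lemma horner_closed_discE p z : closed_disc z -> horner_closed_disc p z = p.[z].
Proof.
by move=> cz; rewrite /horner_closed_disc; case: (pselect (closed_disc z)) => [c|/(_ cz)[]].
Qed.

Lemma horner_disc_algebra p : horner_closed_disc p \in disc_algebra_pred.
Proof.
apply/disc_algebra_predP; split.
- apply: (analytic_eq (f := horner p)); last exact: (@analytic_horner _ p disc).
  by move=> z /set_mem Dz; rewrite horner_closed_discE//; exact: disc_closed_disc.
- apply/within_continuous_cabsP => xi cxi e e0.
  have [d d0 hd] := (continuous_cabsP _ _).1 (@horner_continuous _ p xi) e e0.
  by exists d => // z cz zd; rewrite !horner_closed_discE// ltW// hd.
- by move=> z cz; rewrite /horner_closed_disc; case: (pselect (closed_disc z)) => [/cz[]|].
Qed.

Definition poly_disc_algebra p : disc_algebra R :=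
  exist _ (horner_closed_disc p) (horner_disc_algebra p).

Lemma poly_disc_algebra_ball p : unit_ball p -> rnorm (poly_disc_algebra p) <= 1.
Proof.
move=> pb; apply: rnorm_disc_algebra_le => z cz.
rewrite -[X in cabs X]/(horner_closed_disc p z) horner_closed_discE//.
by apply: pb; exact/closed_discP.
Qed.

Variable g : C -> C.
Hypothesis gan : analytic disc g.

(** On the segment from 0 to z the peak function has modulus at most (1 + |z|) / 2 < 1 for every
    [xi], and g' is bounded, so [N] depends on neither [xi] nor [p]. *)
Lemma Tp_peak_small z (e : R) : disc z -> 0 < e -> exists N, forall n, (N <= n)%N ->
  forall xi p, cabs xi = 1 -> unit_ball p -> cabs (Tp g (p * peak xi n) z) <= e.
Proof.
move=> Dz e0; have /discP z1 := Dz.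
have [L L0 hL] := analytic_locally_bounded (analytic_derive1 gan) z1.
pose q : R := (1 + cabs z) / 2.
have q0 : 0 <= q by rewrite divr_ge0// addr_ge0// cabs_ge0.
have q1 : q < 1 by rewrite ltr_pdivrMr// mul1r -[ltRHS]/(1 + 1) ltrD2l.
have [N hN] := expr_small q0 q1 (divr_gt0 e0 (mulr_gt0 (ltr0Sn R 1) L0)).
exists N => n Nn xi p xi1 pb.
have pan := @analytic_horner _ (p * peak xi n) disc.
have h : cabs (Tp g (p * peak xi n) z) <= 2 * (q ^+ n * L).
  apply: (segment_integral_bound (analytic_Tg_arg gan pan) Dz) => t /andP[t0 t1].
  have tz : cabs (t%:C * z) <= cabs z.
    by rewrite cabsM cabsR ger0_norm// ler_piMl ?cabs_ge0.
  rewrite cabsM ler_pM ?cabs_ge0 ?hL// hornerM cabsM -[leRHS]mul1r.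
  apply: ler_pM (cabs_ge0 _) (cabs_ge0 _) _ _.
    by apply: pb; rewrite (le_trans tz)// ltW.
  by apply: peak_bound => //; rewrite xi1.
rewrite (le_trans h)// mulrCA -ler_pdivlMr ?mulr_gt0//.
exact: hN.
Qed.

(** If decay failed, there would be p_n with T_g (p_n h^n) of norm above e for all n. By compactness
    these functions cluster in norm, and by [Tp_peak_small] the cluster point vanishes at every
    point of the disc, which is absurd. *)
Lemma Tg_compact_bounded : Tg_compact (@disc_algebra_fun R) (@Hinf_fun R) g ->
  Tp_bounded g /\ Tp_peak g.
Proof.
move=> [T [hT cT]]; pose S p : Hinf R := T (poly_disc_algebra p).
have SE p z : disc z -> S p z = Tp g p z.
  move=> Dz; rewrite /S [LHS]hT ?inE//; apply: eq_Tg => // x /set_mem Dx.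
  by apply: horner_closed_discE; exact: disc_closed_disc.
have [|K TK [cK _]] := cT [set k | rnorm k <= 1].
  by apply/bounded_setP; exists 1.
have SK p : unit_ball p -> K (S p).
  by move=> pb; apply: TK; exists (poly_disc_algebra p) => //; exact: poly_disc_algebra_ball.
split.
  have [M M0 hM] := compact_rnorm_bounded cK.
  exists M => // p pb z Dz; rewrite -SE//.
  by rewrite (le_trans (Hinf_le _ Dz))// hM//; exact: SK.
move=> xi xi1 e e0; apply: contrapT => /forallNP hn.
have hn' n : exists p, unit_ball p /\ exists z, disc z /\ e < cabs (Tp g (p * peak xi n) z).
  apply: contrapT => hp; apply: (hn n) => p pb z Dz; rewrite leNgt; apply/negP => h.
  by apply: hp; exists p; split=> //; exists z.
have [p hp] := choice hn'.
have pkb n : unit_ball (p n * peak xi n).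
  by apply: unit_ballM; [case: (hp n)|apply: peak_ball; rewrite xi1].
pose v n : Hinf R := S (p n * peak xi n).
have [h hh] := compact_seq_cluster cK (fun n => SK _ (pkb n)).
pose h' : Hinf R := h; pose w n : Hinf R := v n - h'.
have wE n z : w n z = v n z - h' z by [].
have h0 z : disc z -> h' z = 0.
  move=> Dz; apply: cabs_eq0P => d d0; have d2 : 0 < d / 2 by rewrite divr_gt0.
  have [N hN] := Tp_peak_small Dz d2.
  have [n Nn hn2] := hh (d / 2) N d2.
  rewrite (_ : h' z = v n z - w n z); last by rewrite wE opprB addrC subrK.
  rewrite (le_trans (ler_cabsD _ _))// cabsN (splitr d); apply: lerD.
    by rewrite SE//; apply: hN => //; case: (hp n).
  by rewrite (le_trans (Hinf_le _ Dz))// ltW.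
have [n _ hne] := hh e 0%N e0.
have [_ [z [Dz]]] := hp n; rewrite ltNge => /negP; apply.
rewrite -SE// (_ : S _ z = w n z); last by rewrite wE h0// subr0.
by rewrite (le_trans (Hinf_le _ Dz))// ltW.
Qed.

End compact_to_bounded.

(** * Pairing polynomials with Cauchy transforms *)

Section cintegral_linear.
Context d {T : measurableType d} {R : realType}.
Local Notation C := R[i].
Implicit Types (mu : cmeasure T R) (f h : T -> C).

Lemma bounded_measurableD (u v : T -> R) :
  bounded_measurable u -> bounded_measurable v -> bounded_measurable (fun x => u x + v x).
Proof.
move=> [mu [M uM]] [mv [N vN]]; split; first exact: measurable_funD.
by exists (M + N) => x; rewrite (le_trans (ler_normD _ _))// lerD.
Qed.

Lemma bounded_measurableZ (k : R) (u : T -> R) :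
  bounded_measurable u -> bounded_measurable (fun x => k * u x).
Proof.
move=> [mu [M uM]]; split; first by apply: measurable_funM => //; exact: measurable_cst.
by exists (`|k| * M) => x; rewrite normrM ler_wpM2l.
Qed.

Lemma charge_integralDr (nu : {charge set T -> \bar R}) (u v : T -> R) :
  bounded_measurable u -> bounded_measurable v ->
  charge_integral nu (fun x => u x + v x) = charge_integral nu u + charge_integral nu v.
Proof.
move=> bu bv; rewrite /charge_integral.
have ip (w : T -> R) : bounded_measurable w -> (jordan_pos (hahnP nu)).-integrable setT (EFin \o w).
  exact: (bounded_measurable_integrable (finite_measure_lty (jordan_pos (hahnP nu)))).
have im (w : T -> R) : bounded_measurable w -> (jordan_neg (hahnP nu)).-integrable setT (EFin \o w).
  exact: (bounded_measurable_integrable (finite_measure_lty (jordan_neg (hahnP nu)))).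
by rewrite !RintegralD//; [ring|exact: im|exact: im|exact: ip|exact: ip].
Qed.

Lemma charge_integralZr (nu : {charge set T -> \bar R}) (k : R) (u : T -> R) :
  bounded_measurable u ->
  charge_integral nu (fun x => k * u x) = k * charge_integral nu u.
Proof.
move=> bu; rewrite /charge_integral.
have ip := bounded_measurable_integrable (finite_measure_lty (jordan_pos (hahnP nu))) bu.
have im := bounded_measurable_integrable (finite_measure_lty (jordan_neg (hahnP nu))) bu.
by rewrite !RintegralZl// mulrBr.
Qed.

Lemma eq_bounded_measurable (u v : T -> R) : u =1 v -> bounded_measurable u ->
  bounded_measurable v.
Proof. by move=> /funext ->. Qed.

Lemma cbounded_measurableD f h : cbounded_measurable f -> cbounded_measurable h ->
  cbounded_measurable (fun x => f x + h x).
Proof.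
move=> [fr fi] [hr hi]; split.
  by apply: eq_bounded_measurable (bounded_measurableD fr hr) => x; rewrite /= ReD.
by apply: eq_bounded_measurable (bounded_measurableD fi hi) => x; rewrite /= ImD.
Qed.

Lemma cbounded_measurableZ (k : C) f : cbounded_measurable f ->
  cbounded_measurable (fun x => k * f x).
Proof.
move=> [fr fi]; split.
  apply: eq_bounded_measurable (bounded_measurableD (bounded_measurableZ (complex.Re k) fr)
    (bounded_measurableZ (- complex.Im k) fi)) => x.
  by rewrite /= ReM mulNr.
apply: eq_bounded_measurable (bounded_measurableD (bounded_measurableZ (complex.Re k) fi)
    (bounded_measurableZ (complex.Im k) fr)) => x.
by rewrite /= ImM.
Qed.

Lemma cbounded_measurable_cst (k : C) : cbounded_measurable (fun _ : T => k).
Proof.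
have h (r : R) : bounded_measurable (fun _ : T => r).
  by split; [exact: measurable_cst|exists (`|r|)].
by split; exact: h.
Qed.

Lemma cintegralDr mu f h : cbounded_measurable f -> cbounded_measurable h ->
  cintegral mu (fun x => f x + h x) = cintegral mu f + cintegral mu h.
Proof.
move=> [fr fi] [hr hi]; rewrite /cintegral.
rewrite (_ : @complex.Re R \o _ = (fun x => (@complex.Re R \o f) x + (@complex.Re R \o h) x)); last first.
  by apply/funext => x /=; rewrite ReD.
rewrite (_ : @complex.Im R \o (fun x => f x + h x) =
    (fun x => (@complex.Im R \o f) x + (@complex.Im R \o h) x)); last first.
  by apply/funext => x /=; rewrite ImD.
rewrite !charge_integralDr//.
by congr (_ +i* _); rewrite ?opprD addrACA.
Qed.

Lemma cintegralZr mu (k : C) f : cbounded_measurable f ->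
  cintegral mu (fun x => k * f x) = k * cintegral mu f.
Proof.
move=> [fr fi]; rewrite /cintegral.
have br := bounded_measurableZ (complex.Re k) fr.
have bi := bounded_measurableZ (- complex.Im k) fi.
have br' := bounded_measurableZ (complex.Re k) fi.
have bi' := bounded_measurableZ (complex.Im k) fr.
rewrite (_ : @complex.Re R \o _ =
    (fun x => complex.Re k * (@complex.Re R \o f) x + - complex.Im k * (@complex.Im R \o f) x)); last first.
  by apply/funext => x /=; rewrite ReM mulNr.
rewrite (_ : @complex.Im R \o (fun x => k * f x) =
    (fun x => complex.Re k * (@complex.Im R \o f) x + complex.Im k * (@complex.Re R \o f) x)); last first.
  by apply/funext => x /=; rewrite ImM.
rewrite !charge_integralDr// !charge_integralZr//.
case: k {br bi br' bi'} => a b /=.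
move: (charge_integral _ _) (charge_integral _ _) (charge_integral _ _) (charge_integral _ _).
by move=> *; congr (_ +i* _); ring.
Qed.

Lemma cbounded_measurable_sum (I : Type) (s : seq I) (F : I -> T -> C) :
  (forall i, cbounded_measurable (F i)) ->
  cbounded_measurable (fun x => \sum_(i <- s) F i x).
Proof.
move=> bF; elim: s => [|i s IH].
  rewrite (_ : (fun x => _) = (fun=> 0)); first exact: cbounded_measurable_cst.
  by apply/funext => x; rewrite big_nil.
rewrite (_ : (fun x => _) = (fun x => F i x + \sum_(i <- s) F i x)).
  exact: cbounded_measurableD.
by apply/funext => x; rewrite big_cons.
Qed.

Lemma cintegral_sum mu (I : Type) (s : seq I) (F : I -> T -> C) :
  (forall i, cbounded_measurable (F i)) ->
  cintegral mu (fun x => \sum_(i <- s) F i x) = \sum_(i <- s) cintegral mu (F i).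
Proof.
move=> bF; elim: s => [|i s IH].
  rewrite big_nil (_ : (fun x => _) = (fun x => 0 * (0 : C))); last first.
    by apply/funext => x; rewrite big_nil mul0r.
  by rewrite cintegralZr ?mul0r//; exact: cbounded_measurable_cst.
rewrite big_cons -IH -(cintegralDr _ (bF i) (cbounded_measurable_sum s bF)).
by congr cintegral; apply/funext => x; rewrite big_cons.
Qed.

End cintegral_linear.

(** * Expansions at the origin and moments of measures *)

Section power_expansion.
Context {R : realType}.
Local Notation C := R[i].

(** An asymptotic expansion at 0. It determines its coefficients and is easily checked for Cauchy
    transforms and for the kernels, so it identifies the moments of any measure representing a
    kernel. *)
Definition has_expansion (F : C -> C) (a : nat -> C) := forall n, exists K : R,
  forall w, cabs w <= 1 / 2 -> cabs (F w - \sum_(k < n) a k * w ^+ k) <= K * cabs w ^+ n.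

Lemma has_expansion_unique F a b : has_expansion F a -> has_expansion F b -> a =1 b.
Proof.
move=> Fa Fb; elim/ltn_ind => n IH.
have [Ka ha] := Fa n.+1; have [Kb hb] := Fb n.+1.
have K0 : 0 < `|Ka| + `|Kb| + 1 by rewrite ltr_wpDl// addr_ge0.
apply/eqP; rewrite -subr_eq0; apply/eqP/cabs_eq0P => e e0.
pose t := Num.min (1 / 2) (e / (`|Ka| + `|Kb| + 1)).
have t0 : 0 < t by rewrite lt_min !divr_gt0.
have t2 : cabs (t%:C : C) <= 1 / 2 by rewrite cabsR gtr0_norm// ge_min lexx.
have tn0 : 0 < t ^+ n by rewrite exprn_gt0.
rewrite -(ler_pM2r tn0).
have -> : cabs (a n - b n) * t ^+ n = cabs ((F t%:C - \sum_(k < n.+1) b k * t%:C ^+ k) -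
    (F t%:C - \sum_(k < n.+1) a k * t%:C ^+ k)).
  rewrite !big_ord_recr/=.
  have -> : \sum_(k < n) b k * t%:C ^+ k = \sum_(k < n) a k * t%:C ^+ k.
    by apply: eq_bigr => k _; rewrite IH.
  rewrite -[t in t ^+ n](gtr0_norm t0) -(cabsR t) -cabsX -cabsM; congr cabs.
  by move: (F _) (\sum_(k < n) _) => x y; ring.
rewrite (le_trans (ler_cabsD _ _))// cabsN.
rewrite (le_trans (lerD (hb _ t2) (ha _ t2)))// cabsR gtr0_norm//.
rewrite -mulrDl exprS mulrA ler_pM2r//.
rewrite (le_trans (y := (`|Ka| + `|Kb| + 1) * t))//; last first.
  by rewrite mulrC -ler_pdivlMr// ge_min lexx orbT.
rewrite ler_wpM2r ?(ltW t0)// addrC (le_trans (lerD (ler_norm Ka) (ler_norm Kb)))//.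
by rewrite lerDl.
Qed.

Lemma has_expansionB F G a b : has_expansion F a -> has_expansion G b ->
  has_expansion (fun w => F w - G w) (fun k => a k - b k).
Proof.
move=> Fa Gb n; have [Ka ha] := Fa n; have [Kb hb] := Gb n.
exists (Ka + Kb) => w w2.
rewrite (_ : _ - _ = (F w - \sum_(k < n) a k * w ^+ k) - (G w - \sum_(k < n) b k * w ^+ k)).
  by rewrite (le_trans (ler_cabsD _ _))// cabsN mulrDl lerD ?ha ?hb.
under eq_bigr do rewrite mulrBl.
rewrite sumrB; move: (\sum_(k < n) a k * _) (\sum_(k < n) b k * _) (F w) (G w) => *; ring.
Qed.

Lemma eq_has_expansion F G a : (forall w, cabs w <= 1 / 2 -> F w = G w) ->
  has_expansion F a -> has_expansion G a.
Proof. by move=> FG Fa n; have [K hK] := Fa n; exists K => w w2; rewrite -FG ?hK. Qed.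

Implicit Types mu : cmeasure (borel_circle R) R.

Lemma half_disc (w : C) : cabs w <= 1 / 2 -> disc w.
Proof.
by move=> w2; apply/discP; rewrite (le_lt_trans w2)// ltr_pdivrMr// mul1r ltr1n.
Qed.

Lemma cabs_conj_circle (xi : borel_circle R) k : cabs (conjc (circle_val xi) ^+ k) = 1.
Proof. by rewrite cabsX cabs_conj cabs_circle expr1n. Qed.

Lemma conj_circle_bm k :
  cbounded_measurable (fun xi : borel_circle R => conjc (circle_val xi) ^+ k).
Proof.
have cc : continuous ((fun xi => conjc (circle_val xi) ^+ k) : circle R -> C).
  move=> xi; apply: (@continuous_comp (circle R) _ _ (@circle_val R)
    (fun w => conjc w ^+ k)); first exact: circle_val_continuous.
  elim: k => [|k IH].
    rewrite (_ : (fun w => _) = (fun=> 1)); first exact: cst_continuous.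
    by apply/funext => w; rewrite expr0.
  rewrite (_ : (fun w => _) = (fun w => conjc w * conjc w ^+ k)); last first.
    by apply/funext => w; rewrite exprS.
  by apply: (@cvgM _ _ (nbhs (circle_val xi))) IH; exact: conjc_continuous.
split; split.
- apply: continuous_circle_measurable => xi.
  by apply: (@continuous_comp (circle R) _ _ _ (@complex.Re R)); [exact: cc|exact: Re_continuous].
- by exists 1 => xi; rewrite (le_trans (cabs_Re _))// cabs_conj_circle.
- apply: continuous_circle_measurable => xi.
  by apply: (@continuous_comp (circle R) _ _ _ (@complex.Im R)); [exact: cc|exact: Im_continuous].
- by exists 1 => xi; rewrite (le_trans (cabs_Im _))// cabs_conj_circle.
Qed.

Definition moment mu k : C :=
  cintegral mu (fun xi : borel_circle R => conjc (circle_val xi) ^+ k).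

Lemma cauchy_transform_expansion mu : has_expansion (cauchy_transform mu) (moment mu).
Proof.
move=> n; exists (2 * (8 * cmeasure_norm mu)) => w w2.
have Dw := half_disc w2.
have bk := cauchy_kernel_bm Dw.
pose F (k : 'I_n) (xi : borel_circle R) := w ^+ k * conjc (circle_val xi) ^+ k.
have bF k : cbounded_measurable (F k) by exact/cbounded_measurableZ/conj_circle_bm.
have -> : \sum_(k < n) moment mu k * w ^+ k = \sum_(k <- index_enum 'I_n) cintegral mu (F k).
  by apply: eq_bigr => k _; rewrite /F (cintegralZr _ _ (conj_circle_bm k)) [RHS]mulrC.
rewrite -(cintegral_sum _ _ bF).
have bs := cbounded_measurable_sum (index_enum 'I_n) bF.
have -> : cauchy_transform mu w - cintegral mu (fun x => \sum_(i <- index_enum 'I_n) F i x) =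
    cintegral mu (fun x => cauchy_kernel w x + (- 1) * \sum_(i <- index_enum 'I_n) F i x).
  by rewrite (cintegralDr _ bk (cbounded_measurableZ _ bs)) (cintegralZr _ _ bs) mulN1r.
rewrite -mulrA [_ * cabs w ^+ n]mulrC mulrA.
apply: cabs_cintegral_le.
  exact: (cbounded_measurableD bk (cbounded_measurableZ _ bs)).
move=> xi; have x1 : cabs (conjc (circle_val xi) * w) <= 1 / 2.
  by rewrite cabsM cabs_conj cabs_circle mul1r.
have xn1 : conjc (circle_val xi) * w != 1.
  by apply: contraTneq x1 => ->; rewrite cabs1 -ltNge ltr_pdivrMr// mul1r ltr1n.
rewrite /cauchy_kernel (geometric_expansion n xn1).
rewrite (eq_bigr (fun k : 'I_n => F k xi)); last first.
  by move=> k _; rewrite /F exprMn mulrC.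
rewrite mulN1r addrC addKr cabsM cabsX cabsM cabs_conj cabs_circle mul1r mulrC.
rewrite ler_wpM2r ?exprn_ge0 ?cabs_ge0//.
rewrite (le_trans (cabs_cauchy_kernel xi Dw))//.
rewrite -[leRHS]invrK lef_pV2 ?posrE ?invr_gt0 ?disc_cabs//.
by move: w2; lra.
Qed.

(** For every measure representing [k], the sum is the conjugate of the integral of conj p, because
    the moments of the measure are the conj (c j). The factor 8 is that of [cabs_cintegral_le], and
    the infimum over the measures gives the norm. *)
Lemma cauchy_space_pairing (k : cauchy_space R) (c : nat -> C) (p : {poly C}) :
  has_expansion k (fun j => conjc (c j)) -> unit_ball p ->
  cabs (\sum_(j < size p) p`_j * c j) <= 8 * rnorm k.
Proof.
move=> kc pb; rewrite -ler_pdivrMl//; apply: le_cauchy_norm => mu muk.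
rewrite ler_pdivrMl//.
have muc : moment mu =1 (fun j => conjc (c j)).
  apply: has_expansion_unique kc; apply: eq_has_expansion (cauchy_transform_expansion mu).
  by move=> w /half_disc Dw; rewrite muk ?inE.
pose F (j : 'I_(size p)) (xi : borel_circle R) := conjc p`_j * conjc (circle_val xi) ^+ j.
have bF j : cbounded_measurable (F j) by exact/cbounded_measurableZ/conj_circle_bm.
have -> : \sum_(j < size p) p`_j * c j =
    conjc (cintegral mu (fun xi => \sum_(j <- index_enum 'I_(size p)) F j xi)).
  rewrite (cintegral_sum _ _ bF) rmorph_sum; apply: eq_bigr => j _.
  rewrite /F (cintegralZr _ _ (conj_circle_bm j)).
  by rewrite -/(moment mu j) muc rmorphM/= !conjcK.
rewrite cabs_conj -[leRHS]mul1r.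
apply: cabs_cintegral_le; first exact: (cbounded_measurable_sum _ bF).
move=> xi; have -> : \sum_(j <- index_enum 'I_(size p)) F j xi = conjc p.[circle_val xi].
  rewrite horner_coef rmorph_sum; apply: eq_bigr => j _.
  by rewrite /F rmorphM rmorphXn.
by rewrite cabs_conj; apply: pb; rewrite cabs_circle.
Qed.

End power_expansion.

(** * Taylor expansion of the kernels, and from (v) to boundedness and decay *)

Section kernel_compact.
Context {R : realType}.
Local Notation C := R[i].
Variable g : C -> C.
Hypothesis gan : analytic disc g.
Implicit Types (p : {poly C}).

Definition Tmon (j : nat) (z : C) : C := Tp g 'X^j z.

Lemma TpE p z : disc z -> Tp g p z = \sum_(j < size p) p`_j * Tmon j z.
Proof.
move=> Dz; rewrite -{1}(coefK p) poly_def.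
have h (s : seq 'I_(size p)) : Tp g (\sum_(j <- s) p`_j *: 'X^j) z =
    \sum_(j <- s) p`_j * Tmon j z.
  elim: s => [|j s IH]; last by rewrite !big_cons (TpD gan _ _ Dz) (TpZ gan _ _ Dz) IH.
  by rewrite !big_nil -(scale0r (0 : {poly C})) (TpZ gan _ _ Dz) mul0r.
exact: h.
Qed.

(** The geometric series is expanded under the integral, the partial sum being the conjugate of T_g
    q (z). In the error, |w|^n gives the expansion at 0 and |z|^n gives uniform convergence over |w|
    <= 1. *)
Lemma G_H2_partial (L : R) z w n : (forall x, cabs x <= cabs z -> cabs (derive1 g x) <= L) ->
  disc z -> cabs w <= 1 ->
  cabs (G_H2 g z w - \sum_(j < n) conjc (Tmon j z) * w ^+ j) <=
    2 * ((cabs z * cabs w) ^+ n * (1 - cabs z)^-1 * L).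
Proof.
move=> hL Dz w1; have /discP z1 := Dz.
pose q : {poly C} := \sum_(j < n) (conjc w ^+ j) *: 'X^j.
have qE x : q.[x] = \sum_(j < n) (conjc w * x) ^+ j.
  by rewrite /q horner_sum; apply: eq_bigr => j _; rewrite hornerZ hornerXn exprMn.
have -> : \sum_(j < n) conjc (Tmon j z) * w ^+ j = conjc (Tp g q z).
  have h (s : seq 'I_n) : Tp g (\sum_(j <- s) (conjc w ^+ j) *: 'X^j) z =
      \sum_(j <- s) (conjc w ^+ j) * Tmon j z.
    elim: s => [|j s IH]; last by rewrite !big_cons (TpD gan _ _ Dz) (TpZ gan _ _ Dz) IH.
    by rewrite !big_nil -(scale0r (0 : {poly C})) (TpZ gan _ _ Dz) mul0r.
  rewrite /q h rmorph_sum; apply: eq_bigr => j _.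
  transitivity (conjc (conjc w ^+ j * Tmon j z)); last by [].
  have -> : conjc (conjc w ^+ j * Tmon j z) = conjc (conjc w) ^+ j * conjc (Tmon j z).
    by rewrite rmorphM rmorphXn.
  by rewrite conjcK mulrC.
have wx x : cabs (conjc w * x) <= cabs x.
  by rewrite cabsM cabs_conj ler_piMl ?cabs_ge0.
have wx1 x : cabs x < 1 -> 1 - conjc w * x != 0.
  move=> x1; rewrite subr_eq0; apply: contraTneq (wx x) => <-.
  by rewrite cabs1 -ltNge.
have han : analytic disc (fun x => derive1 g x / (1 - conjc w * x)).
  move=> x /discP x1; apply: derivableM; first by apply: analytic_derive1 => //; apply/discP.
  apply: derivableV; first exact: wx1.
  apply: derivableB => //; apply: derivableM => //; exact: derivable_cst.
have qan := analytic_Tg_arg gan (@analytic_horner _ q disc).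
rewrite /G_H2 -rmorphB cabs_conj -(segment_integralB han qan Dz).
apply: (segment_integral_bound (analyticB han qan) Dz) => t /andP[t0 t1].
set x := t%:C * z.
have xz : cabs x <= cabs z.
  by rewrite /x cabsM cabsR ger0_norm// ler_piMl ?cabs_ge0.
have x1 : cabs x < 1 := le_lt_trans xz z1.
have n1 : conjc w * x != 1 by rewrite eq_sym -subr_eq0 wx1.
rewrite [_ / _](_ : _ = derive1 g x * (1 - conjc w * x)^-1)//.
rewrite (geometric_expansion n n1) qE.
have alg (a b c : C) : a * (b + c) - b * a = c * a by ring.
rewrite alg cabsM; apply: ler_pM (cabs_ge0 _) (cabs_ge0 _) _ (hL _ xz).
rewrite cabsM; apply: ler_pM (cabs_ge0 _) (cabs_ge0 _) _ _.
  rewrite cabsX lerXn2r ?nnegrE ?cabs_ge0 ?mulr_ge0 ?cabs_ge0//.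
  by rewrite cabsM cabs_conj mulrC ler_pM ?cabs_ge0.
rewrite cabsV lef_pV2 ?posrE ?subr_gt0//; last by rewrite cabs_gt0 wx1.
have h := ler_cabsB 1 (conjc w * x); rewrite cabs1 in h.
by rewrite (le_trans _ h)// lerB// (le_trans (wx x)).
Qed.

Lemma G_H2_expansion z : disc z -> has_expansion (G_H2 g z) (fun j => conjc (Tmon j z)).
Proof.
move=> Dz n; have /discP z1 := Dz.
have [L L0 hL] := analytic_locally_bounded (analytic_derive1 gan) z1.
exists (2 * ((1 - cabs z)^-1 * L)) => w w2; have /discP/ltW w1 := half_disc w2.
rewrite (le_trans (G_H2_partial n hL Dz w1))// -!mulrA ler_wpM2l// mulrC.
rewrite -mulrA ler_wpM2l ?invr_ge0 ?(ltW (disc_cabs Dz))// ler_wpM2l ?(ltW L0)//.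
by rewrite exprMn ler_piMl ?exprn_ge0 ?cabs_ge0// exprn_ile1 ?cabs_ge0// ltW.
Qed.

Lemma Tp_kernel_le (k : cauchy_space R) z p : disc z -> {in disc, k =1 G_H2 g z} ->
  unit_ball p -> cabs (Tp g p z) <= 8 * rnorm k.
Proof.
move=> Dz kz pb; rewrite TpE//.
apply: (cauchy_space_pairing (k := k) (c := fun j => Tmon j z)) pb.
apply: eq_has_expansion (G_H2_expansion Dz) => w /half_disc Dw.
by rewrite kz ?inE.
Qed.

Lemma Tp_kernel_lipschitz (k k' : cauchy_space R) z z' p : disc z -> disc z' ->
  {in disc, k =1 G_H2 g z} -> {in disc, k' =1 G_H2 g z'} ->
  unit_ball p -> cabs (Tp g p z - Tp g p z') <= 8 * rnorm (k - k').
Proof.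
move=> Dz Dz' kz kz' pb; rewrite !TpE// -sumrB.
rewrite (eq_bigr (fun j : 'I_(size p) => p`_j * (Tmon j z - Tmon j z'))); last first.
  by move=> j _; rewrite mulrBr.
apply: (cauchy_space_pairing (k := k - k') (c := fun j => Tmon j z - Tmon j z')) pb.
have -> : (fun j => conjc (Tmon j z - Tmon j z')) = (fun j => conjc (Tmon j z) - conjc (Tmon j z')).
  by apply/funext => j; rewrite rmorphB.
have h := has_expansionB (G_H2_expansion Dz) (G_H2_expansion Dz').
apply: eq_has_expansion h => w /half_disc Dw.
by rewrite -[RHS]/(k w - k' w) kz ?kz' ?inE.
Qed.

(** If decay failed at points z_n for polynomials p_n, the kernels at the z_n would cluster. By the
    pairing bound the value of T_g (p_n h^n) at z_n is then close to its value at one fixed z_n0,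
    and the latter tends to 0 by [Tp_peak_small]. *)
Lemma kernel_compact_bounded :
  cauchy_relatively_compact [set G_H2 g z | z in disc] -> Tp_bounded g /\ Tp_peak g.
Proof.
move=> [hk [K SK [cK _]]].
have hk' z : exists k : cauchy_space R, disc z -> {in disc, k =1 G_H2 g z}.
  have [Dz|nDz] := pselect (disc z); last by exists 0 => /nDz.
  have [|k hkz] := hk (G_H2 g z); first by exists z.
  by exists k.
have [k kE] := choice hk'.
have kK z : disc z -> K (k z).
  move=> Dz; apply: SK; exists (G_H2 g z); first by exists z.
  exact: kE.
split.
  have [M M0 hM] := compact_rnorm_bounded cK.
  exists (8 * M); first by rewrite mulr_gt0.
  move=> p pb z Dz; rewrite (le_trans (Tp_kernel_le Dz (kE z Dz) pb))//.
  by rewrite ler_wpM2l// hM//; exact: kK.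
move=> xi xi1 e e0; apply: contrapT => /forallNP hn.
have hn' n : exists pz : {poly C} * C, [/\ unit_ball pz.1, disc pz.2 &
    e < cabs (Tp g (pz.1 * peak xi n) pz.2)].
  apply: contrapT => hp; apply: (hn n) => p pb z Dz; rewrite leNgt; apply/negP => h.
  by apply: hp; exists (p, z); split.
have [pz hpz] := choice hn'.
have Dz n : disc (pz n).2 by have [] := hpz n.
have pkb n : unit_ball ((pz n).1 * peak xi n).
  by apply: unit_ballM; [case: (hpz n)|apply: peak_ball; rewrite xi1].
have [h hh] := compact_seq_cluster cK (fun n => kK _ (Dz n)).
(* 17 = 8 * 2 + 1: two kernel distances multiplied by 8, plus the value at the fixed point. *)
have e17 : 0 < e / 17 by rewrite divr_gt0.
have [n0 _ hn0] := hh _ 0%N e17.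
have [N hN] := Tp_peak_small gan (Dz n0) e17.
have [n Nn hn1] := hh _ N e17.
have [pb _] := hpz n; rewrite ltNge => /negP; apply.
rewrite -(subrK (Tp g ((pz n).1 * peak xi n) (pz n0).2) (Tp g _ (pz n).2)).
apply: (@le_trans _ _ (8 * (e / 17 + e / 17) + e / 17)); last first.
  by rewrite le_eqVlt; apply/orP; left; apply/eqP; field.
rewrite (le_trans (ler_cabsD _ _))//; apply: lerD; last exact: (hN n Nn).
apply: le_trans (Tp_kernel_lipschitz (Dz n) (Dz n0) (kE _ (Dz n)) (kE _ (Dz n0)) (pkb n)) _.
rewrite ler_wpM2l//.
rewrite (_ : k (pz n).2 - k (pz n0).2 = (k (pz n).2 - h) - (k (pz n0).2 - h)); last first.
  by rewrite opprB addrA subrK.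
apply: le_trans (ler_rnormD _ _) _; rewrite rnormN.
exact: (lerD (ltW hn1) (ltW hn0)).
Qed.

End kernel_compact.

(** * Measures on the circle *)

Section density.
Local Open Scope ereal_scope.
Context d1 d2 (X : measurableType d1) (Y : measurableType d2) (R : realType).
Variables (mu : {measure set X -> \bar R}) (E : X -> Y) (v : X -> R).
Hypothesis mE : measurable_fun setT E.
Hypothesis mv : measurable_fun setT v.
Hypothesis v0 : forall x, (0 <= v x)%R.

Import HBNNSimple.

Let dens (A : set Y) : \bar R := \int[mu]_(x in E @^-1` A) (v x)%:E.

Let mpre A : measurable A -> measurable (E @^-1` A).
Proof. by move=> mA; rewrite -[X in measurable X]setTI; exact: mE. Qed.

Let mvE D : measurable_fun D (fun x => (v x)%:E).
Proof. by apply: measurable_funTS; exact/measurable_EFinP. Qed.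

Let dens0 : dens set0 = 0.
Proof. by rewrite /dens preimage_set0 integral_set0. Qed.

Let dens_ge0 A : 0 <= dens A.
Proof. by apply: integral_ge0 => x _; rewrite lee_fin. Qed.

Let dens_sigma_additive : semi_sigma_additive dens.
Proof.
move=> F mF tF mUF; rewrite /dens preimage_bigcup ge0_integral_bigcup//=.
- by apply: is_cvg_ereal_nneg_natsum_cond => n _ _; exact: dens_ge0.
- by move=> k; exact: mpre.
- by move=> x _; rewrite lee_fin.
- apply/trivIsetP => /= i j _ _ ij; rewrite -preimage_setI.
  by move/trivIsetP : tF => /(_ _ _ _ _ ij) ->//; rewrite preimage_set0.
Qed.

(** [m] is the image under [E] of the measure of density [v]; the formula passes from indicators to
    simple functions and then to monotone limits. *)
Lemma density_measure : exists m : {measure set Y -> \bar R},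
  forall f : Y -> \bar R, measurable_fun setT f -> (forall y, 0 <= f y) ->
    \int[m]_y f y = \int[mu]_x (f (E x) * (v x)%:E).
Proof.
pose m : {measure set Y -> \bar R} := HB.pack dens
  (isMeasure.Build _ _ _ dens dens0 dens_ge0 dens_sigma_additive).
exists m => f mf f0.
pose f_ := nnsfun_approx measurableT mf.
have mfE n : measurable_fun setT (fun x => (f_ n (E x))%:E).
  by apply/measurable_EFinP; apply: measurableT_comp.
have f_cvg y : (f_ n y)%:E @[n --> \oo] --> f y.
  by apply: cvg_nnsfun_approx => //.
transitivity (limn (fun n => \int[m]_x (f_ n x)%:E)).
  rewrite -monotone_convergence//.
  - by apply: eq_integral => y _; apply/esym/cvg_lim => //; exact: f_cvg.
  - by move=> n; exact/measurable_EFinP/measurable_funP.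
  - by move=> n y _; rewrite lee_fin.
  - by move=> y _ i j ij; rewrite lee_fin; exact/lefP/nd_nnsfun_approx.
rewrite [X in limn X](_ : _ = (fun n => \int[mu]_x ((f_ n (E x))%:E * (v x)%:E))).
  rewrite -monotone_convergence//.
  - apply: eq_integral => x _; apply/cvg_lim => //.
    by apply: cvgeZr => //; exact: f_cvg.
  - by move=> n; apply: emeasurable_funM; [exact: mfE|exact: mvE].
  - by move=> n x _; rewrite mule_ge0 ?lee_fin.
  - move=> x _ i j ij; rewrite lee_wpmul2r ?lee_fin//.
    exact/lefP/nd_nnsfun_approx.
apply/funext => n; rewrite integralT_nnsfun sintegralE.
transitivity (\int[mu]_x (\sum_(k \in range (f_ n))
    (k%:E * ((\1_(E @^-1` (f_ n @^-1` [set k])) x)%:E * (v x)%:E)))); last first.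
  apply: eq_integral => x _.
  rewrite [in RHS]fimfunE -fsumEFin// ge0_mule_fsuml.
    by apply: eq_fsbigr => k _; rewrite EFinM muleA.
  by move=> k; exact: nnfun_muleindic_ge0.
have mind k : measurable_fun setT (fun x => ((\1_(E @^-1` (f_ n @^-1` [set k])) x)%:E : \bar R)).
  by apply/measurable_EFinP/measurable_indic; exact: mpre.
have mk k : measurable_fun setT (fun x => (\1_(E @^-1` (f_ n @^-1` [set k])) x)%:E * (v x)%:E).
  by apply: emeasurable_funM; [exact: mind|exact: mvE].
rewrite ge0_integral_fsum//; first last.
- move=> k x _; rewrite muleA mule_ge0 ?lee_fin//.
  exact: (nnfun_muleindic_ge0 (f_ n) k (E x)).
- by move=> k; apply: emeasurable_funM => //; exact: measurable_cst.
apply: eq_fsbigr => k /[!inE] -[y _ <-].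
have fy0 : 0 <= (f_ n y)%:E by rewrite lee_fin.
have i0 x : [set: X] x -> 0 <= (\1_(E @^-1` (f_ n @^-1` [set f_ n y])) x)%:E * (v x)%:E.
  by move=> _; rewrite mule_ge0 ?lee_fin.
rewrite (ge0_integralZl _ _ (mk _) i0 fy0)//.
congr (_ * _); rewrite -[LHS]/(dens _) /dens integral_mkcond.
apply: eq_integral => x _; rewrite /patch indicE.
by case: ifPn => _; rewrite ?mul1e ?mul0e.
Qed.

Lemma density_measure_integral : exists m : {measure set Y -> \bar R},
  forall f : Y -> \bar R, measurable_fun setT f ->
    \int[m]_y f y = \int[mu]_x (f (E x) * (v x)%:E).
Proof.
have [m hm] := density_measure; exists m => f mf.
rewrite integralE [RHS]integralE !hm; first last.
- by move=> y; exact: funepos_ge0.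
- exact: measurable_funepos.
- by move=> y; exact: funeneg_ge0.
- exact: measurable_funeneg.
congr (_ - _); apply: eq_integral => x _.
  by rewrite !funeposE maxe_pMl ?lee_fin ?mul0e.
by rewrite !funenegE -mulNe maxe_pMl ?lee_fin ?mul0e.
Qed.

End density.

Section total_variation_bound.
Context d {T : measurableType d} {R : realType}.
Local Notation C := R[i].

(** Over a partition the bounds add up to m(T), by countable additivity of [m]. *)
Lemma cmeasure_norm_le (mu : cmeasure T R) (m : {measure set T -> \bar R}) :
  (m setT < +oo)%E ->
  (forall A, measurable A -> ((cabs (mu A))%:E <= m A)%E) ->
  cmeasure_norm mu <= fine (m setT).
Proof.
move=> moo hm; rewrite -lee_fin -total_variationE fineK; last first.
  by rewrite ge0_fin_numE.
apply: ge_ereal_sup => _ [F [mF tF UF] <-].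
rewrite -UF measure_bigcup//.
rewrite [leRHS](eq_eseriesl (Q := xpredT)); last by move=> n; exact: in_setT.
apply: lee_nneseries => [n _ _|n _]; first by rewrite lee_fin cabs_ge0.
by apply: hm; exact: mF.
Qed.

Lemma finite_measure_fin (m : {measure set T -> \bar R}) : (m setT < +oo)%E ->
  exists m' : {finite_measure set T -> \bar R}, forall A, m' A = m A.
Proof.
move=> moo; exists (mfrestr measurableT moo) => A.
by rewrite -[in RHS](setIT A).
Qed.

Definition cmeasure_of (p1 n1 p2 n2 : {finite_measure set T -> \bar R}) : cmeasure T R :=
  CMeasure (cadd (charge_of_finite_measure p1) (cscale (-1) (charge_of_finite_measure n1)))
           (cadd (charge_of_finite_measure p2) (cscale (-1) (charge_of_finite_measure n2))).

Lemma cintegral_cmeasure_of p1 n1 p2 n2 (f : T -> C) : cbounded_measurable f ->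
  cintegral (cmeasure_of p1 n1 p2 n2) f =
  ((\int[p1]_x complex.Re (f x) - \int[n1]_x complex.Re (f x))
   - (\int[p2]_x complex.Im (f x) - \int[n2]_x complex.Im (f x)))%R +i*
  ((\int[p1]_x complex.Im (f x) - \int[n1]_x complex.Im (f x))
   + (\int[p2]_x complex.Re (f x) - \int[n2]_x complex.Re (f x)))%R.
Proof.
move=> [fr fi].
have h (p n : {finite_measure set T -> \bar R}) (u : T -> R) : bounded_measurable u ->
    charge_integral (cadd (charge_of_finite_measure p) (cscale (-1) (charge_of_finite_measure n))) u =
    (\int[p]_x u x - \int[n]_x u x)%R.
  move=> bu; apply: charge_integralE => //; [exact: finite_measure_lty|exact: finite_measure_lty|].
  by move=> A mA; congr (_ + _)%E; exact: mulN1e.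
by rewrite /cintegral /= !h.
Qed.

Lemma cmeasure_of_norm_le (p1 n1 p2 n2 : {finite_measure set T -> \bar R}) (B : R) :
  (p1 setT <= B%:E)%E -> (n1 setT <= B%:E)%E -> (p2 setT <= B%:E)%E -> (n2 setT <= B%:E)%E ->
  cmeasure_norm (cmeasure_of p1 n1 p2 n2) <= 4 * B.
Proof.
move=> hp1 hn1 hp2 hn2.
pose m : {measure set T -> \bar R} := measure_add (measure_add p1 n1) (measure_add p2 n2).
have mE A : m A = (p1 A + n1 A + (p2 A + n2 A))%E.
  transitivity (measure_add p1 n1 A + measure_add p2 n2 A)%E; first exact: measure_addE.
  by congr (_ + _)%E; exact: measure_addE.
have mB : (m setT <= (4 * B)%:E)%E.
  rewrite mE (_ : 4 * B = B + B + (B + B))%R; last by ring.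
  by rewrite !EFinD !leeD.
have moo : (m setT < +oo)%E by rewrite (le_lt_trans mB)// ltry.
rewrite (le_trans (cmeasure_norm_le moo _))//; last first.
  by rewrite -lee_fin fineK// ge0_fin_numE.
move=> A mA; rewrite mE.
have fp (p : {finite_measure set T -> \bar R}) : p A = (fine (p A))%:E.
  by rewrite fineK// fin_num_measure.
have f0 (p : {finite_measure set T -> \bar R}) : 0 <= fine (p A) by rewrite fine_ge0.
rewrite (fp p1) (fp n1) (fp p2) (fp n2) -!EFinD lee_fin.
rewrite (le_trans (cabs_ReIm _))//=.
have fE (p n : {finite_measure set T -> \bar R}) :
    fine (cadd (charge_of_finite_measure p) (cscale (-1) (charge_of_finite_measure n)) A) =
    (fine (p A) - fine (n A))%R.
  rewrite /cadd/= /cscale/= /charge_of_finite_measure (fp p) (fp n).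
  by rewrite -EFinM -EFinD /= mulN1r.
by rewrite !fE lerD// (le_trans (ler_normB _ _))// !ger0_norm.
Qed.

End total_variation_bound.

Section circle_density.
Context {R : realType}.
Local Notation C := R[i].
Local Notation lambda := (@lebesgue_measure R).

Lemma expi_circle_subproof (t : R) : expi t \in [set z : C | `|z| = 1].
Proof. by apply/mem_set; rewrite /= normcE cabs_expi. Qed.

Definition circle_point (t : R) : borel_circle R := exist _ (expi t) (expi_circle_subproof t).

Lemma circle_pointE t : circle_val (circle_point t) = expi t.
Proof. by []. Qed.

Lemma circle_point_measurable : measurable_fun setT circle_point.
Proof.
have cc : continuous (circle_point : R -> circle R).
  apply: continuous_comp_initial => t.
  have tt : t <= t <= t by rewrite lexx.
  exact: (@expi_cont R t t t tt).
apply: (@measurability _ _ _ _ setT circle_point (@open (circle R))) => //.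
move=> _ [U oU <-]; rewrite setTI; apply: open_measurable.
by move/continuousP : cc; apply.
Qed.

Lemma circle_density_measure (u : R -> R) : continuous u -> (forall t, 0 <= u t) ->
  exists m : {finite_measure set (borel_circle R) -> \bar R},
    (forall F : borel_circle R -> C, cbounded_measurable F ->
       (\int[m]_x complex.Re (F x)) +i* (\int[m]_x complex.Im (F x)) =
       cint 0 1 (fun t => (u t)%:C * F (circle_point t))) /\
    m setT = (\int[lambda]_(t in `[0, 1]) u t)%:E.
Proof.
(* The density is cut off outside [0, 1], so that the circle is covered once by the image of
   Lebesgue measure on the line. *)
move=> cu u0; pose v := u \_ `[0%R, 1%R]%classic.
have mu : measurable_fun setT u by exact: continuous_measurable_fun.
have mv : measurable_fun setT v.
  apply/(measurable_restrictT u (measurable_itv `[0%R, 1%R])); exact: measurable_funTS.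
have v0 t : 0 <= v t by rewrite /v /patch; case: ifP.
have [m hm] := density_measure_integral lambda circle_point_measurable mv v0.
have hmE (f : borel_circle R -> R) : measurable_fun setT f ->
    (\int[m]_y (f y)%:E = \int[lambda]_(t in `[0%R, 1%R]) (f (circle_point t) * u t)%:E)%E.
  move=> mf; rewrite hm; last exact/measurable_EFinP.
  rewrite [RHS]integral_mkcond; apply: eq_integral => t _.
  by rewrite /v /patch; case: ifP => _; rewrite -EFinM ?mulr0.
have iu : lambda.-integrable `[0%R, 1%R] (EFin \o u).
  apply: continuous_compact_integrable; first exact: segment_compact.
  exact: continuous_subspaceT.
have mT : m setT = (\int[lambda]_(t in `[0, 1]) u t)%:E.
  rewrite -[LHS]mul1e -(integral_cst m measurableT).
  rewrite (hmE (fun=> 1)); last exact: measurable_cst.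
  rewrite /Rintegral fineK; last exact: (integrable_fin_num _ iu).
  by apply: eq_integral => t _; rewrite mul1r.
have moo : (m setT < +oo)%E by rewrite mT ltry.
have [m' m'E] := finite_measure_fin moo.
exists m'; split; last by rewrite m'E.
have mm' (f : borel_circle R -> R) : measurable_fun setT f ->
    \int[m']_x f x = \int[lambda]_(t in `[0, 1]) (f (circle_point t) * u t).
  move=> mf; rewrite /Rintegral -hmE//; congr fine.
  by apply: eq_measure_integral => A _ _; exact: m'E.
move=> F [[mr _] [mi _]]; rewrite !mm'//; congr (_ +i* _); apply: eq_Rintegral => t _.
  by rewrite ReM /= mul0r subr0 mulrC.
by rewrite ImM /= mul0r addr0 mulrC.
Qed.

(** The positive part, in a form whose continuity and bound by the modulus are immediate. *)
Definition rpos (x : R) := (`|x| + x) / 2.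

Lemma rpos_ge0 x : 0 <= rpos x.
Proof. by rewrite divr_ge0// -lerBlDr sub0r ler_normr lexx orbT. Qed.

Lemma rpos_le x : rpos x <= `|x|.
Proof. by rewrite /rpos ler_pdivrMr// mulrDr mulr1 lerD2l ler_norm. Qed.

Lemma rposB x : rpos x - rpos (- x) = x.
Proof. by rewrite /rpos normrN; field. Qed.

Lemma rpos_continuous (u : R -> R) : continuous u -> continuous (rpos \o u).
Proof.
move=> cu t; apply: cvgM; last exact: cvg_cst.
by apply: cvgD; [apply: cvg_norm; exact: cu|exact: cu].
Qed.

(** The measure is the image of h(t) dt under [circle_point], assembled from the positive and
    negative parts of Re h and Im h. Each has mass at most the integral of |h|, hence the factor
    4. *)
Lemma circle_density (h : R -> C) : continuous h ->
  exists mu : cmeasure (borel_circle R) R,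
    (forall w, disc w -> cauchy_transform mu w = cauchy_int 1 h w) /\
    cmeasure_norm mu <= 4 * \int[lambda]_(t in `[0, 1]) cabs (h t).
Proof.
move=> ch.
have cre : continuous (fun t => complex.Re (h t)) by move=> t; exact: (@continuous_Re R h t (ch t)).
have cim : continuous (fun t => complex.Im (h t)) by move=> t; exact: (@continuous_Im R h t (ch t)).
have cN (u : R -> R) : continuous u -> continuous (fun t => - u t).
  by move=> cu t; apply: cvgN; exact: cu.
have parts (u : R -> R) : continuous u -> (forall t, `|u t| <= cabs (h t)) ->
    exists2 m : {finite_measure set (borel_circle R) -> \bar R},
    (forall F : borel_circle R -> C, cbounded_measurable F ->
       (\int[m]_x complex.Re (F x)) +i* (\int[m]_x complex.Im (F x)) =
       cint 0 1 (fun t => (rpos (u t))%:C * F (circle_point t))) &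
    (m setT <= (\int[lambda]_(t in `[0, 1]) cabs (h t))%:E)%E.
  move=> cu uh.
  have [m [mF mT]] := circle_density_measure (rpos_continuous cu) (fun t => rpos_ge0 (u t)).
  exists m => //; rewrite mT lee_fin.
  have ci (f : R -> R) : continuous f -> lambda.-integrable `[0%R, 1%R] (EFin \o f).
    move=> cf; apply: continuous_compact_integrable; first exact: segment_compact.
    exact: continuous_subspaceT.
  apply: le_Rintegral => //.
  - exact/ci/rpos_continuous.
  - by apply: ci => t; apply: (continuous_comp (ch t)); exact: cabs_continuous.
  - by move=> t _; exact: le_trans (rpos_le _) (uh t).
have reh t : `|complex.Re (h t)| <= cabs (h t) by exact: cabs_Re.
have imh t : `|complex.Im (h t)| <= cabs (h t) by exact: cabs_Im.
have reNh t : `|- complex.Re (h t)| <= cabs (h t) by rewrite normrN; exact: cabs_Re.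
have imNh t : `|- complex.Im (h t)| <= cabs (h t) by rewrite normrN; exact: cabs_Im.
have [p1 p1F p1T] := parts _ cre reh.
have [n1 n1F n1T] := parts _ (cN _ cre) reNh.
have [p2 p2F p2T] := parts _ cim imh.
have [n2 n2F n2T] := parts _ (cN _ cim) imNh.
exists (cmeasure_of p1 n1 p2 n2); split; last exact: cmeasure_of_norm_le.
move=> w Dw; have bk := cauchy_kernel_bm Dw.
rewrite /cauchy_transform cintegral_cmeasure_of//.
have alg (a a' b b' c c' e e' : R) : (a - b - (c' - e')) +i* (a' - b' + (c - e)) =
    (a +i* a') - (b +i* b') + 'i * ((c +i* c') - (e +i* e')) by congr (_ +i* _); ring.
rewrite alg (p1F _ bk) (n1F _ bk) (p2F _ bk) (n2F _ bk).
have w1 : cabs w < 1 by exact/discP.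
have ck := circle_kernel_cont (a := 0) (b := 1) w1.
have kE t : cauchy_kernel w (circle_point t) = circle_kernel 1 w t.
  by rewrite /cauchy_kernel circle_pointE /circle_kernel divr1 mulrC.
have cp (u : R -> R) : continuous u ->
    cont_on 0 1 (fun t => (rpos (u t))%:C * cauchy_kernel w (circle_point t)).
  move=> cu; rewrite (_ : (fun t => _) = (fun t => (rpos (u t))%:C * circle_kernel 1 w t)); last first.
    by apply/funext => t; rewrite kE.
  apply: (cont_onM _ ck); apply: cont_onR => t _; exact: rpos_continuous.
rewrite -(cintB (cp _ cre) (cp _ (cN _ cre))) -(cintB (cp _ cim) (cp _ (cN _ cim))).
have c1' := cont_onB (cp _ cre) (cp _ (cN _ cre)).
have c2' := cont_onB (cp _ cim) (cp _ (cN _ cim)).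
rewrite -(cintZ _ c2') -(cintD c1' (cont_onM (cont_on_cst _) c2')).
rewrite /cauchy_int; apply: eq_cint => t _; rewrite kE.
rewrite -!mulrBl mulrA -mulrDl; congr (_ * _).
by rewrite -!rmorphB/= !rposB -complex.complexE.
Qed.

End circle_density.

(** * Fourier coefficients and the Cauchy integral on the unit circle *)

Section circle_moments.
Context {R : realType}.
Local Notation C := R[i].
Implicit Types (w : C) (p q : {poly C}).

Lemma expi_conj_cont a b : cont_on 0 1 (fun t : R => expi t ^+ a * conjc (expi t) ^+ b).
Proof.
exact: (cont_onM (cont_onX (@expi_cont R 0 1)) (cont_onX (cont_on_conj (@expi_cont R 0 1)))).
Qed.

Lemma cint_expi_conj a b :
  cint 0 1 (fun t : R => expi t ^+ a * conjc (expi t) ^+ b) = (a == b)%:R :> C.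
Proof.
have cancel t : expi t * conjc (expi t) = 1 :> C.
  by rewrite conj_expi divff// expi_neq0.
have [ba|ab] := leqP b a.
  rewrite (eq_cint (psi := fun t => expi t ^+ (a - b))).
    by rewrite cint_expiX subn_eq0 eqn_leq ba andbT.
  by move=> t _; rewrite -{1}(subnK ba) exprD -mulrA -exprMn cancel expr1n mulr1.
rewrite (eq_cint (psi := fun t => conjc (expi t) ^+ (b - a))).
  by rewrite cint_conj_expiX subn_eq0 leqNgt ab eqn_leq [(b <= a)%N]leqNgt ab andbF.
by move=> t _; rewrite -{1}(subnK (ltnW ab)) exprD mulrCA -exprMn cancel expr1n mulr1.
Qed.

(** By orthogonality the only possible nonzero Taylor coefficient has index a - b. Negative
    frequencies are thus removed: the Cauchy integral extracts the analytic part of a trigonometric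
    polynomial. *)
Lemma cauchy_int_expi_conj a b w : cabs w < 1 ->
  cauchy_int 1 (fun t => expi t ^+ a * conjc (expi t) ^+ b) w =
  if (b <= a)%N then w ^+ (a - b) else 0.
Proof.
move=> w1; apply/eqP; rewrite -subr_eq0; apply/eqP/cabs_eq0P => e e0.
have w10 : 0 < 1 - cabs w by rewrite subr_gt0.
have [N hN] := expr_small (cabs_ge0 w) w1 (mulr_gt0 (divr_gt0 e0 (ltr0Sn R 1)) w10).
pose n := maxn N (a - b).+1.
have h1 (t : R) : 0 <= t <= 1 -> cabs (expi t ^+ a * conjc (expi t) ^+ b) <= 1.
  by move=> _; rewrite cabsM !cabsX cabs_conj cabs_expi !expr1n mulr1.
have := cauchy_int_taylor n (@expi_conj_cont a b) h1 w1.
rewrite divr1 mulr1.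
have -> : \sum_(k < n) taylor_coef 1 (fun t => expi t ^+ a * conjc (expi t) ^+ b) k * w ^+ k =
    if (b <= a)%N then w ^+ (a - b) else 0.
  have tE k : taylor_coef 1 (fun t : R => expi t ^+ a * conjc (expi t) ^+ b) k = (a == (b + k)%N)%:R.
    rewrite -(cint_expi_conj a (b + k)); apply: eq_cint => t _.
    by rewrite divr1 -mulrA -exprD.
  have [ba|ab] := leqP b a.
    have an : (a - b < n)%N by rewrite leq_max leqnn orbT.
    rewrite (bigD1 (Ordinal an))//= tE subnKC// eqxx mul1r big1 ?addr0//.
    move=> k kn; rewrite tE; case: eqP => [abk|]; last by rewrite mul0r.
    by move: kn; rewrite -val_eqE/= abk addKn eqxx.
  rewrite big1// => k _; rewrite tE; case: eqP => [abk|]; last by rewrite mul0r.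
  by move: ab; rewrite abk ltnNge leq_addr.
move=> /le_trans; apply; rewrite ler_pdivrMr//.
have := hN n (leq_maxl _ _); rewrite -(ler_pM2l (ltr0Sn R 1)) => /le_trans; apply.
by rewrite mulrA mulrCA divff ?mulr1// pnatr_eq0.
Qed.

Lemma cauchy_int_sum (I : Type) (s : seq I) (F : I -> R -> C) w : cabs w < 1 ->
  (forall i, cont_on 0 1 (F i)) ->
  cauchy_int 1 (fun t => \sum_(i <- s) F i t) w = \sum_(i <- s) cauchy_int 1 (F i) w.
Proof.
move=> w1 cF; have ck := circle_kernel_cont (a := 0) (b := 1) w1.
rewrite /cauchy_int -(cint_sum _ (fun i => cont_onM (cF i) ck)).
by apply: eq_cint => t _; rewrite mulr_suml.
Qed.

Lemma cauchy_intZ k (F : R -> C) w : cabs w < 1 -> cont_on 0 1 F ->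
  cauchy_int 1 (fun t => k * F t) w = k * cauchy_int 1 F w.
Proof.
move=> w1 cF; have ck := circle_kernel_cont (a := 0) (b := 1) w1.
rewrite /cauchy_int -(cintZ _ (cont_onM cF ck)).
by apply: eq_cint => t _; rewrite mulrA.
Qed.

Lemma cauchy_intD (F G : R -> C) w : cabs w < 1 -> cont_on 0 1 F -> cont_on 0 1 G ->
  cauchy_int 1 (fun t => F t + G t) w = cauchy_int 1 F w + cauchy_int 1 G w.
Proof.
move=> w1 cF cG; have ck := circle_kernel_cont (a := 0) (b := 1) w1.
rewrite /cauchy_int -(cintD (cont_onM cF ck) (cont_onM cG ck)).
by apply: eq_cint => t _; rewrite mulrDl.
Qed.

Lemma cauchy_int_bound (F : R -> C) (M : R) w : cabs w < 1 -> cont_on 0 1 F ->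
  (forall t, 0 <= t <= 1 -> cabs (F t) <= M) ->
  cabs (cauchy_int 1 F w) <= 2 * (M / (1 - cabs w)).
Proof.
move=> w1 cF hM; have ck := circle_kernel_cont (a := 0) (b := 1) w1.
rewrite -[leRHS]mulr1 -[X in _ <= _ * X](subr0 1).
apply: (cint_bound ler01 (cont_onM cF ck)) => t t01.
rewrite cabsM ler_pM ?cabs_ge0 ?hM//.
by rewrite -[cabs w]divr1; exact: cabs_circle_kernel.
Qed.

Lemma cauchy_int_horner p w : cabs w < 1 ->
  cauchy_int 1 (fun t => p.[expi t]) w = p.[w].
Proof.
move=> w1; have cX k : cont_on 0 1 (fun t : R => expi t ^+ k : C).
  exact: (cont_onX (@expi_cont R 0 1)).
transitivity (cauchy_int 1 (fun t => \sum_(k <- index_enum 'I_(size p)) p`_k * expi t ^+ k) w).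
  by apply: eq_cint => t _; rewrite horner_coef.
rewrite (cauchy_int_sum _ w1 (fun k : 'I_(size p) => cont_onM (cont_on_cst p`_k) (cX k))).
rewrite horner_coef; apply: eq_bigr => k _; rewrite (cauchy_intZ _ w1 (cX k)).
congr (_ * _); transitivity (cauchy_int 1 (fun t => expi t ^+ k * conjc (expi t) ^+ 0) w).
  by apply: eq_cint => t _; rewrite expr0 mulr1.
by rewrite cauchy_int_expi_conj// subn0.
Qed.

(* Applying the crude Cauchy bound to the powers of p removes the constant. *)
Lemma unit_circle_ball p : (forall t : R, cabs p.[expi t] <= 1) ->
  forall w, cabs w < 1 -> cabs p.[w] <= 1.
Proof.
move=> p1 w w1; rewrite leNgt; apply/negP => pw.
have w10 : 0 < 1 - cabs w by rewrite subr_gt0.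
have pw0 : 0 < cabs p.[w] by rewrite (lt_trans ltr01).
have hn n : cabs p.[w] ^+ n <= 2 * (1 / (1 - cabs w)).
  rewrite -cabsX -horner_exp -(cauchy_int_horner _ w1).
  apply: (cauchy_int_bound w1) => [|t _].
    by move=> t _; apply: (@continuous_comp _ _ _ (@expi R) (fun x => (p ^+ n).[x]));
      [exact: (@expi_cont R t t t ltac:(by rewrite lexx))|exact: horner_continuous].
  by rewrite horner_exp cabsX exprn_ile1// cabs_ge0.
have pV0 : 0 <= (cabs p.[w])^-1 by rewrite invr_ge0 ltW.
have pV1 : (cabs p.[w])^-1 < 1 by rewrite invf_lt1.
have [N /(_ N (leqnn N))] := expr_small pV0 pV1 (divr_gt0 w10 (ltr0Sn R 2)).
rewrite exprVn -[leRHS]invrK lef_pV2 ?posrE ?exprn_gt0 ?invr_gt0 ?divr_gt0//.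
rewrite invf_div => /le_trans /(_ (hn N)).
by rewrite mul1r ler_pM2r ?invr_gt0// ler_nat.
Qed.

Lemma circle_ball p : (forall x, cabs x = 1 -> cabs p.[x] <= 1) -> unit_ball p.
Proof.
move=> p1 w; rewrite le_eqVlt => /orP[/eqP/p1//|].
by apply: unit_circle_ball => t; rewrite p1 ?cabs_expi.
Qed.

End circle_moments.

(** * Representing measures *)

Section moment_hull.
Context {R : realType}.
Local Notation C := R[i].
Implicit Types (u v c : nat -> C) (M : R).

(* Moment sequences of the finitely supported measures on the circle of total
   mass at most M. *)
Definition moment_hull M v := exists s : seq (C * C),
  [/\ forall x, x \in s -> cabs x.2 = 1, \sum_(x <- s) cabs x.1 <= M &
      forall k, v k = \sum_(x <- s) x.1 * x.2 ^+ k].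

Lemma moment_hull_atom M a xi : cabs a <= M -> cabs xi = 1 ->
  moment_hull M (fun k => a * xi ^+ k).
Proof.
move=> aM xi1; exists [:: (a, xi)]; split=> [x|| k]; rewrite ?big_seq1//.
by rewrite inE => /eqP ->.
Qed.

(** The two lists of atoms are concatenated with weights t and 1 - t. *)
Lemma moment_hull_convex M u v (t : R) : 0 <= t <= 1 -> moment_hull M u -> moment_hull M v ->
  moment_hull M (fun k => v k + t%:C * (u k - v k)).
Proof.
move=> /andP[t0 t1] [s [s1 sM su]] [s' [s1' sM' sv]].
exists ([seq (t%:C * x.1, x.2) | x <- s] ++ [seq ((1 - t)%:C * x.1, x.2) | x <- s']); split.
- by move=> x; rewrite mem_cat => /orP[] /mapP[y ys ->]/=; [exact: s1|exact: s1'].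
- rewrite big_cat/= !big_map/=.
  under eq_bigr do rewrite cabsM cabsR ger0_norm//.
  under [X in _ + X]eq_bigr do rewrite cabsM cabsR ger0_norm ?subr_ge0//.
  have -> : M = t * M + (1 - t) * M by ring.
  by rewrite -!mulr_sumr lerD// ler_wpM2l// subr_ge0.
move=> k; rewrite big_cat/= !big_map/= su sv.
under [X in _ = X + _]eq_bigr do rewrite -mulrA.
under [X in _ = _ + X]eq_bigr do rewrite -mulrA.
rewrite -!mulr_sumr rmorphB/=.
move: (\sum_(x <- s) _) (\sum_(x <- s') _) => A B; ring.
Qed.

Lemma moment_hull_le M v k : moment_hull M v -> cabs (v k) <= M.
Proof.
move=> [s [s1 sM ->]]; apply: le_trans sM.
rewrite (le_trans (cabs_sum _ _ _))// big_seq [leRHS]big_seq ler_sum// => x xs.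
by rewrite cabsM cabsX s1// expr1n mulr1.
Qed.

Lemma cabs_sqr (z : C) : cabs z ^+ 2 = complex.Re z ^+ 2 + complex.Im z ^+ 2.
Proof. by case: z => a b; rewrite /cabs normc_def/= sqr_sqrtr// addr_ge0 ?sqr_ge0. Qed.

Lemma cabs_sqrB_scale (r x : C) (t : R) : cabs (r - t%:C * x) ^+ 2 =
  cabs r ^+ 2 - 2 * t * complex.Re (x * conjc r) + t ^+ 2 * cabs x ^+ 2.
Proof.
by rewrite !cabs_sqr ReM; case: r x => [r1 r2] [x1 x2] /=; rewrite !(mul0r, subr0, addr0); ring.
Qed.

Lemma Re_mul_phase (z : C) : exists2 a : C, cabs a = 1 & complex.Re (a * z) = cabs z.
Proof.
have [->|z0] := eqVneq z 0; first by exists 1; rewrite ?cabs1// mulr0 cabs0.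
have nz : cabs z != 0 by rewrite gt_eqF// cabs_gt0.
exists (conjc z / (cabs z)%:C).
  by rewrite cabs_div cabs_conj cabsR ger0_norm ?cabs_ge0// divff.
apply: (mulfI nz); rewrite -expr2 cabs_sqr.
have -> : conjc z / (cabs z)%:C = ((cabs z)^-1)%:C * conjc z.
  by rewrite mulrC -fmorphV.
move: (cabs z) nz => n nz; case: z {z0} => a b /=.
by field.
Qed.

(* A near-minimizer v of the Euclidean distance from c to the convex set of
   moment sequences has a residual c - v that is almost normal to that set at
   v; the conjugate residual is the separating polynomial. *)
Lemma moment_hull_approx n M c (eta : R) : 0 < M -> 0 < eta ->
  (forall q : {poly C}, unit_ball q -> (size q <= n.+1)%N ->
     cabs (\sum_(k < n.+1) q`_k * c k) <= M) ->
  exists2 v, moment_hull M v & forall k, (k <= n)%N -> cabs (c k - v k) <= eta.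
Proof.
move=> M0 eta0 hc; apply: contrapT => nv.
pose D v := \sum_(k < n.+1) cabs (c k - v k) ^+ 2.
have eta20 : 0 < eta ^+ 2 by rewrite exprn_gt0.
have Dlb v : moment_hull M v -> eta ^+ 2 <= D v.
  move=> Kv; rewrite leNgt; apply/negP => Dv; apply: nv; exists v => // k kn.
  rewrite leNgt; apply/negP => ek; move: Dv; rewrite ltNge => /negP; apply.
  rewrite /D (bigD1 (Ordinal (kn : (k < n.+1)%N)))//= -[leLHS]addr0 lerD//.
    by rewrite lerXn2r ?nnegrE ?(ltW eta0) ?cabs_ge0 ?(ltW ek).
  by apply: sumr_ge0 => j _; rewrite sqr_ge0.
pose S := [set D v | v in moment_hull M].
have S0 : S !=set0.
  exists (D (fun k => 0 * 1 ^+ k)), (fun k => 0 * 1 ^+ k) => //.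
  by apply: moment_hull_atom; rewrite ?cabs0 ?cabs1 ?ltW.
have Slb : has_lbound S by exists 0 => _ [v _ <-]; apply: sumr_ge0 => k _; rewrite sqr_ge0.
(* Moments are bounded by M, so two moment sequences are at squared distance at most [L]. *)
pose L := n.+1%:R * (2 * M) ^+ 2.
have L0 : 0 < L by rewrite mulr_gt0 ?exprn_gt0 ?mulr_gt0.
pose delta := eta ^+ 2 / 4.
have delta0 : 0 < delta by rewrite divr_gt0.
(* A step of length [t] towards u has second-order term at most t delta. As D v is within t delta of
   the infimum, the inner product of u - v with the residual is at most delta. *)
pose t := Num.min 1 (delta / L).
have t0 : 0 < t by rewrite lt_min ltr01 divr_gt0.
have t1 : t <= 1 by rewrite ge_min lexx.
have tL : t * L <= delta by rewrite -ler_pdivlMr// ge_min lexx orbT.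
have [_ [v Kv <-]] := inf_adherent (mulr_gt0 t0 delta0) (conj S0 Slb).
move=> Dv.
pose r k := c k - v k.
pose q : {poly C} := \poly_(k < n.+1) conjc (r k).
have qE k : (k < n.+1)%N -> q`_k = conjc (r k) by move=> kn; rewrite coef_poly kn.
pose ip u := \sum_(k < n.+1) complex.Re (u k * conjc (r k)).
have ipE u : ip u = complex.Re (\sum_(k < n.+1) q`_k * u k).
  by rewrite Re_sum; apply: eq_bigr => k _; rewrite qE// mulrC.
have almost_normal u : moment_hull M u -> ip u <= ip v + delta.
  move=> Ku.
  have Kw := moment_hull_convex (introT andP (conj (ltW t0) t1)) Ku Kv.
  have : inf S <= D (fun k => v k + t%:C * (u k - v k)) by apply: ge_inf => //; eexists; first exact: Kw.
  have -> : D (fun k => v k + t%:C * (u k - v k)) =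
      D v - 2 * t * (ip u - ip v) + t ^+ 2 * \sum_(k < n.+1) cabs (u k - v k) ^+ 2.
    rewrite /D /ip -sumrB !mulr_sumr -sumrB -big_split/=; apply: eq_bigr => k _.
    rewrite opprD addrA cabs_sqrB_scale; congr (_ - _ * _ + _).
    by rewrite mulrBl ReD; congr (_ + _); case: (v k * _).
  have hL : \sum_(k < n.+1) cabs (u k - v k) ^+ 2 <= L.
    have -> : L = \sum_(k < n.+1) (2 * M) ^+ 2.
      by rewrite sumr_const card_ord -[RHS]mulr_natl.
    apply: ler_sum => k _; rewrite lerXn2r ?nnegrE ?cabs_ge0 ?mulr_ge0 ?(ltW M0)//.
    rewrite (le_trans (ler_cabsD _ _))// cabsN mulr2n mulrDl !mul1r.
    by rewrite lerD// moment_hull_le.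
  have h2 : t ^+ 2 * \sum_(k < n.+1) cabs (u k - v k) ^+ 2 <= t * delta.
    rewrite expr2 -mulrA ler_wpM2l ?(ltW t0)// (le_trans _ tL)// ler_wpM2l ?(ltW t0)//.
  move: h2; move: (t ^+ 2 * _) => B h2 h3.
  have : 2 * t * (ip u - ip v) < 2 * t * delta by move: (ip u) (ip v) Dv h2 h3 => *; lra.
  by rewrite ltr_pM2l ?mulr_gt0// ltrBlDl => /ltW.
(* The near-normality is tested on one atom of mass M at [xi], with a phase that makes its product
   with q(xi) positive. *)
have q_le xi : cabs xi = 1 -> M * cabs q.[xi] <= ip v + delta.
  move=> xi1; have [a a1 aq] := Re_mul_phase q.[xi].
  have Ka : moment_hull M (fun k => (M%:C * a) * xi ^+ k).
    by apply: moment_hull_atom => //; rewrite cabsM a1 mulr1 cabsR gtr0_norm.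
  have := almost_normal _ Ka; rewrite ipE.
  have -> : \sum_(k < n.+1) q`_k * (M%:C * a * xi ^+ k) = M%:C * (a * q.[xi]).
    rewrite (horner_coef_wide _ (size_poly _ _)) !mulr_sumr; apply: eq_bigr => k _.
    by move: (q`_k) (xi ^+ k) => x y; ring.
  by rewrite ReM aq /= mul0r subr0.
(* By [q_le] the polynomial q / S' is in the unit ball; 2 delta in place of delta makes [S']
   positive. *)
pose S' := (ip v + 2 * delta) / M.
have S'0 : 0 < S'.
  rewrite divr_gt0//; have := q_le 1 (@cabs1 R).
  move/(le_trans (mulr_ge0 (ltW M0) (cabs_ge0 _))); move: (ip v) => *; lra.
have ball : unit_ball ((S'^-1)%:C *: q).
  apply: circle_ball => x x1; rewrite hornerZ cabsM cabsR ger0_norm ?invr_ge0 ?(ltW S'0)//.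
  rewrite mulrC ler_pdivrMr// mul1r /S' ler_pdivlMr// mulrC.
  rewrite (le_trans (q_le x x1))//; move: (ip v) => *; lra.
have := hc _ ball (leq_trans (size_scale_leq _ _) (size_poly _ _)).
have -> : \sum_(k < n.+1) ((S'^-1)%:C *: q)`_k * c k =
    (S'^-1)%:C * \sum_(k < n.+1) q`_k * c k.
  by rewrite mulr_sumr; apply: eq_bigr => k _; rewrite coefZ mulrA.
rewrite cabsM cabsR ger0_norm ?invr_ge0 ?(ltW S'0)// mulrC ler_pdivrMr//.
rewrite /S' mulrCA divff ?mulr1 ?gt_eqF// => hM.
have : ip c <= ip v + 2 * delta.
  by rewrite ipE (le_trans _ hM)// (le_trans (ler_norm _))// cabs_Re.
have -> : ip c = ip v + D v.
  rewrite /ip /D -big_split/=; apply: eq_bigr => k _.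
  rewrite cabs_sqr -/(r k) -{1}(subrK (v k) (c k)) -/(r k).
  by rewrite mulrDl ReD addrC; congr (_ + _); case: (r k) => a b /=; ring.
(* D v is at most 2 delta = eta^2 / 2, below its lower bound eta^2. *)
have := Dlb v Kv; rewrite /delta; move: (ip v) (D v) => *; lra.
Qed.

End moment_hull.

(** * Boundary values of uniform limits of polynomials *)

Section boundary_values.
Context {R : realType}.
Local Notation C := R[i].

Lemma continuous_real_cabsP (f : R -> C) (t : R) : {for t, continuous f} <->
  forall e : R, 0 < e -> \forall x \near t, cabs (f t - f x) < e.
Proof.
split=> [cf e e0|cf].
  have e0' : 0 < e%:C by rewrite ltcR.
  have /(_ e%:C e0') := (@cvgrPdist_lt _ _ _ (nbhs t) (nbhs_filter t) f (f t)).1 cf.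
  by apply: filterS => x; rewrite cabs_lt.
apply: (@cvgrPdist_lt _ _ _ (nbhs t) _ f (f t)).2 => -[e e'] /[dup] e0.
rewrite ltcE/= => /andP[/eqP e'0 e00]; subst e'.
by apply: filterS (cf e e00) => x; rewrite -[_ +i* 0]/(e%:C) cabs_lt.
Qed.

Variables (G : C -> C).
Hypothesis approxG : forall e : R, 0 < e ->
  exists p : {poly C}, forall w, cabs w <= 1 -> cabs (G w - p.[w]) <= e.

Lemma horner_expi_continuous (p : {poly C}) : continuous (fun t : R => p.[expi t]).
Proof.
move=> t; have tt : t <= t <= t by rewrite lexx.
apply: (@continuous_comp _ _ _ (@expi R) (fun x => p.[x])); first exact: (@expi_cont R t t t tt).
exact: horner_continuous.
Qed.

Lemma boundary_continuous : continuous (fun t : R => G (expi t)).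
Proof.
move=> t; apply/continuous_real_cabsP => e e0.
have e3 : 0 < e / 3 by rewrite divr_gt0.
have [p hp] := approxG e3.
have := (continuous_real_cabsP (fun t => p.[expi t]) t).1 (@horner_expi_continuous p t) _ e3.
apply: filterS => x hx.
have -> : G (expi t) - G (expi x) = (G (expi t) - p.[expi t]) + (p.[expi t] - p.[expi x])
    - (G (expi x) - p.[expi x]).
  by move: (G _) (G _) (p.[_]) (p.[_]) => *; ring.
have h1 := hp (expi t); have h2 := hp (expi x).
rewrite (le_lt_trans (ler_cabsD _ _))// cabsN.
have := ler_cabsD (G (expi t) - p.[expi t]) (p.[expi t] - p.[expi x]).
move: h1 h2; rewrite !cabs_expi => /(_ (lexx _)) + /(_ (lexx _)).
by move: hx; move: (cabs _) (cabs _) (cabs _) (cabs _) => *; lra.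
Qed.

Lemma cauchy_int_boundary w : cabs w < 1 -> cauchy_int 1 (fun t => G (expi t)) w = G w.
Proof.
move=> w1; apply/eqP; rewrite -subr_eq0; apply/eqP/cabs_eq0P => e e0.
have w10 : 0 < 1 - cabs w by rewrite subr_gt0.
(* The Cauchy integral turns this error into 2 e / 3, and the error at [w] itself is at most e /
   3. *)
have d0 : 0 < e * (1 - cabs w) / 3 by rewrite divr_gt0// mulr_gt0.
have [p hp] := approxG d0.
set d := e * (1 - cabs w) / 3 in hp d0.
have cG : cont_on 0 1 (fun t : R => G (expi t)) by move=> t _; exact: boundary_continuous.
have cp : cont_on 0 1 (fun t : R => p.[expi t]) by move=> t _; exact: horner_expi_continuous.
have -> : cauchy_int 1 (fun t => G (expi t)) w - G w =
    cauchy_int 1 (fun t => G (expi t) - p.[expi t]) w - (G w - p.[w]).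
  have -> : cauchy_int 1 (fun t => G (expi t) - p.[expi t]) w =
      cauchy_int 1 (fun t => G (expi t)) w - cauchy_int 1 (fun t => p.[expi t]) w.
    have ck := circle_kernel_cont (a := 0) (b := 1) w1.
    rewrite /cauchy_int -(cintB (cont_onM cG ck) (cont_onM cp ck)).
    by apply: eq_cint => t _; rewrite mulrBl.
  rewrite (cauchy_int_horner _ w1).
  by move: (cauchy_int _ _ _) (G w) (p.[w]) => *; ring.
rewrite (le_trans (ler_cabsD _ _))// cabsN.
have h1 := cauchy_int_bound w1 (cont_onB cG cp) (fun t _ => hp (expi t) ltac:(by rewrite cabs_expi)).
have h2 := hp w (ltW w1).
rewrite (le_trans (lerD h1 h2))//.
have -> : 2 * (d / (1 - cabs w)) = 2 / 3 * e.
  by rewrite /d; field; rewrite gt_eqF.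
have : d <= e / 3.
  by rewrite /d ler_pM2r ?invr_gt0// ler_piMr ?(ltW e0)// gerBl cabs_ge0.
by move=> *; lra.
Qed.

End boundary_values.

(** * Fejer kernels *)

Section fejer.
Context {R : realType}.
Local Notation C := R[i].
Implicit Types (xi w : C).

Lemma cabs_sqrE (z : C) : (cabs z ^+ 2)%:C = z * conjc z.
Proof. by rewrite cabs_sqr; case: z => a b; congr (_ +i* _) => /=; ring. Qed.

Variable n : nat.

(** Its squared modulus is n times the Fejer kernel centred at [xi]. *)
Definition dirichlet xi (t : R) : C := \sum_(a < n) (conjc xi * expi t) ^+ a.

(** n times the n-th Fejer mean of 1 / (1 - conj xi w), the Cauchy transform of a unit mass at
    [xi]. *)
Definition fejer_poly xi : {poly C} :=
  \sum_(m < n) \sum_(k < m.+1) conjc xi ^+ k *: 'X^k.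

Lemma fejer_polyE xi w : (fejer_poly xi).[w] = \sum_(m < n) \sum_(k < m.+1) (conjc xi * w) ^+ k.
Proof.
rewrite /fejer_poly horner_sum; apply: eq_bigr => m _.
by rewrite horner_sum; apply: eq_bigr => k _; rewrite hornerZ hornerXn exprMn.
Qed.

Lemma dirichlet_continuous xi : continuous (dirichlet xi).
Proof.
rewrite (_ : dirichlet xi = fun t => (\sum_(a < n) conjc xi ^+ a *: 'X^a).[expi t]).
  exact: horner_expi_continuous.
apply/funext => t; rewrite horner_sum; apply: eq_bigr => k _.
by rewrite hornerZ hornerXn exprMn.
Qed.

(** Expanding the squared modulus gives the frequencies a - b, of which the Cauchy integral keeps
    those with b <= a. So a nonnegative density has the Fejer polynomial as its Cauchy transform. *)
Lemma cauchy_int_fejer xi w : cabs xi = 1 -> cabs w < 1 ->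
  cauchy_int 1 (fun t => (cabs (dirichlet xi t) ^+ 2)%:C) w = (fejer_poly xi).[w].
Proof.
move=> xi1 w1.
pose F (a b : 'I_n) (t : R) : C :=
  (conjc xi ^+ a * xi ^+ b) * (expi t ^+ a * conjc (expi t) ^+ b).
have cF a b : cont_on 0 1 (F a b).
  exact: (cont_onM (cont_on_cst _) (@expi_conj_cont R a b)).
have cF' a : cont_on 0 1 (fun t => \sum_(b <- index_enum 'I_n) F a b t).
  exact: (cont_on_sum (cF a)).
transitivity (cauchy_int 1 (fun t => \sum_(a <- index_enum 'I_n) \sum_(b <- index_enum 'I_n) F a b t) w).
  apply: eq_cint => t _; congr (_ * _); rewrite cabs_sqrE /dirichlet rmorph_sum mulr_suml.
  apply: eq_bigr => a _; rewrite mulr_sumr; apply: eq_bigr => b _.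
  rewrite [X in _ * X](_ : _ = xi ^+ b * conjc (expi t) ^+ b); last first.
    by rewrite rmorphXn rmorphM/= conjcK exprMn.
  by rewrite /F exprMn mulrACA.
rewrite (cauchy_int_sum _ w1 cF') fejer_polyE; apply: eq_bigr => a _.
rewrite (cauchy_int_sum _ w1 (cF a)).
transitivity (\sum_(b < n | (b < a.+1)%N) (conjc xi * w) ^+ (a - b)).
  rewrite [RHS]big_mkcond/=; apply: eq_bigr => b _.
  rewrite (cauchy_intZ _ w1 (@expi_conj_cont R a b)) cauchy_int_expi_conj// ltnS.
  case: ifP => [ba|_]; last by rewrite mulr0.
  have xx : conjc xi * xi = 1 by rewrite mulrC -cabs_sqrE xi1 expr1n.
  have -> : conjc xi ^+ a * xi ^+ b = conjc xi ^+ (a - b).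
    by rewrite -{1}(subnK ba) exprD -mulrA -exprMn xx expr1n mulr1.
  by rewrite exprMn.
rewrite -(big_ord_widen n (fun b => (conjc xi * w) ^+ (a - b)))//.
rewrite (reindex_inj rev_ord_inj); apply: eq_bigr => k _ /=.
by rewrite subSS subKn// -ltnS.
Qed.

End fejer.

(** * Construction of a representing measure of controlled mass *)

Section representation.
Context {R : realType}.
Local Notation C := R[i].
Local Notation lambda := (@lebesgue_measure R).

Lemma geometric_sum_le (rho : R) n : 0 <= rho -> rho < 1 ->
  \sum_(k < n) rho ^+ k <= (1 - rho)^-1.
Proof.
move=> r0 r1; have d0 : 0 < 1 - rho by rewrite subr_gt0.
rewrite -[leRHS]mul1r ler_pdivlMr// mulrC.
have -> : (1 - rho) * (\sum_(i < n) rho ^+ i) = 1 - rho ^+ n.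
  by rewrite -opprB mulNr -subrX1 opprB.
by rewrite gerBl exprn_ge0.
Qed.

Lemma continuous_interval_integrable (f : R -> R) : continuous f ->
  lambda.-integrable `[0%R, 1%R] (EFin \o f).
Proof.
move=> cf; apply: continuous_compact_integrable; first exact: segment_compact.
exact: continuous_subspaceT.
Qed.

Variables (G : C -> C) (c : nat -> C) (M A rho : R).
Hypotheses (M0 : 0 < M) (rho0 : 0 <= rho) (rho1 : rho < 1).
Hypothesis hG : forall w, cabs w <= 1 -> forall N,
  cabs (G w - \sum_(k < N) conjc (c k) * w ^+ k) <= A * rho ^+ N.
Hypothesis hc : forall q : {poly C}, unit_ball q ->
  cabs (\sum_(k < size q) q`_k * c k) <= M.

Let A0 : 0 <= A.
Proof.
have := hG (w := 0) _ 0%N; rewrite cabs0 expr0 mulr1 => /(_ ler01).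
exact: le_trans (cabs_ge0 _).
Qed.

Let approxG (e : R) : 0 < e ->
  exists p : {poly C}, forall w, cabs w <= 1 -> cabs (G w - p.[w]) <= e.
Proof.
move=> e0; have A1 : 0 < A + 1 by rewrite ltr_wpDl.
have [N hN] := expr_small rho0 rho1 (divr_gt0 e0 A1).
exists (\poly_(k < N) conjc (c k)) => w w1; rewrite horner_poly.
rewrite (le_trans (hG w1 N))//; have := hN N (leqnn N).
rewrite ler_pdivlMr// mulrC => /(le_trans _); apply.
by rewrite ler_wpM2r ?exprn_ge0// lerDl.
Qed.

(* G minus the Fejer means of the moments of s is replaced, in the density, by
   the corresponding Fejer kernels, which have the same Cauchy transform and
   integral 1. *)
Lemma representing_measure : exists mu : cmeasure (borel_circle R) R,
  represents mu G /\ cmeasure_norm mu <= 8 * M.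
Proof.
have r10 : 0 < 1 - rho by rewrite subr_gt0.
(* The tails A rho^m sum to at most A / (1 - rho), so their average over m < n is at most M / 2. *)
pose n := (Num.truncn (A / ((1 - rho) * (M / 2)))).+1.
have n0 : 0 < n%:R :> R by rewrite ltr0n.
have hn : A / (1 - rho) <= n%:R * (M / 2).
  rewrite -ler_pdivrMr ?divr_gt0// -mulrA -invfM ltW//.
  exact: truncnS_gt.
(* At most n moment errors occur in each partial sum, for a total of at most M / 2. *)
pose eta := M / 2 / n%:R.
have eta0 : 0 < eta by rewrite !divr_gt0.
have hc' q : unit_ball q -> (size q <= n.-1.+1)%N -> cabs (\sum_(k < n.-1.+1) q`_k * c k) <= M.
  move=> qb sq; rewrite (le_trans _ (hc qb))// le_eqVlt; apply/orP; left; apply/eqP.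
  congr cabs; rewrite (big_ord_widen _ (fun k => q`_k * c k) sq) [RHS]big_mkcond/=.
  by apply: eq_bigr => k _; case: ltnP => // h; rewrite nth_default// mul0r.
have [v [s [s1 sM sv]] cv] := moment_hull_approx M0 eta0 hc'.
have c_v k : (k < n)%N -> cabs (c k - v k) <= eta by move=> kn; apply: cv.
(* G has the Taylor coefficients conj (c k), hence the conjugated masses; 1 / n normalizes
   [fejer_poly]. *)
pose coef (x : C * C) : C := conjc x.1 / n%:R%:C.
pose Q : {poly C} := \sum_(x <- s) coef x *: fejer_poly n x.2.
have QG w : cabs w <= 1 -> cabs (G w - Q.[w]) <= M.
  move=> w1.
  have nC0 : n%:R%:C != 0 :> C by rewrite -cabs_gt0 cabsR ger0_norm ?ltW.
  have nE : n%:R = n%:R%:C :> C by rewrite rmorph_nat.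
  (* [Q] is an average of partial sums, so the error is the average of the tails of G and of the
     moment errors c - v, each at most M / 2. *)
  have -> : G w - Q.[w] = n%:R%:C^-1 * \sum_(m < n) (G w - \sum_(k < m.+1) conjc (v k) * w ^+ k).
    rewrite sumrB sumr_const card_ord mulrBr -[G w *+ n]mulr_natl; congr (_ - _).
      by rewrite nE mulrA mulVf// mul1r.
    rewrite /Q horner_sum.
    under eq_bigr do rewrite hornerZ fejer_polyE /coef [_ / _]mulrC -mulrA.
    rewrite -mulr_sumr; congr (_ * _).
    under eq_bigr do rewrite mulr_sumr.
    rewrite exchange_big/=; apply: eq_bigr => m _.
    under eq_bigr do rewrite mulr_sumr.
    rewrite exchange_big/=; apply: eq_bigr => k _.
    rewrite sv rmorph_sum mulr_suml; apply: eq_bigr => x _.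
    by rewrite rmorphM rmorphXn/= exprMn mulrA.
  rewrite cabsM cabsV cabsR ger0_norm ?(ltW n0)// mulrC ler_pdivrMr//.
  rewrite (le_trans (cabs_sum _ _ _))//.
  have hm (m : 'I_n) : cabs (G w - \sum_(k < m.+1) conjc (v k) * w ^+ k) <=
      A * rho ^+ m + M / 2.
    have -> : G w - \sum_(k < m.+1) conjc (v k) * w ^+ k =
        (G w - \sum_(k < m.+1) conjc (c k) * w ^+ k) + \sum_(k < m.+1) conjc (c k - v k) * w ^+ k.
      have -> : \sum_(k < m.+1) conjc (c k - v k) * w ^+ k =
          \sum_(k < m.+1) conjc (c k) * w ^+ k - \sum_(k < m.+1) conjc (v k) * w ^+ k.
        by rewrite -sumrB; apply: eq_bigr => k _; rewrite rmorphB/= mulrBl.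
      by rewrite addrA subrK.
    rewrite (le_trans (ler_cabsD _ _))//; apply: lerD.
      rewrite (le_trans (hG w1 _))// ler_wpM2l// exprS ler_piMl ?exprn_ge0//.
      exact: ltW.
    rewrite (le_trans (cabs_sum _ _ _))//.
    have -> : M / 2 = \sum_(k < n) eta.
      by rewrite sumr_const card_ord -[RHS]mulr_natl /eta [RHS]mulrC divfK// gt_eqF.
    rewrite (big_ord_widen n (fun k => cabs (conjc (c k - v k) * w ^+ k)))//.
    rewrite big_mkcond/=; apply: ler_sum => k _; case: ifP => _; last exact: ltW.
    rewrite cabsM cabs_conj cabsX (le_trans _ (c_v k (ltn_ord k)))//.
    by rewrite ler_piMr ?cabs_ge0// exprn_ile1// cabs_ge0.
  rewrite (le_trans (ler_sum _ (fun m _ => hm m)))// big_split/= -mulr_sumr.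
  rewrite sumr_const card_ord -[(M / 2) *+ n]mulr_natl.
  have -> : M * n%:R = n%:R * (M / 2) + n%:R * (M / 2) by field.
  by rewrite lerD// (le_trans _ hn)// ler_wpM2l// geometric_sum_le.
pose D xi (t : R) := cabs (dirichlet n xi t) ^+ 2.
have cD xi : continuous (D xi).
  move=> t; apply: (@continuous_comp _ _ _ (fun t => cabs (dirichlet n xi t)) (fun x : R => x ^+ 2)).
    apply: (@continuous_comp _ _ _ (dirichlet n xi) (@cabs R)).
      exact: dirichlet_continuous.
    exact: cabs_continuous.
  exact: exprn_continuous.
have cC (f : R -> R) : continuous f -> cont_on 0 1 (fun t => (f t)%:C).
  by move=> cf; apply: cont_onR => t _; exact: cf.
have cDC (k : C) xi : cont_on 0 1 (fun t => k * (D xi t)%:C).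
  exact: (cont_onM (cont_on_cst _) (cC _ (cD xi))).
have KE (k : C * C -> C) w : cabs w < 1 ->
    cauchy_int 1 (fun t => \sum_(x <- s) k x * (D x.2 t)%:C) w =
    \sum_(x <- s) k x * (fejer_poly n x.2).[w].
  move=> w1; rewrite (cauchy_int_sum _ w1 (fun x => cDC (k x) x.2)).
  apply: eq_big_seq => x xs; rewrite (cauchy_intZ _ w1 (cC _ (cD x.2))).
  by rewrite cauchy_int_fejer// s1.
pose h (t : R) : C := (G (expi t) - Q.[expi t]) + \sum_(x <- s) coef x * (D x.2 t)%:C.
have approxGQ (e : R) : 0 < e ->
    exists p : {poly C}, forall w, cabs w <= 1 -> cabs (G w - Q.[w] - p.[w]) <= e.
  move=> e0; have [p hp] := approxG e0; exists (p - Q) => w w1.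
  by rewrite hornerD hornerN opprB addrA subrK hp.
have cGQ := boundary_continuous approxGQ.
have cK (k : C * C -> C) : continuous (fun t => \sum_(x <- s) k x * (D x.2 t)%:C).
  move=> t; have tt : t <= t <= t by rewrite lexx.
  have cx x : cont_on t t (fun t => k x * (D x.2 t)%:C).
    have cR : cont_on t t (fun t => (D x.2 t)%:C) by apply: cont_onR => y _; exact: cD.
    exact: (cont_onM (cont_on_cst _) cR).
  exact: (cont_on_sum cx tt).
have ch : continuous h.
  by move=> t; apply: (@cvgD _ _ _ (nbhs t)); [exact: cGQ|exact: cK].
have [mu [muE mu_le]] := circle_density ch; exists mu; split.
  move=> w /set_mem/[dup] Dw /discP w1; rewrite muE//.
  rewrite (cauchy_intD w1 (F := fun t => G (expi t) - Q.[expi t])); first last.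
  - by move=> t _; exact: cK.
  - by move=> t _; exact: cGQ.
  rewrite (cauchy_int_boundary approxGQ w1) KE//.
  rewrite -[RHS](subrK Q.[w]); congr (_ + _); rewrite horner_sum.
  by apply: eq_bigr => x _; rewrite hornerZ.
rewrite (le_trans mu_le)// (_ : 8 * M = 4 * (M + M)); last by ring.
rewrite ler_wpM2l//.
(* A continuous majorant of |h|. Its integral is its Cauchy integral at 0, namely M plus the total
   mass of the atoms, since each Fejer kernel has mean 1. *)
pose b (t : R) := M + \sum_(x <- s) cabs x.1 / n%:R * D x.2 t.
have bE t : (b t)%:C = M%:C + \sum_(x <- s) (cabs x.1 / n%:R)%:C * (D x.2 t)%:C.
  by rewrite /b rmorphD rmorph_sum; congr (_ + _); apply: eq_bigr => x _; rewrite rmorphM.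
have cb : continuous b.
  rewrite (_ : b = fun t => complex.Re (M%:C + \sum_(x <- s) (cabs x.1 / n%:R)%:C * (D x.2 t)%:C)); last first.
    by apply/funext => t; rewrite -bE.
  move=> t; apply: (@continuous_Re R (fun t => M%:C + \sum_(x <- s) (cabs x.1 / n%:R)%:C * (D x.2 t)%:C)).
  by apply: (@cvgD _ _ _ (nbhs t)); [exact: cvg_cst|exact: cK].
have hb t : cabs (h t) <= b t.
  rewrite (le_trans (ler_cabsD _ _))// lerD ?QG ?cabs_expi//.
  rewrite (le_trans (cabs_sum _ _ _))// ler_sum// => x _.
  by rewrite cabsM /coef cabs_div cabs_conj !cabsR !ger0_norm// ?(ltW n0) ?sqr_ge0.
rewrite (le_trans (y := \int[lambda]_(t in `[0, 1]) b t))//.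
  apply: le_Rintegral => //.
  - apply: continuous_interval_integrable => t.
    by apply: (continuous_comp (ch t)); exact: cabs_continuous.
  - exact: continuous_interval_integrable.
have l01 : cabs (0 : C) < 1 by rewrite cabs0.
have -> : \int[lambda]_(t in `[0, 1]) b t = complex.Re (cauchy_int 1 (fun t => (b t)%:C) 0).
  rewrite /cauchy_int; apply: eq_Rintegral => t _.
  by rewrite /circle_kernel mul0r subr0 invr1 mulr1.
have -> : cauchy_int 1 (fun t => (b t)%:C) 0 = M%:C + \sum_(x <- s) (cabs x.1)%:C.
  rewrite (_ : (fun t => (b t)%:C) = (fun t => (polyC M%:C).[expi t] +
      \sum_(x <- s) (cabs x.1 / n%:R)%:C * (D x.2 t)%:C)); last first.
    by apply/funext => t; rewrite bE hornerC.
  rewrite (cauchy_intD l01 (F := fun t => (polyC M%:C).[expi t])); first last.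
  - by move=> t _; exact: cK.
  - by move=> t _; exact: horner_expi_continuous.
  rewrite cauchy_int_horner// hornerC KE//; congr (_ + _).
  apply: eq_bigr => x _; rewrite fejer_polyE.
  have -> : \sum_(m < n) \sum_(k < m.+1) (conjc x.2 * 0) ^+ k = n%:R%:C :> C.
    rewrite -[n in RHS]card_ord rmorph_nat -sumr_const; apply: eq_bigr => m _.
    by rewrite mulr0 big_ord_recl expr0 big1 ?addr0// => k _; rewrite exprS mul0r.
  by rewrite -rmorphM/= divfK// gt_eqF.
rewrite -rmorph_sum -rmorphD/=.
by rewrite lerD2l.
Qed.

End representation.

(** * Completeness of the space of Cauchy transforms *)

Section measure_series.
Context d {T : measurableType d} {R : realType}.
Local Notation C := R[i].

Let seq_cvgB (u v w : nat -> R) (a b : R) : (forall n, w n = u n - v n) ->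
  u n @[n --> \oo] --> a -> v n @[n --> \oo] --> b -> w n @[n --> \oo] --> a - b.
Proof. by move=> /funext ->; exact: cvgB. Qed.

Let seq_cvgD (u v w : nat -> R) (a b : R) : (forall n, w n = u n + v n) ->
  u n @[n --> \oo] --> a -> v n @[n --> \oo] --> b -> w n @[n --> \oo] --> a + b.
Proof. by move=> /funext ->; exact: cvgD. Qed.

(** For nonnegative integrands this is the formula for the integral against a sum of measures; a
    bounded [f] is made nonnegative by adding a constant, which is subtracted afterwards. *)
Lemma measure_series (m : nat -> {finite_measure set T -> \bar R}) (b : nat -> R) (B : R) :
  (forall k, (m k setT <= (b k)%:E)%E) -> (forall n, \sum_(k < n) b k <= B) ->
  exists2 p : {finite_measure set T -> \bar R}, (p setT <= B%:E)%E &
    forall f, bounded_measurable f ->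
      (\sum_(k < n) \int[m k]_x f x)%R @[n --> \oo] --> \int[p]_x f x.
Proof.
move=> mb bB; pose p : {measure set T -> \bar R} := mseries m 0.
have pB : (p setT <= B%:E)%E.
  apply: lime_le; first by apply: is_cvg_nneseries => k _ _; exact: measure_ge0.
  apply: nearW => n /=; rewrite big_mkord (le_trans (y := (\sum_(k < n) (b k)%:E)%E))//.
    by apply: lee_sum => k _; exact: mb.
  by rewrite sumEFin lee_fin.
have poo : (p setT < +oo)%E by rewrite (le_lt_trans pB)// ltry.
have [p' p'E] := finite_measure_fin poo.
exists p'; first by rewrite p'E.
have p'i (f : T -> R) : \int[p']_x f x = \int[p]_x f x.
  by rewrite /Rintegral; congr fine; apply: eq_measure_integral => A _ _; exact: p'E.
have nonneg (f : T -> R) : bounded_measurable f -> (forall x, 0 <= f x) ->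
    (\sum_(k < n) \int[m k]_x f x)%R @[n --> \oo] --> \int[p']_x f x.
  move=> bf f0; rewrite p'i.
  have mf : measurable_fun setT (EFin \o f) by apply/measurable_EFinP; case: bf.
  have pE : (\int[p]_x (f x)%:E = \sum_(k <oo) \int[m k]_x (f x)%:E)%E.
    by rewrite ge0_integral_measure_series// => x _; rewrite lee_fin.
  have fin_p : (\int[p]_x (f x)%:E)%E \is a fin_num.
    exact: integrable_fin_num (bounded_measurable_integrable poo bf).
  have fin_m k : (\int[m k]_x (f x)%:E)%E \is a fin_num.
    by apply: integrable_fin_num => //; exact: (bounded_measurable_integrable (finite_measure_lty (m k)) bf).
  have h : ((\sum_(k < n) \int[m k]_x f x)%R%:E @[n --> \oo] --> (\int[p]_x f x)%:E)%E.
    rewrite {2}/Rintegral fineK// pE.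
    rewrite [X in X @ _ --> _](_ : _ = (fun n => (\sum_(0 <= k < n) \int[m k]_x (f x)%:E)%E)); last first.
      apply/funext => n; rewrite big_mkord -sumEFin; apply: eq_bigr => k _.
      by rewrite /Rintegral (fineK (fin_m k)).
    by apply: is_cvg_nneseries => k _ _; apply: integral_ge0 => x _; rewrite lee_fin.
  exact: (fine_cvg h).
move=> f bf; have [mf [K fK]] := bf.
have K0 : 0 <= `|K| by [].
have bK : bounded_measurable (fun _ : T => `|K|).
  by split; [exact: measurable_cst|exists `|K| => x; rewrite normr_id].
have bfK := bounded_measurableD bf bK.
have fK0 x : 0 <= f x + `|K|.
  by rewrite -lerBlDr sub0r lerNl (le_trans (ler_norm _))// normrN (le_trans (fK x))// ler_norm.
have DE (q : {finite_measure set T -> \bar R}) :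
    \int[q]_x (f x + `|K|) - \int[q]_x `|K| = \int[q]_x f x.
  rewrite RintegralD//; first by rewrite addrK.
    exact: (bounded_measurable_integrable (finite_measure_lty q) bf).
  exact: (bounded_measurable_integrable (finite_measure_lty q) bK).
rewrite -DE; apply: (seq_cvgB _ (nonneg _ bfK fK0) (nonneg _ bK (fun _ => K0))) => n.
by rewrite -sumrB; apply: eq_bigr => k _; rewrite DE.
Qed.

Lemma jordan_pos_le (nu : {charge set T -> \bar R}) (M : R) :
  (forall A, measurable A -> `|fine (nu A)| <= M) ->
  ((jordan_pos (hahnP nu) : {finite_measure set T -> \bar R}) setT <= M%:E)%E.
Proof.
move=> nuM; have [[mP _] _ _ _] := hahnP nu.
have pE : (jordan_pos (hahnP nu) : {finite_measure set T -> \bar R}) setT = nu (hahn_pos nu).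
  transitivity (crestr0 nu mP setT) => //.
  by rewrite /crestr0 /crestr mem_set// setTI.
have fin : nu (hahn_pos nu) \is a fin_num by exact: fin_num_measure.
by rewrite pE -(fineK fin) lee_fin (le_trans (ler_norm _))// nuM.
Qed.

Lemma jordan_neg_le (nu : {charge set T -> \bar R}) (M : R) :
  (forall A, measurable A -> `|fine (nu A)| <= M) ->
  ((jordan_neg (hahnP nu) : {finite_measure set T -> \bar R}) setT <= M%:E)%E.
Proof.
move=> nuM; have [_ [mN _] _ _] := hahnP nu.
have nE : (jordan_neg (hahnP nu) : {finite_measure set T -> \bar R}) setT = (- nu (hahn_neg nu))%E.
  transitivity ((-1)%:E * crestr0 nu mN setT)%E => //.
  by rewrite /crestr0 /crestr mem_set// setTI; exact: mulN1e.
have fin : nu (hahn_neg nu) \is a fin_num by exact: fin_num_measure.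
by rewrite nE -(fineK fin) -EFinN lee_fin (le_trans (ler_norm _))// normrN nuM.
Qed.

(** The Jordan parts of the real and of the imaginary parts form four series, each of total mass at
    most [B]; hence the factor 4. *)
Lemma cmeasure_series (mu : nat -> cmeasure T R) (b : nat -> R) (B : R) :
  (forall k, cmeasure_norm (mu k) <= b k) -> (forall n, \sum_(k < n) b k <= B) ->
  exists2 nu : cmeasure T R, cmeasure_norm nu <= 4 * B &
    forall f, cbounded_measurable f ->
      \sum_(k < n) cintegral (mu k) f @[n --> \oo] --> cintegral nu f.
Proof.
move=> mub bB.
have reb k A : measurable A -> `|fine (cmeasure_Re (mu k) A)| <= b k.
  move=> mA; rewrite (le_trans _ (mub k))// (le_trans _ (cabs_cmeasure_le (mu k) mA))//.
  exact: (cabs_Re (mu k A)).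
have imb k A : measurable A -> `|fine (cmeasure_Im (mu k) A)| <= b k.
  move=> mA; rewrite (le_trans _ (mub k))// (le_trans _ (cabs_cmeasure_le (mu k) mA))//.
  exact: (cabs_Im (mu k A)).
have [p1 p1B p1f] := measure_series (fun k => jordan_pos_le (reb k)) bB.
have [n1 n1B n1f] := measure_series (fun k => jordan_neg_le (reb k)) bB.
have [p2 p2B p2f] := measure_series (fun k => jordan_pos_le (imb k)) bB.
have [n2 n2B n2f] := measure_series (fun k => jordan_neg_le (imb k)) bB.
exists (cmeasure_of p1 n1 p2 n2); first exact: cmeasure_of_norm_le.
move=> f bf; have [fr fi] := bf.
rewrite cintegral_cmeasure_of//; apply: complex_cvg => /=.
  apply: (seq_cvgB _ (seq_cvgB _ (p1f _ fr) (n1f _ fr)) (seq_cvgB _ (p2f _ fi) (n2f _ fi))) => n //.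
  by rewrite Re_sum -!sumrB.
apply: (seq_cvgD _ (seq_cvgB _ (p1f _ fi) (n1f _ fi)) (seq_cvgB _ (p2f _ fr) (n2f _ fr))) => n //.
have -> : complex.Im (\sum_(k < n) cintegral (mu k) f) = \sum_(k < n) complex.Im (cintegral (mu k) f).
  by elim/big_ind2 : _ => //= x x' y y' <- <-; rewrite ImD.
by rewrite -!sumrB -big_split.
Qed.

End measure_series.

Section cauchy_complete.
Context {R : realType}.
Local Notation C := R[i].
Implicit Types mu : cmeasure (borel_circle R) R.

Lemma cauchy_space_of_measure mu : exists k : cauchy_space R, represents mu k.
Proof.
pose f w := if pselect (disc w) then cauchy_transform mu w else 0.
have muf : represents mu f.
  by move=> w /set_mem Dw; rewrite /f; case: pselect.
have fP : f \in cauchy_pred.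
  apply/cauchy_predP; split; first by exists mu.
  by move=> w nDw; rewrite /f; case: pselect.
by exists (exist _ f fP).
Qed.

Lemma rnorm_cauchy_le (k : cauchy_space R) mu : represents mu k -> rnorm k <= cmeasure_norm mu.
Proof. exact: cauchy_norm_le. Qed.

Lemma near_norm_measure (k : cauchy_space R) (e : R) : rnorm k < e ->
  exists2 mu, represents mu k & cmeasure_norm mu <= e.
Proof.
move=> ke; apply: contrapT => h; move: ke; rewrite ltNge => /negP; apply.
apply: le_cauchy_norm => mu muk; rewrite leNgt; apply/negP => /ltW mue.
by apply: h; exists mu.
Qed.

Lemma halves_sum_le n : \sum_(k < n) (2^-1 : R) ^+ k <= 2.
Proof.
have := @geometric_sum_le R 2^-1 n; rewrite invr_ge0 ler0n => /(_ isT).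
rewrite invf_lt1// ltr1n => /(_ isT) /le_trans; apply.
by rewrite le_eqVlt; apply/orP; left; apply/eqP; field.
Qed.

Lemma cvgn_shift_unique (u v : nat -> C) (a b k : C) : (forall n, v n = u n - k) ->
  u n @[n --> \oo] --> a -> v n @[n --> \oo] --> b -> b = a - k.
Proof.
move=> /funext vE ua vb; apply: cvg_unique vb _; first exact: norm_hausdorff.
by rewrite vE; apply: cvgB ua _; exact: cvg_cst.
Qed.

(** Each increment is represented by a measure of norm at most 2 * 2^-j. The series of these
    measures from index N on has a sum of norm at most 4 * 2 * 2^-N * 2 = 16 * 2^-N, whose Cauchy
    transform is the pointwise limit of v n - v N. *)
Lemma cauchy_space_fast_complete (v : nat -> cauchy_space R) :
  (forall j, rnorm (v j.+1 - v j) <= 2^-1 ^+ j) ->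
  exists k, forall j, rnorm (k - v j) <= 16 * 2^-1 ^+ j.
Proof.
move=> hv.
have pos j : 0 < (2^-1 : R) ^+ j by rewrite exprn_gt0// invr_gt0.
have hmu j : exists mu, represents mu (v j.+1 - v j : cauchy_space R) /\ cmeasure_norm mu <= 2 * 2^-1 ^+ j.
  (* The factor 2 makes the inequality strict, as the infimum defining the norm may not be
     attained. *)
  have [|mu muv mub] := @near_norm_measure (v j.+1 - v j) (2 * 2^-1 ^+ j).
    by rewrite (le_lt_trans (hv j))// ltr_pMl// ltr1n.
  by exists mu.
have [mu hmu'] := choice hmu.
have tail N : exists nu, cmeasure_norm nu <= 16 * 2^-1 ^+ N /\
    forall w, disc w -> v (n + N)%N w - v N w @[n --> \oo] --> cauchy_transform nu w.
  have [||nu nuB nuf] := @cmeasure_series _ _ R (fun k => mu (k + N)%N)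
      (fun k => 2 * 2^-1 ^+ N * 2^-1 ^+ k) (2 * 2^-1 ^+ N * 2).
  - by move=> k; rewrite -mulrA -exprD [(N + k)%N]addnC; have [] := hmu' (k + N)%N.
  - by move=> n; rewrite -mulr_sumr ler_pM2l ?mulr_gt0// halves_sum_le.
  exists nu; split; first by rewrite (le_trans nuB)// le_eqVlt; apply/orP; left; apply/eqP; ring.
  move=> w Dw; have := nuf _ (cauchy_kernel_bm Dw).
  rewrite (_ : (fun n => \sum_(k < n) _) = (fun n => v (n + N)%N w - v N w))//.
  apply/funext; elim=> [|n IH]; first by rewrite big_ord0 subrr.
  rewrite big_ord_recr/= IH; have [muv _] := hmu' (n + N)%N.
  have -> : cintegral (mu (n + N)%N) (cauchy_kernel w) = v (n + N).+1 w - v (n + N)%N w.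
    exact: (muv w (mem_set Dw)).
  by rewrite addrC addrA subrK.
have [nu hnu] := choice tail.
have [k0 k0nu] := cauchy_space_of_measure (nu 0%N).
exists (v 0%N + k0) => N; apply: le_trans (proj1 (hnu N)).
apply: rnorm_cauchy_le => w /[dup] wD /set_mem Dw.
have h0 : v n w - v 0%N w @[n --> \oo] --> cauchy_transform (nu 0%N) w.
  have := (hnu 0%N).2 w Dw; rewrite (_ : (fun n => v (n + 0)%N w - _) = (fun n => v n w - v 0%N w))//.
  by apply/funext => n; rewrite addn0.
have h1 : v (n + N)%N w - v 0%N w @[n --> \oo] --> cauchy_transform (nu 0%N) w.
  by rewrite (cvg_shiftn N (fun n => v n w - v 0%N w)).
have -> : cauchy_fun (v 0%N + k0 - v N) w = cauchy_transform (nu 0%N) w - (v N w - v 0%N w).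
  rewrite -[LHS]/(v 0%N w + k0 w - v N w) -k0nu//.
  have alg (a b c : C) : a + b - c = b - (c - a) by ring.
  exact: alg.
apply: cvgn_shift_unique h1 ((hnu N).2 w Dw) => n.
have alg (a b c : C) : a - b = a - c - (b - c) by ring.
exact: alg.
Qed.

Lemma cauchy_space_complete (u : nat -> cauchy_space R) :
  (forall e : R, 0 < e -> exists N, forall m n, (N <= m)%N -> (N <= n)%N ->
     rnorm (u m - u n) <= e) ->
  exists k, forall e : R, 0 < e -> exists N, forall n, (N <= n)%N -> rnorm (k - u n) <= e.
Proof.
move=> hu.
have pos j : 0 < (2^-1 : R) ^+ j by rewrite exprn_gt0// invr_gt0.
have [N hN] := choice (fun j => hu _ (pos j)).
(* Both s j and s (j + 1) are at least N j, which bounds the j-th increment of the subsequence by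
   2^-j. *)
pose s j := (\max_(i < j.+1) N i)%N.
have sN j i : (i <= j)%N -> (N i <= s j)%N.
  by move=> ij; rewrite /s (bigD1 (Ordinal (ij : (i < j.+1)%N)))//= leq_maxl.
have [|k hk] := @cauchy_space_fast_complete (fun j => u (s j)).
  by move=> j; apply: hN; apply: sN.
exists k => e e0.
(* 17 = 16 + 1: the distance from the limit to the subsequence, plus that from the subsequence to
   the sequence. *)
have e17 : 0 < e / 17 by rewrite divr_gt0.
have half0 : 0 <= (2^-1 : R) by rewrite invr_ge0.
have half1 : (2^-1 : R) < 1 by rewrite invf_lt1// ltr1n.
have [J /(_ J (leqnn J)) hJ] := expr_small half0 half1 e17.
exists (N J) => n Nn.
have -> : k - u n = (k - u (s J)) + (u (s J) - u n) by rewrite addrA subrK.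
rewrite (le_trans (ler_rnormD _ _))//.
rewrite (le_trans (lerD (hk J) (hN J _ _ (sN J J (leqnn J)) Nn)))//.
by move: hJ; rewrite ler_pdivlMr//; move: (_ ^+ J) => *; lra.
Qed.

End cauchy_complete.

(** * Relative compactness of the kernels *)

Section kernel_space.
Context {R : realType}.
Local Notation C := R[i].
Variable g : C -> C.
Hypothesis gan : analytic disc g.

(** [A] does not depend on [rho], so two points can share as common ratio the larger of their
    moduli. *)
Lemma G_H2_tail z : disc z -> exists2 A : R, 0 < A & forall (rho : R), cabs z <= rho ->
  forall w, cabs w <= 1 -> forall n,
    cabs (G_H2 g z w - \sum_(j < n) conjc (Tmon g j z) * w ^+ j) <= A * rho ^+ n.
Proof.
move=> Dz; have /discP z1 := Dz.
have [L L0 hL] := analytic_locally_bounded (analytic_derive1 gan) z1.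
have d0 := disc_cabs Dz.
exists (2 * ((1 - cabs z)^-1 * L)); first by rewrite !mulr_gt0// invr_gt0.
move=> rho zr w w1 n; rewrite (le_trans (G_H2_partial gan n hL Dz w1))// -!mulrA ler_wpM2l//.
rewrite mulrC -mulrA ler_wpM2l ?invr_ge0 ?(ltW d0)// ler_wpM2l ?(ltW L0)//.
rewrite lerXn2r ?nnegrE ?mulr_ge0 ?cabs_ge0//; first by rewrite (le_trans _ zr) ?cabs_ge0.
by rewrite (le_trans _ zr)// ler_piMr ?cabs_ge0.
Qed.

(** [representing_measure] applied with c k = T_g z^k (z) - T_g z^k (z'), whose pairing with a
    polynomial q is T_g q (z) - T_g q (z'). *)
Lemma kernel_difference_measure z z' (M : R) : disc z -> disc z' -> 0 < M ->
  (forall p, unit_ball p -> cabs (Tp g p z - Tp g p z') <= M) ->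
  exists mu, represents mu (fun w => G_H2 g z w - G_H2 g z' w) /\ cmeasure_norm mu <= 8 * M.
Proof.
move=> Dz Dz' M0 hM; have /discP z1 := Dz; have /discP z1' := Dz'.
have [A A0 hA] := G_H2_tail Dz; have [A' A0' hA'] := G_H2_tail Dz'.
pose rho := Num.max (cabs z) (cabs z').
have zr : cabs z <= rho by rewrite le_max lexx.
have zr' : cabs z' <= rho by rewrite le_max lexx orbT.
have rho0 : 0 <= rho by rewrite (le_trans _ zr) ?cabs_ge0.
have rho1 : rho < 1 by rewrite gt_max z1.
apply: (@representing_measure R _ (fun k => Tmon g k z - Tmon g k z') M (A + A') rho) => //.
  move=> w w1 n.
  have -> : \sum_(k < n) conjc (Tmon g k z - Tmon g k z') * w ^+ k =
      \sum_(k < n) conjc (Tmon g k z) * w ^+ k - \sum_(k < n) conjc (Tmon g k z') * w ^+ k.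
    by rewrite -sumrB; apply: eq_bigr => k _; rewrite rmorphB/= mulrBl.
  have alg (a b c e : C) : a - b - (c - e) = (a - c) - (b - e) by ring.
  rewrite alg (le_trans (ler_cabsD _ _))// cabsN mulrDl.
  exact: (lerD (hA rho zr w w1 n) (hA' rho zr' w w1 n)).
move=> q qb; apply: le_trans (hM q qb); rewrite (TpE gan q Dz) (TpE gan q Dz') -sumrB.
by rewrite (eq_bigr (fun k : 'I_(size q) => q`_k * Tmon g k z - q`_k * Tmon g k z'))// => k _; rewrite mulrBr.
Qed.

Lemma Tp_0 p : Tp g p 0 = 0.
Proof. exact: mul0r. Qed.

Lemma G_H2_0 w : G_H2 g 0 w = 0.
Proof. by rewrite /G_H2 segment_integralE mul0r conjc0. Qed.

Hypothesis gb : Tp_bounded g.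

(** The case z' = 0 of [kernel_difference_measure], as the kernel at 0 is zero. *)
Lemma kernel_in_cauchy_space z : disc z -> exists k : cauchy_space R, {in disc, k =1 G_H2 g z}.
Proof.
move=> Dz; have [M M0 hM] := gb.
have [|mu [muG _]] := kernel_difference_measure Dz (@disc0 R) M0.
  by move=> p pb; rewrite Tp_0 subr0; exact: hM.
have [k kmu] := cauchy_space_of_measure mu; exists k => w Dw.
by rewrite -kmu// muG// G_H2_0 subr0.
Qed.

Lemma kernel_rnorm_le (k k' : cauchy_space R) z z' (M : R) : disc z -> disc z' -> 0 < M ->
  {in disc, k =1 G_H2 g z} -> {in disc, k' =1 G_H2 g z'} ->
  (forall p, unit_ball p -> cabs (Tp g p z - Tp g p z') <= M) ->
  rnorm (k - k') <= 8 * M.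
Proof.
move=> Dz Dz' M0 kz kz' /(kernel_difference_measure Dz Dz' M0)[mu [muG muM]].
apply: le_trans muM; apply: rnorm_cauchy_le => w Dw.
by rewrite muG// -kz// -kz'.
Qed.

Hypothesis ge : Tp_equicontinuous g.

Lemma equicontinuous_kernel_compact :
  cauchy_relatively_compact [set G_H2 g z | z in disc].
Proof.
have hk z : exists k : cauchy_space R, disc z -> {in disc, k =1 G_H2 g z}.
  have [Dz|nDz] := pselect (disc z); last by exists 0 => /nDz.
  by have [k kz] := kernel_in_cauchy_space Dz; exists k.
have [k kE] := choice hk.
have kcauchy (xi : C) (e : R) : cabs xi <= 1 -> 0 < e -> exists2 d : R, 0 < d &
    forall z z', disc z -> disc z' -> cabs (z - xi) < d -> cabs (z' - xi) < d ->
      rnorm (k z - k z') <= e.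
  move=> xi1 e0; have e8 : 0 < e / 8 by rewrite divr_gt0.
  have [d d0 hd] := ge xi1 e8; exists d => // z z' Dz Dz' zx zx'.
  have -> : e = 8 * (e / 8) by field.
  apply: (kernel_rnorm_le Dz Dz' e8 (kE z Dz) (kE z' Dz')) => p pb.
  exact: hd.
(* The limit is taken along one sequence of the disc tending to [xi]; the Cauchy condition makes it
   a limit along the whole disc. *)
have hPhi (xi : C) : exists l : cauchy_space R, cabs xi <= 1 -> forall e : R, 0 < e ->
    exists2 d : R, 0 < d & forall z, disc z -> cabs (z - xi) < d -> rnorm (k z - l) <= e.
  have [xi1|nxi] := pselect (cabs xi <= 1); last by exists 0 => /nxi.
  have hz n : exists z, disc z /\ cabs (z - xi) < n.+1%:R^-1.
    have n0 : 0 < n.+1%:R^-1 :> R by rewrite invr_gt0.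
    by have [z Dz zx] := disc_near xi1 n0; exists z.
  have [z zP] := choice hz.
  have znear (d : R) : 0 < d -> exists N, forall n, (N <= n)%N -> cabs (z n - xi) < d.
    move=> d0; exists (Num.truncn d^-1) => n Nn; rewrite (lt_trans (proj2 (zP n)))//.
    rewrite -[ltRHS]invrK ltf_pV2 ?posrE ?invr_gt0//.
    by rewrite (lt_le_trans (truncnS_gt _))// ler_nat ltnS.
  have [|l hl] := @cauchy_space_complete R (fun n => k (z n)).
    move=> e e0; have [d d0 hd] := kcauchy xi e xi1 e0; have [N hN] := znear d d0.
    by exists N => m n Nm Nn; apply: hd; [case: (zP m)|case: (zP n)|exact: hN|exact: hN].
  exists l => _ e e0; have e2 : 0 < e / 2 by rewrite divr_gt0.
  have [d d0 hd] := kcauchy xi _ xi1 e2; exists d => // y Dy yx.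
  have [N hN] := znear d d0; have [N' hN'] := hl _ e2.
  pose n := maxn N N'.
  have -> : k y - l = (k y - k (z n)) + (k (z n) - l) by rewrite addrA subrK.
  rewrite (le_trans (ler_rnormD _ _))// [leRHS]splitr [rnorm (k (z n) - l)]rnormB.
  apply: lerD; last by apply: hN'; exact: leq_maxr.
  by apply: hd => //; [case: (zP n)|apply: hN; exact: leq_maxl].
have [Phi PhiE] := choice hPhi.
have Phi_k z : disc z -> Phi z = k z.
  move=> Dz; have /discP/ltW z1 := Dz; apply/eqP; rewrite eq_sym -subr_eq0 -normr_eq0.
  rewrite rnormE (_ : rnorm _ = 0)//; apply/eqP; rewrite eq_le rnorm_ge0 andbT.
  apply/ler_addgt0Pl => e e0; rewrite addr0.
  have [d d0 hd] := PhiE z z1 e e0; apply: hd => //.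
  by rewrite subrr cabs0.
have cPhi : {within closed_disc, continuous Phi}.
  apply/subspace_continuousP => xi /closed_discP xi1.
  move=> A /nbhs_rnormP[e e0 eA].
  have e3 : 0 < e / 3 by rewrite divr_gt0.
  have [d d0 hd] := PhiE xi xi1 _ e3.
  (* The remaining d / 2 leaves room for a point of the disc near [y] at which both limits are
     compared. *)
  apply/nbhs_cabsP; exists (d / 2); first by rewrite divr_gt0.
  move=> y yx /closed_discP y1; apply: eA.
  have [d' d0' hd'] := PhiE y y1 _ e3.
  have dd : 0 < Num.min d' (d / 2) by rewrite lt_min d0' divr_gt0.
  have [z Dz] := disc_near y1 dd; rewrite lt_min => /andP[zy1 zy2].
  have -> : Phi y - Phi xi = (k z - Phi xi) - (k z - Phi y) by rewrite opprB [RHS]addrC addrA subrK.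
  rewrite (le_lt_trans (ler_rnormD _ _))// rnormN.
  have h1 := hd' z Dz zy1.
  have zx : cabs (z - xi) < d.
    have -> : z - xi = (z - y) + (y - xi) by rewrite addrA subrK.
    by rewrite (le_lt_trans (ler_cabsD _ _))// [ltRHS]splitr ltrD.
  have h2 := hd z Dz zx.
  by rewrite (le_lt_trans (lerD h2 h1))//; lra.
split; first by move=> _ [z Dz <-]; exists (k z); exact: kE.
apply: (precompact_of_compact (K := Phi @` closed_disc)).
  exact: continuous_compact cPhi (@closed_disc_compact R).
(* An element of the space vanishes off the disc, so it is determined by its agreement with the
   kernel on the disc. *)
move=> h [_ [z Dz <-] hz]; exists z; first exact: disc_closed_disc.
rewrite Phi_k//; apply/val_inj/funext => w.
have [Dw|nDw] := pselect (disc w).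
  by rewrite -[LHS]/(k z w) (kE z Dz) ?inE// -hz ?inE.
have /cauchy_predP[_ /(_ w nDw) h0] := valP h.
by have /cauchy_predP[_ /(_ w nDw) k0] := valP (k z); rewrite k0 h0.
Qed.

End kernel_space.

Theorem theorem1p7 (R : realType) (g : R[i] -> R[i]) (hg : analytic disc g) :
  [<-> Tg_compact (@Hinf_fun R) (@Hinf_fun R) g;
       Tg_compact (@disc_algebra_fun R) (@disc_algebra_fun R) g;
       Tg_compact (@Hinf_fun R) (@disc_algebra_fun R) g;
       Tg_compact (@disc_algebra_fun R) (@Hinf_fun R) g;
       cauchy_relatively_compact [set G_H2 g z | z in disc]].
Proof.
(* Both (iv) and (v) yield this hypothesis. Since (i) and (ii) imply (iv), and (iii) implies (i),
   (ii) and (iv), the cycle closes through it. *)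
have compact_iii : Tp_bounded g /\ Tp_peak g ->
    Tg_compact (@Hinf_fun R) (@disc_algebra_fun R) g.
  move=> [gb gp]; apply: equicontinuous_Tg_compact => //.
  exact: Tp_bounded_peak_equicontinuous.
have iv_bounded := Tg_compact_bounded hg.
tfae.
- by move=> /Tg_compact_restrict/iv_bounded/compact_iii/Tg_compact_restrict.
- by move=> /Tg_compact_widen/iv_bounded/compact_iii.
- by move=> /Tg_compact_restrict/Tg_compact_widen.
- move=> /iv_bounded[gb gp]; apply: equicontinuous_kernel_compact => //.
  exact: Tp_bounded_peak_equicontinuous.
- by move=> /(kernel_compact_bounded hg)/compact_iii/Tg_compact_widen.
Qed.
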